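(* Let $k,N\in\mathbb N$, let $\Omega\subset\mathbb R^k$ be open, let $\mathbb K\in\{\mathbb R,\mathbb C\}$, and let $f_1,\dots,f_N\colon\Omega\to\Omega$, $g_1,\dots,g_N\colon\Omega\to\mathbb K$, $h_0\colon\Omega\to\mathbb K$ be functions satisfying hypothesis (H) (with constants $K$ and $L$ as in (H)). Let $\psi$ be as in the context and assume $h_0\in L^{\psi,1}(\Omega,\mathbb K)$. Suppose there is a real constant $\alpha\in[0,\tfrac12)$ such that $$|g_n(x)|\le \alpha\min\Big\{\frac{|J_{f_n}(x)|}{KL},\frac1N\Big\}\quad\text{for all } n\in\{1,\dots,N\}\text{ and almost all }x\in\Omega.$$ Then the elementary solution of the equation $\varphi(x)=\sum_{n=1}^N g_n(x)\varphi(f_n(x))+h_0(x)$ in $L^{\psi,1}(\Omega,\mathbb K)$ exists, it is the unique solution of this equation in $L^{\psi,1}(\Omega,\mathbb K)$, and for every $j\in\mathbb N\cup\{0\}$ $$\Big\|\sum_{i=j}^\infty P^i h_0\Big\|_{L^{\psi,1}(\Omega,\mathbb K)}\le \frac{(2\alpha)^j}{1-2\alpha}\|h_0\|_{L^{\psi,1}(\Omega,\mathbb K)}.$$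
   Context: $\mu$ denotes $k$-dimensional Lebesgue measure. A Young function is a non-decreasing, left-continuous, convex $\Psi\colon[0,\infty)\to[0,\infty]$ with $\lim_{t\to0+}\Psi(t)=\Psi(0)=0$ and $\lim_{t\to\infty}\Psi(t)=\infty$. Fix a strictly increasing Young function $\psi\colon[0,\infty)\to[0,\infty)$ satisfying $\Delta_2$ globally (there is $d\in(1,\infty)$ with $\psi(2t)\le d\psi(t)$ for all $t>0$) and $\lim_{t\to0+}\psi(t)/t=\lim_{t\to\infty}t/\psi(t)=0$. Define $\tau(0)=0$ and $\tau(t)=1/\psi(1/t)$ for $t>0$; $\tau$ is a strictly increasing bijection of $[0,\infty)$, and $\tau^{-1}$ denotes its inverse (with $\tau^{-1}(\infty)=\infty$). For measurable $f\colon\Omega\to\mathbb K$ the distribution function is $\mu_f(s)=\mu(\{x\in\Omega:|f(x)|>s\})$. The Lorentz space $L^{\psi,1}(\Omega,\mathbb K)$ is the set of $f\in L^1_{\mathrm{loc}}(\Omega,\mathbb K)$ with $\|f\|_{L^{\psi,1}(\Omega,\mathbb K)}:=\int_0^\infty\tau^{-1}(\mu_f(s))\,ds<\infty$ (functions equal a.e. identified). Approximate differential: a linear map $A\colon\mathbb R^k\to\mathbb R^k$ is an approximate differential of a measurable $F\colon\Omega\to\mathbb R^k$ at $x_0$ if for every $\varepsilon>0$ the point $x_0$ is a density point of $\{x\in\Omega\setminus\{x_0\}:\|F(x)-F(x_0)-A(x-x_0)\|/\|x-x_0\|<\varepsilon\}$. $J_F(x)$ is the determinant of the approximate differential of $F$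 at $x$, set to $0$ where $F$ is not approximately differentiable. $F$ satisfies Luzin's condition N if it maps Lebesgue-null sets to Lebesgue-null sets. Hypothesis (H): $f_1,\dots,f_N$ are measurable, almost everywhere approximately differentiable and satisfy Luzin's condition N; for every $n$ and every null set $M\subset\mathbb R^k$, $f_n^{-1}(M)$ is null; there is $K\in\mathbb N$ such that for every $n$ the set $\{x\in\Omega:\operatorname{card} f_n^{-1}(x)>K\}$ is null; $g_1,\dots,g_N,h_0$ are measurable; and $L=\max\{l\in\{1,\dots,N\}: \mu(\bigcap_{i=1}^l f_{n_i}(\Omega))>0\text{ for some } n_1<\dots<n_l\}$. The operator $P$ is $P\psi=\sum_{n=1}^N g_n\cdot(\psi\circ f_n)$. The elementary solution of the equation in a normed function space $\mathcal F_0$ is the series $\sum_{i=0}^\infty P^i h_0$, when it converges in the norm of $\mathcal F_0$ to a function in $\mathcal F_0$ solving the equation. *)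

(* Defs.v *)
From HB Require Import structures.
From mathcomp Require Import all_boot all_order all_algebra.
From mathcomp Require Import all_classical all_reals all_analysis.
From mathcomp Require Import complex.
Import Order.TTheory GRing.Theory Num.Theory.
Import numFieldNormedType.Exports.

Set Implicit Arguments.
Unset Strict Implicit.
Unset Printing Implicit Defensive.

Local Open Scope ring_scope.
Local Open Scope classical_set_scope.

Section Defs.
Variable R : realType.

Definition enorm (k : nat) (x : 'rV[R]_k) : R :=
  Num.sqrt (\sum_(i < k) x 0 i ^+ 2).

Definition eball (k : nat) (x0 : 'rV[R]_k) (r : R) : set 'rV[R]_k :=
  [set x | enorm (x - x0) < r].

Definition box (k : nat) (a b : 'rV[R]_k) : set 'rV[R]_k :=
  [set x | forall i : 'I_k, a 0 i <= x 0 i < b 0 i].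

Definition box_vol (k : nat) (a b : 'rV[R]_k) : R :=
  \prod_(i < k) Num.max 0 (b 0 i - a 0 i).

Definition leb_outer (k : nat) (A : set 'rV[R]_k) : \bar R :=
  ereal_inf [set s | exists a b : nat -> 'rV[R]_k,
     A `<=` \bigcup_n box (a n) (b n) /\
     s = (\sum_(0 <= n <oo) (box_vol (a n) (b n))%:E)%E].

Definition leb_measurable (k : nat) (A : set 'rV[R]_k) : Prop :=
  forall T : set 'rV[R]_k,
    leb_outer T = (leb_outer (T `&` A) + leb_outer (T `&` ~` A))%E.

Definition leb_null (k : nat) (A : set 'rV[R]_k) : Prop := leb_outer A = 0%E.

Definition ae_on (k : nat) (Omega : set 'rV[R]_k) (P : 'rV[R]_k -> Prop) : Prop :=
  leb_null [set x | Omega x /\ ~ P x].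

(* Scalar field K (R or C): a normed Z-module over R (norm |.| : K -> R)
   together with its multiplication.                                   *)

Definition kopen (K : normedZmodType R) (U : set K) : Prop :=
  forall z, U z -> exists2 e : R, 0 < e & forall w, `|w - z| < e -> U w.

Definition kmeasurable (k : nat) (K : normedZmodType R)
    (Omega : set 'rV[R]_k) (u : 'rV[R]_k -> K) : Prop :=
  forall U : set K, kopen U -> leb_measurable (Omega `&` u @^-1` U).

Definition vmeasurable (k : nat) (Omega : set 'rV[R]_k)
    (F : 'rV[R]_k -> 'rV[R]_k) : Prop :=
  forall U : set 'rV[R]_k, open U -> leb_measurable (Omega `&` F @^-1` U).

Definition nn_integral (k : nat) (D : set 'rV[R]_k)
    (u : 'rV[R]_k -> \bar R) : \bar R :=
  ereal_sup [set v | exists s : seq (R * set 'rV[R]_k),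
     [/\ forall p, p \in s -> 0 <= p.1 /\ leb_measurable p.2 /\ p.2 `<=` D,
         forall x, D x -> ((\sum_(p <- s) p.1 * \1_(p.2) x)%:E <= u x)%E
       & v = (\sum_(p <- s) (p.1%:E * leb_outer p.2))%E]].

Definition L1loc (k : nat) (K : normedZmodType R)
    (Omega : set 'rV[R]_k) (u : 'rV[R]_k -> K) : Prop :=
  kmeasurable Omega u /\
  forall C : set 'rV[R]_k, compact C -> C `<=` Omega ->
    (nn_integral C (fun x => (`|u x|)%:E) < +oo)%E.

Definition young_function (psi : R -> R) : Prop :=
  (forall t, 0 <= t -> 0 <= psi t) /\
  (forall s t, 0 <= s -> s <= t -> psi s <= psi t) /\
  (forall t, 0 < t -> forall e, 0 < e -> exists2 d, 0 < d &
     forall u, t - d < u -> u <= t -> `|psi u - psi t| < e) /\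
  (forall s t l, 0 <= s -> 0 <= t -> 0 <= l <= 1 ->
     psi (l * s + (1 - l) * t) <= l * psi s + (1 - l) * psi t) /\
  psi 0 = 0 /\
  (forall e, 0 < e -> exists2 d, 0 < d &
     forall t, 0 < t -> t < d -> psi t < e) /\
  (forall M, exists T, forall t, T <= t -> M <= psi t).

Definition admissible_psi (psi : R -> R) : Prop :=
  [/\ young_function psi,
      (* strictly increasing *) forall s t, 0 <= s -> s < t -> psi s < psi t,
      (exists2 d, 1 < d & forall t, 0 < t -> psi (2 * t) <= d * psi t),
      (forall e, 0 < e -> exists2 d, 0 < d &
         forall t, 0 < t -> t < d -> psi t / t < e)
    &
      forall e, 0 < e -> exists T, forall t, T < t -> 0 < t -> t / psi t < e].

Definition tau (psi : R -> R) (t : R) : R :=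
  if t == 0 then 0 else (psi (t^-1))^-1.

Definition tau_inv (psi : R -> R) (u : \bar R) : \bar R :=
  match u with
  | r%:E => (xget 0 [set t | 0 <= t /\ tau psi t = r])%:E
  | +oo%E => +oo%E
  | -oo%E => 0%E
  end.

Definition distribution (k : nat) (K : normedZmodType R)
    (Omega : set 'rV[R]_k) (u : 'rV[R]_k -> K) (s : R) : \bar R :=
  leb_outer [set x | Omega x /\ s < `|u x|].

Definition lorentz_norm (psi : R -> R) (k : nat) (K : normedZmodType R)
    (Omega : set 'rV[R]_k) (u : 'rV[R]_k -> K) : \bar R :=
  (\int[lebesgue_measure]_(s in `[0%R, +oo[) tau_inv psi (distribution Omega u s))%E.

Definition in_Lpsi1 (psi : R -> R) (k : nat) (K : normedZmodType R)
    (Omega : set 'rV[R]_k) (u : 'rV[R]_k -> K) : Prop :=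
  L1loc Omega u /\ (lorentz_norm psi Omega u < +oo)%E.

(** x0 is a density point of A:
    mu(A /\ B(x0,r)) / mu(B(x0,r)) -> 1 as r -> 0+.  (The ratio is <= 1.) *)
Definition density_point (k : nat) (x0 : 'rV[R]_k) (A : set 'rV[R]_k) : Prop :=
  forall e, 0 < e -> exists2 d, 0 < d & forall r, 0 < r -> r < d ->
    ((1 - e)%:E * leb_outer (eball x0 r) <= leb_outer (A `&` eball x0 r))%E.

Definition approx_diff (k : nat) (Omega : set 'rV[R]_k)
    (F : 'rV[R]_k -> 'rV[R]_k) (x0 : 'rV[R]_k) (A : 'M[R]_k) : Prop :=
  forall e, 0 < e -> density_point x0
    [set x | Omega x /\ x <> x0 /\
       enorm (F x - F x0 - (x - x0) *m A) / enorm (x - x0) < e].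

Definition approx_differentiable (k : nat) (Omega : set 'rV[R]_k)
    (F : 'rV[R]_k -> 'rV[R]_k) (x0 : 'rV[R]_k) : Prop :=
  exists A, approx_diff Omega F x0 A.

Definition jacobian (k : nat) (Omega : set 'rV[R]_k)
    (F : 'rV[R]_k -> 'rV[R]_k) (x : 'rV[R]_k) : R :=
  match pselect (approx_differentiable Omega F x) with
  | left h => \det (projT1 (cid h))
  | right _ => 0
  end.

Definition luzin_N (k : nat) (Omega : set 'rV[R]_k)
    (F : 'rV[R]_k -> 'rV[R]_k) : Prop :=
  forall M, M `<=` Omega -> leb_null M -> leb_null (F @` M).

Definition null_preimages (k : nat) (Omega : set 'rV[R]_k)
    (F : 'rV[R]_k -> 'rV[R]_k) : Prop :=
  forall M, leb_null M -> leb_null (Omega `&` F @^-1` M).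

Definition many_preimages (k : nat) (Omega : set 'rV[R]_k)
    (F : 'rV[R]_k -> 'rV[R]_k) (K : nat) : set 'rV[R]_k :=
  [set x | Omega x /\ exists s : seq 'rV[R]_k,
     [/\ uniq s, size s = K.+1 & forall y, y \in s -> Omega y /\ F y = x]].

Definition images_cap (k N : nat) (Omega : set 'rV[R]_k)
    (f : 'I_N -> 'rV[R]_k -> 'rV[R]_k) (s : seq 'I_N) : set 'rV[R]_k :=
  [set y | forall n, n \in s -> (f n @` Omega) y].

Definition incr_tuple (N : nat) (s : seq 'I_N) : Prop :=
  sorted (fun a b : 'I_N => (a < b)%N) s /\ (0 < size s)%N.

Definition is_L (k N : nat) (Omega : set 'rV[R]_k)
    (f : 'I_N -> 'rV[R]_k -> 'rV[R]_k) (L : nat) : Prop :=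
  (exists s, [/\ incr_tuple s, size s = L & (0 < leb_outer (images_cap Omega f s))%E])
  /\ forall s, incr_tuple s -> (0 < leb_outer (images_cap Omega f s))%E ->
       (size s <= L)%N.

Definition hypH (k N : nat) (Kf : normedZmodType R) (Omega : set 'rV[R]_k)
    (f : 'I_N -> 'rV[R]_k -> 'rV[R]_k) (g : 'I_N -> 'rV[R]_k -> Kf)
    (h0 : 'rV[R]_k -> Kf) (K L : nat) : Prop :=
  (forall n, vmeasurable Omega (f n)) /\
  (forall n, ae_on Omega (approx_differentiable Omega (f n))) /\
  (forall n, luzin_N Omega (f n)) /\
  (forall n, null_preimages Omega (f n)) /\
  (forall n, leb_null (many_preimages Omega (f n) K)) /\
  (forall n, kmeasurable Omega (g n)) /\ kmeasurable Omega h0 /\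
  is_L Omega f L.

Definition opP (k N : nat) (Kf : normedZmodType R) (mul : Kf -> Kf -> Kf)
    (f : 'I_N -> 'rV[R]_k -> 'rV[R]_k) (g : 'I_N -> 'rV[R]_k -> Kf)
    (phi : 'rV[R]_k -> Kf) : 'rV[R]_k -> Kf :=
  fun x => \sum_(n < N) mul (g n x) (phi (f n x)).

Definition partial_sum (k N : nat) (Kf : normedZmodType R) (mul : Kf -> Kf -> Kf)
    (f : 'I_N -> 'rV[R]_k -> 'rV[R]_k) (g : 'I_N -> 'rV[R]_k -> Kf)
    (h0 : 'rV[R]_k -> Kf) (j m : nat) : 'rV[R]_k -> Kf :=
  fun x => \sum_(j <= i < j + m) iter i (opP mul f g) h0 x.

Definition solves (k N : nat) (Kf : normedZmodType R) (mul : Kf -> Kf -> Kf)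
    (Omega : set 'rV[R]_k)
    (f : 'I_N -> 'rV[R]_k -> 'rV[R]_k) (g : 'I_N -> 'rV[R]_k -> Kf)
    (h0 : 'rV[R]_k -> Kf) (phi : 'rV[R]_k -> Kf) : Prop :=
  ae_on Omega (fun x => phi x = opP mul f g phi x + h0 x).

Definition tail_converges (psi : R -> R) (k N : nat) (Kf : normedZmodType R)
    (mul : Kf -> Kf -> Kf) (Omega : set 'rV[R]_k)
    (f : 'I_N -> 'rV[R]_k -> 'rV[R]_k) (g : 'I_N -> 'rV[R]_k -> Kf)
    (h0 : 'rV[R]_k -> Kf) (j : nat) (T : 'rV[R]_k -> Kf) : Prop :=
  (fun m => lorentz_norm psi Omega (fun x => T x - partial_sum mul f g h0 j m x))
    @ \oo --> 0%E.

Definition theorem3p6_claim (Kf : normedZmodType R) (mul : Kf -> Kf -> Kf) : Prop :=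
  forall (k N : nat) (Omega : set 'rV[R]_k)
    (f : 'I_N -> 'rV[R]_k -> 'rV[R]_k) (g : 'I_N -> 'rV[R]_k -> Kf)
    (h0 : 'rV[R]_k -> Kf) (K L : nat) (psi : R -> R) (alpha : R),
  (0 < k)%N -> (0 < N)%N -> (0 < K)%N ->
  open Omega ->
  (forall n x, Omega x -> Omega (f n x)) ->
  hypH Omega f g h0 K L ->
  admissible_psi psi ->
  in_Lpsi1 psi Omega h0 ->
  0 <= alpha -> alpha < 2^-1 ->
  (forall n, ae_on Omega (fun x =>
     `|g n x| <= alpha * Num.min (`|jacobian Omega (f n) x| / (K * L)%:R) (N%:R^-1))) ->
  (exists phi, [/\ in_Lpsi1 psi Omega phi,
                   tail_converges psi mul Omega f g h0 0 phi
                 & solves mul Omega f g h0 phi])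
  /\
  (forall phi1 phi2, in_Lpsi1 psi Omega phi1 -> in_Lpsi1 psi Omega phi2 ->
     tail_converges psi mul Omega f g h0 0 phi1 ->
     solves mul Omega f g h0 phi2 ->
     ae_on Omega (fun x => phi1 x = phi2 x))
  /\
  (forall j : nat,
     (exists T, in_Lpsi1 psi Omega T /\ tail_converges psi mul Omega f g h0 j T) /\
     forall T, in_Lpsi1 psi Omega T -> tail_converges psi mul Omega f g h0 j T ->
       (lorentz_norm psi Omega T <=
          ((2 * alpha) ^+ j / (1 - 2 * alpha))%:E * lorentz_norm psi Omega h0)%E).

End Defs.

(* Main.v *)
Require Import Defs.
From HB Require Import structures.
From mathcomp Require Import all_boot all_order all_algebra fingroup perm complex.
From mathcomp Require Import all_classical all_reals all_analysis.
From mathcomp Require Import measurable_realfun ring lra zify.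
Import Order.TTheory GRing.Theory Num.Theory.
Import numFieldNormedType.Exports.

(** Write [phi] for the inverse of [tau] and [||f||] for the integral of
    [phi (mu_f)]. As [phi] need not be concave, [||.||] need not be subadditive;
    but [phi] is nondecreasing and [phi t / t] nonincreasing, so that, for
    [0 <= w <= M] and every [b > 0],
      [||h + w|| <= ||h|| + M phi(b) + (phi(b) / b) int w],
    because [h] and [h + w] have distribution functions which differ by a shift
    of at most [M] and by an area of at most [int w]. Call cost of [v] a value
    of [sum_j (M_j phi(b_j) + (phi(b_j) / b_j) int w_j)] for a decomposition
    [v <= sum_j w_j] into bounded layers, so that [||h + v|| <= ||h|| + cost].
    Cutting [v] along the levels [lam ^ z], with [b_j] the measure of the [j]-th
    level set, gives a cost [2 lam ||v||] for each [lam > 1].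

    A cost is linear in the [L^infty] and [L^1] norms of the layers, and the
    operator [P] contracts both by [alpha]: the first because
    [|g_n| <= alpha / N], the second by the area formula (only the inequality is
    needed), because [|g_n| <= alpha |J_{f_n}| / (K L)] while a point of [Omega]
    is in at most [L] of the images [f_n(Omega)] and has at most [K] preimages
    in each. Hence [P^i h_0] has cost [2 lam alpha^i ||h_0||], and summing these
    costs and letting [lam] tend to [1] gives the convergence of the series, the
    uniqueness of its sum, and the estimates of its tails.

    For the area inequality, almost all of [{J_f <> 0}] is covered by countably
    many measurable pieces on which [f] is Lipschitz and so close to an
    invertible rational matrix [A] that it expands volumes by nearly
    [|det A|]. *)

Set Implicit Arguments.
Unset Strict Implicit.
Unset Printing Implicit Defensive.

Local Open Scope ring_scope.
Local Open Scope classical_set_scope.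

(** * Lorentz functionals of quasi-concave functions *)

(** The factor 2 has a single source. When [b_j] is the measure of the level set, the [L^infty] and
    the [L^1] term of a layer cost the same, and each is bounded by [lam] times a lower sum for the
    Lorentz functional. A function that is not cut into layers enters with factor 1. Hence the tail
    from [j >= 1] is bounded by [2 alpha^j / (1 - alpha)] and the whole series by
    [1 + 2 alpha / (1 - alpha)]; both are below the stated constants.

    On the geometric side the obstacle is measurability, since neither the images of [Om] nor the
    Jacobian come with any. Images are replaced by those of countable unions of compact sets on
    which the map is Lipschitz; the Jacobian occurs only in an inequality [a <= c * |J|] with [a]
    measurable, which each piece turns into a bound by the constant [|det A|].

    Everything is moved from [Om] to the whole space: moduli are extended by 0 and the maps by the
    identity. Real and complex scalars are treated together through [scalar_algebra]. *)

Section quasiconcave.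
Context {R : realType}.
Implicit Types phi : R -> R.

(** [qc_ratio] is the monotonicity of [phi t / t], cross-multiplied; with [qc_le] it forces
    continuity on the open half-line. [qc_unbounded] makes the extension by [+oo] at [+oo]
    continuous from below. *)
Record quasiconcave phi : Prop := QuasiConcave {
  qc0 : phi 0 = 0;
  qc_gt0 : forall t, 0 < t -> 0 < phi t;
  qc_le : forall s t, 0 <= s -> s <= t -> phi s <= phi t;
  qc_ratio : forall a b, 0 < b -> b <= a -> phi a * b <= phi b * a;
  qc_unbounded : forall M, exists2 t, 0 <= t & M <= phi t }.

Definition ext_phi phi (u : \bar R) : \bar R :=
  match u with
  | r%:E => (phi r)%:E
  | +oo%E => +oo%E
  | -oo%E => 0%E
  end.

Variable phi : R -> R.
Hypothesis qc : quasiconcave phi.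
Local Notation ephi := (ext_phi phi).
Local Open Scope ereal_scope.

Lemma qc_ge0 t : (0 <= t -> 0 <= phi t)%R.
Proof. by move=> t0; rewrite -(qc0 qc) (qc_le qc). Qed.

Lemma ext_phi_ge0 u : 0 <= u -> 0 <= ephi u.
Proof. by case: u => //= r; rewrite !lee_fin; exact: qc_ge0. Qed.

Lemma ext_phi_le u v : 0 <= u -> u <= v -> ephi u <= ephi v.
Proof.
case: u => [r| |] //; case: v => [s| |] //=; rewrite ?lee_fin ?leey //.
exact: qc_le.
Qed.

(** The excess [phi x - phi (min x b)] vanishes for [x <= b] and then grows at rate at most
    [phi b / b]: for [b <= x <= c] the ratio condition gives
    [phi c - phi x <= (c - x) * (phi x / x)]. Subtractions of values of [phi] are moved across so
    that the inequality extends to [+oo]. *)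
Lemma qc_incr a b c : (0 < b -> 0 <= a -> a <= c ->
  phi c + phi (Num.min a b) <=
  phi a + phi (Num.min c b) + (c - a) * (phi b / b))%R.
Proof.
move=> b0 a0 ac.
have r0 : (0 <= phi b / b)%R by rewrite divr_ge0 ?ltW// qc_gt0.
have [cb|bc] := leP c b.
  rewrite (min_idPl (le_trans ac cb)).
  rewrite addrC lerDl mulr_ge0// subr_ge0//.
have H x : (b <= x -> phi c - phi x <= (c - x) * (phi b / b) \/ c < x)%R.
  move=> bx; case: (leP x c) => [xc|]; [left|by right].
  have x0 : (0 < x)%R by exact: lt_le_trans bx.
  have h1 := qc_ratio qc x0 xc.
  have h2 := qc_ratio qc b0 bx.
  have h3 : (phi c - phi x <= (c - x) * (phi x / x))%R.
    rewrite mulrA ler_pdivlMr//; nra.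
  apply: (le_trans h3); rewrite ler_wpM2l ?subr_ge0//.
  by rewrite ler_pdivrMr// mulrAC ler_pdivlMr.
have [ab|ba] := leP a b.
  case: (H b (lexx b)) => [h|]; last by move/lt_trans => /(_ _ bc); rewrite ltxx.
  have : ((c - b) * (phi b / b) <= (c - a) * (phi b / b))%R by rewrite ler_wpM2r// lerB.
  by move: h; lra.
case: (H a (ltW ba)) => [h|]; first by lra.
by move/lt_le_trans => /(_ _ ac); rewrite ltxx.
Qed.

Lemma ext_phi_incr (G H D : \bar R) b : (0 < b)%R -> 0 <= H -> H <= G ->
  0 <= D -> G <= H + D ->
  ephi G + ephi (mine H b%:E) <=
  ephi H + ephi (mine G b%:E) + D * (phi b / b)%:E.
Proof.
move=> b0 H0 HG D0 GHD.
have r0 : (0 < phi b / b)%R by rewrite divr_gt0// qc_gt0.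
case: H H0 HG GHD => [h| |]// h0 hG GhD; last first.
  have h1 : 0 <= ephi (mine G b%:E).
    by apply: ext_phi_ge0; rewrite le_min (le_trans _ hG)//= lee_fin ltW.
  have h2 : 0 <= D * (phi b / b)%:E by rewrite mule_ge0// lee_fin ltW.
  by rewrite /= !addye ?leey// gt_eqF// (lt_le_trans ltNy0).
case: D D0 GhD => [d'| |]// d0 GhD; last first.
  have h1 : 0 <= ephi (mine G b%:E).
    by apply: ext_phi_ge0; rewrite le_min (le_trans _ hG)//= lee_fin ltW.
  rewrite gt0_mulye ?lte_fin// addey ?leey// gt_eqF//.
  by rewrite (lt_le_trans ltNy0)// adde_ge0// ext_phi_ge0.
case: G hG GhD => [g| |]// hg ghd; rewrite /= -?EFin_min.
rewrite /= -EFinM -!EFinD lee_fin.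
rewrite !lee_fin in h0 d0 hg; rewrite -EFinD lee_fin in ghd.
apply: (le_trans (qc_incr b0 h0 hg)).
by rewrite lerD2l (ler_wpM2r (ltW r0))// lerBlDl.
Qed.

(** The sequence is only known to exceed values below its limit, and these suffice:
    [phi (q r) >= q * phi r] at a finite limit [r], unboundedness of [phi] at [+oo]. *)
Lemma ext_phi_limit (u : (\bar R)^nat) l c : (forall n, 0 <= u n) ->
  u @ \oo --> l -> (forall n, ephi (u n) <= c) -> ephi l <= c.
Proof.
move=> u0 ul uc.
have l0 : 0 <= l by apply: cvge_ge ul; exact: nearW.
have c0 : 0 <= c by apply: le_trans (uc 0%N); exact: ext_phi_ge0.
have near_gt t : t%:E < l -> exists n, t%:E <= u n.
  move=> tl; have : \forall n \near \oo, t%:E < u n.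
    exact: (ul _ (open_nbhs_nbhs (conj (@open_ereal_gt_ereal _ t%:E) tl))).
  by move=> [n _ /(_ n (leqnn n)) h]; exists n; exact: ltW.
case: l l0 ul near_gt => [r| |]// l0 ul ngt.
  rewrite lee_fin le_eqVlt in l0; case/orP: l0 => [/eqP <-|r0].
    by rewrite /= (qc0 qc).
  case: c c0 uc => [c| |]// c0 uc; last by rewrite leey.
  rewrite lee_fin /=; apply/ler_addgt0Pl => e e0.
  have p0 := qc_gt0 qc r0.
  (* With this [q], [q * phi r > phi r - e], because [(phi r) ^ 2 > (phi r - e) * (phi r + e)]. *)
  pose q : R := (phi r / (phi r + e))%R.
  have q1 : (0 < q < 1)%R.
    by rewrite divr_gt0 ?addr_gt0//= ltr_pdivrMr ?addr_gt0// mul1r ltrDl.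
  have qr : (0 < q * r)%R by rewrite mulr_gt0//; case/andP: q1.
  have qrr : (q * r < r)%R by rewrite gtr_pMl//; case/andP: q1.
  have qrl : (q * r)%:E < r%:E by rewrite lte_fin.
  have [n hn] := ngt (q * r)%R qrl.
  have : ephi (q * r)%:E <= c%:E.
    by apply: le_trans (uc n); apply: ext_phi_le => //; rewrite lee_fin ltW.
  rewrite /= lee_fin => pc.
  have := qc_ratio qc qr (ltW qrr).
  rewrite mulrA ler_pM2r// => h.
  have : (phi r * q <= c)%R by exact: le_trans h pc.
  rewrite /q mulrA ler_pdivrMr ?addr_gt0// => h2.
  rewrite leNgt; apply/negP => h3.
  have : (c * (phi r + e) < (phi r - e) * (phi r + e))%R.
    by rewrite ltr_pM2r ?addr_gt0//; lra.
  nra.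
case: c c0 uc => [c| |]// c0 uc.
have [t t0 ht] := qc_unbounded qc (c + 1)%R.
have [n hn] := ngt t (ltry _).
have : ephi t%:E <= c%:E by apply: le_trans (uc n); exact: ext_phi_le.
by rewrite /= lee_fin => /(le_trans ht); rewrite gerDl ler10.
Qed.

Lemma cvg_ext_phi (u : (\bar R)^nat) l : (forall n, 0 <= u n) ->
  nondecreasing_seq u -> u @ \oo --> l -> ephi (u n) @[n --> \oo] --> ephi l.
Proof.
move=> u0 ndu ul.
have ndp : nondecreasing_seq (ephi \o u).
  by move=> m n mn; apply: ext_phi_le => //; exact: ndu.
have := ereal_nondecreasing_cvgn ndp.
rewrite (_ : ereal_sup _ = ephi l)//; apply/eqP; rewrite eq_le; apply/andP; split.
  apply: ge_ereal_sup => _ [n _ <-] /=; apply: ext_phi_le => //.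
  have -> : l = ereal_sup (range u).
    by apply: cvg_unique ul (ereal_nondecreasing_cvgn ndu).
  by apply: ereal_sup_ubound; exists n.
apply: (ext_phi_limit u0 ul) => n.
by apply: ereal_sup_ubound; exists n.
Qed.

End quasiconcave.

Section real_line.
Context {R : realType}.
Local Open Scope ereal_scope.
Local Notation leb := (@lebesgue_measure R).

Lemma nonincreasing_emeasurable (f : R -> \bar R) :
  (forall s t, (s <= t)%R -> f t <= f s) -> measurable_fun [set: R] f.
Proof.
move=> fni; apply: (measurability _ (ErealGenOInfty.measurableE R)).
move=> /= _ [_ [r ->] <-].
rewrite setTI; apply: is_interval_measurable => s t/=.
rewrite !in_itv/= !andbT => fs ft u /andP[su ut].
by rewrite in_itv/= andbT (lt_le_trans ft)// fni.
Qed.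

(** Serves to undo the shift by [M] that a summand bounded by [M] causes in a distribution function.
    Translation invariance comes from the uniqueness of the measure with given values on
    intervals. *)
Lemma integral_shift (f : R -> \bar R) (M : R) : measurable_fun setT f ->
  (forall s, 0 <= f s) ->
  \int[leb]_(s in `[M, +oo[) f (s - M)%R = \int[leb]_(s in `[0%R, +oo[) f s.
Proof.
move=> mf f0.
pose sh : R -> measurableTypeR R := fun s => (s - M)%R.
have msh : measurable_fun [set: R] sh by exact: measurable_funB.
rewrite (_ : `[M, +oo[%classic = sh @^-1` `[0%R, +oo[); last first.
  by apply/seteqP; split => s /=; rewrite !in_itv/= !andbT subr_ge0.
transitivity (\int[pushforward leb sh]_(y in `[0%R, +oo[) f y).
  by rewrite ge0_integral_pushforward//; exact: measurable_funTS.
apply: eq_measure_integral => //= A mA AS.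
apply/esym/lebesgue_measure_unique => //= _ [[a b]] _ <-.
rewrite /pushforward.
rewrite (_ : sh @^-1` _ = `](a + M)%R, (b + M)%R]%classic); last first.
  by apply/seteqP; split => s /=; rewrite !in_itv/= /sh ltrBrDr lerBlDr.
rewrite !lebesgue_measure_itv/= !lte_fin ltrD2r; case: ifPn => // _.
by rewrite -!EFinD; congr EFin; ring.
Qed.

End real_line.

(** * Adding layers: the cost inequality *)

Section lorentz.
Context d (T : measurableType d) {R : realType}.
Variable mu : {sigma_finite_measure set T -> \bar R}.
Variable phi : R -> R.
Hypothesis qc : quasiconcave phi.
Local Open Scope ereal_scope.
Local Notation leb := (@lebesgue_measure R).
Implicit Types (v w h : T -> \bar R).

Definition distr w (s : R) : \bar R := mu [set x | s%:E < w x].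

Definition lorentz w : \bar R :=
  \int[leb]_(s in `[0%R, +oo[) ext_phi phi (distr w s).

Lemma measurable_superlevel w s : measurable_fun setT w ->
  measurable [set x | s%:E < w x].
Proof.
by move=> mw; rewrite -[X in measurable X]setTI; exact: emeasurable_fun_o_infty.
Qed.

Lemma distr_ge0 w s : 0 <= distr w s. Proof. exact: measure_ge0. Qed.

Hint Resolve distr_ge0 : core.

Lemma distr_nonincreasing w s t : measurable_fun setT w -> (s <= t)%R ->
  distr w t <= distr w s.
Proof.
move=> mw st; apply: le_measure; rewrite ?inE//; try exact: measurable_superlevel.
by move=> x /=; apply: le_lt_trans; rewrite lee_fin.
Qed.

Lemma ext_phi_distr_ge0 w s : 0 <= ext_phi phi (distr w s).
Proof. exact: ext_phi_ge0. Qed.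

Hint Resolve ext_phi_distr_ge0 : core.

Lemma measurable_ext_phi_distr w : measurable_fun setT w ->
  measurable_fun setT (fun s => ext_phi phi (distr w s)).
Proof.
move=> mw; apply: nonincreasing_emeasurable => s t st.
by apply: ext_phi_le => //; exact: distr_nonincreasing.
Qed.

Lemma lorentz_ge0 w : 0 <= lorentz w.
Proof. by apply: integral_ge0 => s _. Qed.

Lemma distr_ae_le v w s : measurable_fun setT v -> measurable_fun setT w ->
  {ae mu, forall x, v x <= w x} -> distr v s <= distr w s.
Proof.
move=> mv mw [N [mN N0 sN]].
have mW := measurable_superlevel s mw.
apply: (@le_trans _ _ (mu ([set x | s%:E < w x] `|` N))).
  apply: le_measure; rewrite ?inE//; first exact: measurable_superlevel.
    exact: measurableU.
  move=> x /= sv; have [vw|/negP vw] := boolP (v x <= w x).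
    by left => /=; exact: lt_le_trans vw.
  by right; exact: sN.
apply: (le_trans (measureU2 mu mW mN)).
by rewrite [X in _ + X](N0 : mu N = 0) adde0.
Qed.

Lemma lorentz_ae_le v w : measurable_fun setT v -> measurable_fun setT w ->
  {ae mu, forall x, v x <= w x} -> lorentz v <= lorentz w.
Proof.
move=> mv mw vw; apply: ge0_le_integral => //.
- by apply: measurable_funTS; exact: measurable_ext_phi_distr.
- by apply: measurable_funTS; exact: measurable_ext_phi_distr.
- by move=> s _; apply: ext_phi_le => //; exact: distr_ae_le.
Qed.

(** Strict superlevel sets of the [w n] increase to that of the limit, so the distribution functions
    increase to the limiting one; [phi] preserves this, and monotone convergence applies. *)
Lemma lorentz_limit (w : nat -> T -> \bar R) (l : T -> \bar R) c :
  (forall n, measurable_fun setT (w n)) -> measurable_fun setT l ->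
  (forall x, nondecreasing_seq (w ^~ x)) ->
  (forall x, w n x @[n --> \oo] --> l x) ->
  (forall n, lorentz (w n) <= c) -> lorentz l <= c.
Proof.
move=> mw ml ndw wl wc.
have ubw x n : w n x <= l x.
  have -> : l x = ereal_sup (range (w ^~ x)).
    by apply: cvg_unique (wl x) (ereal_nondecreasing_cvgn (ndw x)).
  by apply: ereal_sup_ubound; exists n.
have nd_d s : nondecreasing_seq (fun n => distr (w n) s).
  move=> m n mn; apply: le_measure; rewrite ?inE; try exact: measurable_superlevel.
  by move=> x /= /lt_le_trans; apply; exact: ndw.
have cvd s : distr (w n) s @[n --> \oo] --> distr l s.
  rewrite /distr; have -> : [set x | s%:E < l x] = \bigcup_n [set x | s%:E < w n x].
    apply/seteqP; split => x /=; last first.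
      by move=> [n _ /= h]; exact: lt_le_trans (ubw x n).
    move=> sl; have : \forall n \near \oo, s%:E < w n x.
      exact: (wl x _ (open_nbhs_nbhs (conj (@open_ereal_gt_ereal _ s%:E) sl))).
    by move=> [n _ /(_ n (leqnn n)) ?]; exists n.
  apply: nondecreasing_cvg_mu.
  - by move=> n; exact: measurable_superlevel.
  - by apply: bigcup_measurable => n _; exact: measurable_superlevel.
  - move=> m n mn; apply/subsetPset => x /= /lt_le_trans; apply; exact: ndw.
have cvp s := cvg_ext_phi qc (fun n => distr_ge0 (w n) s) (nd_d s) (cvd s).
have -> : lorentz l = limn (fun n => lorentz (w n)).
  rewrite /lorentz -monotone_convergence//.
  - by apply: eq_integral => s _; apply/esym/cvg_lim => //; exact: cvp.
  - by move=> n; apply: measurable_funTS; exact: measurable_ext_phi_distr.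
  - by move=> s _ m n mn; apply: ext_phi_le => //; exact: nd_d.
apply: lime_le; last exact: nearW.
apply: ereal_nondecreasing_is_cvgn => m n mn.
by apply: lorentz_ae_le => //; apply: aeW => x; exact: ndw.
Qed.

(** Tonelli on the region between the graphs of [h] and [h + w]: its slice over [x] has length at
    most [w x]. The shell at height [s] is what the superlevel set gains when [w] is added. *)
Lemma integral_shell_le h w : measurable_fun setT h -> measurable_fun setT w ->
  (forall x, 0 <= h x) -> (forall x, 0 <= w x) ->
  let shell s := mu [set x | h x <= s%:E < h x + w x] in
  measurable_fun setT shell /\
  \int[leb]_(s in `[0%R, +oo[) shell s <= \int[mu]_x w x.
Proof.
move=> mh mw h0 w0 shell.
pose A : set (T * R) := [set z | h z.1 <= (z.2)%:E < h z.1 + w z.1].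
have mA : measurable A.
  have m1 : measurable_fun [set: T * R] (fun z => h z.1).
    exact: measurableT_comp.
  have m2 : measurable_fun [set: T * R] (fun z => (z.2)%:E).
    by apply/measurable_EFinP; exact: measurable_snd.
  have m3 : measurable_fun [set: T * R] (fun z => h z.1 + w z.1).
    by apply: emeasurable_funD => //; exact: measurableT_comp.
  rewrite (_ : A = ([set: T * R] `&` [set z | h z.1 <= (z.2)%:E]) `&`
     ([set: T * R] `&` [set z | (z.2)%:E < h z.1 + w z.1])); last first.
    rewrite !setTI; apply/seteqP; split => z; rewrite /A /=; first by move/andP.
    by move=> [-> ->].
  by apply: measurableI; [exact: measurable_lee|exact: measurable_lte].
pose f (z : T * R) : \bar R := (\1_A z)%:E.
have mf : measurable_fun setT f by exact/measurable_EFinP/measurable_indic.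
have f0 z : 0 <= f z by rewrite lee_fin.
have shellE s : shell s = \int[mu]_x f (x, s).
  pose B : set T := [set x | h x <= s%:E < h x + w x].
  rewrite /f (eq_integral (fun x => (\1_B x)%:E)).
    rewrite integral_indic ?setIT//.
    have := measurable_ysection s mA.
    rewrite (_ : ysection A s = [set x | h x <= s%:E < h x + w x])//.
    by apply/seteqP; split => x /=; rewrite /ysection /A /= inE.
  by move=> x _; rewrite !indicE; congr ((_ : bool)%:R%:E); apply/idP/idP; rewrite !inE.
have mshell : measurable_fun setT shell.
  rewrite (_ : shell = fubini_G mu f); last by apply/funext => s; rewrite shellE.
  exact: measurable_fun_fubini_tonelli_G.
split=> //.
apply: (@le_trans _ _ (\int[leb]_s shell s)).
  by apply: ge0_subset_integral => // s _; exact: measure_ge0.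
have -> : shell = (fun s => \int[mu]_x f (x, s)) by apply/funext => s; exact: shellE.
rewrite -(fubini_tonelli (m1 := mu) (m2 := leb) f)//.
apply: ge0_le_integral => //.
- by move=> x _; apply: integral_ge0.
- exact: (measurable_fun_fubini_tonelli_F (m2 := leb) f).
move=> x _; rewrite /f.
pose B : set R := [set s | h x <= s%:E < h x + w x].
have -> : (fun s : R => (\1_A (x, s))%:E : \bar R) = (fun s => (\1_B s)%:E).
  by apply/funext => s; rewrite !indicE; congr ((_ : bool)%:R%:E); apply/idP/idP; rewrite !inE.
(* Over a point where [h] is infinite the slice is empty. *)
have := h0 x; rewrite /B; case hx : (h x) => [r| |]// r0; last first.
  rewrite (eq_integral (cst 0)) ?integral0// => s _.
  by rewrite indicE memNset.
have := w0 x; case wx : (w x) => [t| |]// t0; last by rewrite leey.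
rewrite (_ : [set s | _] = `[r, (r + t)%R[%classic); last first.
  by apply/seteqP; split => s /=; rewrite in_itv/= -EFinD !lee_fin lte_fin.
rewrite integral_indic// setIT [leLHS](lebesgue_measure_itv (Interval (BLeft r) (BLeft (r + t)%R)))/= lte_fin; case: ifPn => // _.
by rewrite -EFinD addrAC subrr add0r.
Qed.

(** [phi] is split at the level [phi b]. The truncation [phi (min _ b)] is at most [phi b], so a
    shift by [M] costs it at most [M * phi b]; the excess grows at rate at most [phi b / b] in the
    measure of the shells, whose integral is at most that of [w]. *)
Lemma lorentz_add_bounded h w (M b : R) :
  measurable_fun setT h -> measurable_fun setT w ->
  (forall x, 0 <= h x) -> (forall x, 0 <= w x <= M%:E) ->
  (0 <= M)%R -> (0 < b)%R ->
  lorentz (h \+ w) <=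
  lorentz h + ((M * phi b)%:E + (phi b / b)%:E * \int[mu]_x w x).
Proof.
move=> mh mw h0 wM M0 b0.
have w0 x : 0 <= w x by case/andP: (wM x).
have mhw : measurable_fun setT (h \+ w) by exact: emeasurable_funD.
have r0 : (0 <= phi b / b)%R by rewrite divr_ge0 ?ltW// (qc_gt0 qc).
have iw0 : 0 <= \int[mu]_x w x by apply: integral_ge0.
have c0 : 0 <= (M * phi b)%:E + (phi b / b)%:E * \int[mu]_x w x.
  by rewrite adde_ge0 ?mule_ge0// lee_fin mulr_ge0// ltW// (qc_gt0 qc).
have [->|hfin] := eqVneq (lorentz h) +oo.
  by rewrite addye ?leey// gt_eqF// (lt_le_trans ltNy0).
pose G := distr (h \+ w); pose H := distr h.
pose trunc (X : R -> \bar R) s := ext_phi phi (mine (X s) b%:E).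
have trunc0 v s : 0 <= trunc (distr v) s.
  by apply: (ext_phi_ge0 qc); rewrite le_min distr_ge0 lee_fin ltW.
have mtrunc v : measurable_fun setT v -> measurable_fun setT (trunc (distr v)).
  move=> mv; apply: nonincreasing_emeasurable => s t st; apply: (ext_phi_le qc).
    by rewrite le_min distr_ge0 lee_fin ltW.
  by rewrite le_min !ge_min (distr_nonincreasing mv st) lexx orbT.
have [mD iD] := integral_shell_le mh mw h0 w0.
set D := (fun s => mu _) in mD iD.
have D0 s : 0 <= D s by exact: measure_ge0.
have HG s : H s <= G s.
  apply: distr_ae_le => //; apply: aeW => x /=; exact: leeDl.
have mset_shell s : measurable [set x | h x <= s%:E < h x + w x].
  rewrite (_ : [set _ | _] = (setT `&` [set x | h x <= s%:E]) `&`
    [set x | s%:E < (h \+ w) x]); last first.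
    rewrite setTI; apply/seteqP; split => x /=; first by move/andP.
    by move=> [-> ->].
  apply: measurableI; last exact: measurable_superlevel.
  exact: emeasurable_fun_infty_c.
have GHD s : G s <= H s + D s.
  apply: (le_trans _ (measureU2 mu (measurable_superlevel s mh) (mset_shell s))).
  apply: le_measure; rewrite ?inE; first exact: measurable_superlevel.
    by apply: measurableU => //; exact: measurable_superlevel.
  move=> x /= shw; have [hs|sh] := leP (h x) s%:E; last by left.
  by right; rewrite /= ?hs; exact: shw.
have iX : \int[leb]_(s in `[0%R, +oo[) trunc H s \is a fin_num.
  rewrite ge0_fin_numE; last by apply: integral_ge0 => s _; exact: trunc0.
  apply: (@le_lt_trans _ _ (lorentz h)); last by rewrite ltey.
  apply: ge0_le_integral => //.
  - by move=> s _; exact: trunc0.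
  - by apply: measurable_funTS; exact: mtrunc.
  - by apply: measurable_funTS; exact: measurable_ext_phi_distr.
  - move=> s _; apply: (ext_phi_le qc); last by rewrite ge_min lexx.
    by rewrite le_min distr_ge0 lee_fin ltW.
have truncG : \int[leb]_(s in `[0%R, +oo[) trunc G s <=
    (M * phi b)%:E + \int[leb]_(s in `[0%R, +oo[) trunc H s.
  (* Below [M] the integrand is at most [phi b]; from [M] on, the distribution of [h + w] at [s] is
     at most that of [h] at [s - M]. *)
  have U : `[0%R, +oo[%classic = `[0%R, M[%classic `|` `[M, +oo[%classic :> set R.
    apply/seteqP; split => s /=; rewrite !in_itv/= ?andbT.
      by move=> s0; case: (ltP s M) => sM; [left; rewrite s0|right].
    by move=> [/andP[]//|]; exact: le_trans.
  rewrite [leLHS](_ : _ = \int[leb]_(s in `[0%R, M[ `|` `[M, +oo[) trunc G s); last by rewrite -U.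
  rewrite ge0_integral_setU//; last 3 first.
  - by apply: measurable_funTS; exact: mtrunc.
  - by move=> s _; exact: trunc0.
  - apply/disj_setPS => s /= []; rewrite !in_itv/= andbT => /andP[_ sM].
    by rewrite leNgt sM.
  apply: leeD.
    have -> : (M * phi b)%:E = \int[leb]_(s in `[0%R, M[) cst (phi b)%:E s.
      rewrite integral_cst// [X in _ * X](lebesgue_measure_itv (Interval (BLeft 0%R) (BLeft M))).
      rewrite /= lte_fin; case: ltP => [_|M0']; first by rewrite -EFinB -EFinM subr0 mulrC.
      by rewrite (@le_anti _ _ M 0%R) ?M0 ?M0'// mul0r mule0.
    apply: ge0_le_integral => //.
    - by move=> s _; exact: trunc0.
    - by apply: measurable_funTS; exact: mtrunc.
    - move=> s _; apply: (ext_phi_le qc (v := b%:E)); last by rewrite ge_min lexx orbT.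
      by rewrite le_min distr_ge0 lee_fin ltW.
  rewrite -(integral_shift M (mtrunc _ mh) (trunc0 h)).
  apply: ge0_le_integral => //.
  - by move=> s _; exact: trunc0.
  - by apply: measurable_funTS; exact: mtrunc.
  - apply: measurable_funTS; apply: nonincreasing_emeasurable => s t st.
    apply: (ext_phi_le qc); first by rewrite le_min distr_ge0 lee_fin ltW.
    rewrite le_min !ge_min lexx orbT andbT (distr_nonincreasing mh)//.
    by rewrite lerB.
  - move=> s _; apply: (ext_phi_le qc); first by rewrite le_min distr_ge0 lee_fin ltW.
    rewrite le_min !ge_min lexx orbT andbT; apply/orP; left.
    apply: le_measure; rewrite ?inE; try exact: measurable_superlevel.
    move=> x /= shw; rewrite EFinB lteBlDr//; apply: (lt_le_trans shw).
    by rewrite leeD2l//; case/andP: (wM x).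
have main : lorentz (h \+ w) + \int[leb]_(s in `[0%R, +oo[) trunc H s <=
   lorentz h + \int[leb]_(s in `[0%R, +oo[) trunc G s +
   (phi b / b)%:E * \int[leb]_(s in `[0%R, +oo[) D s.
  have mp v : measurable_fun setT v ->
      measurable_fun (`[0%R, +oo[ : set R) (fun s => ext_phi phi (distr v s)).
    by move=> mv; apply: measurable_funTS; exact: measurable_ext_phi_distr.
  have mt v : measurable_fun setT v -> measurable_fun (`[0%R, +oo[ : set R) (trunc (distr v)).
    by move=> mv; apply: measurable_funTS; exact: mtrunc.
  have mD' : measurable_fun (`[0%R, +oo[ : set R) (fun s => (phi b / b)%:E * D s).
    by apply: measurable_funTS; exact: measurable_funeM.
  rewrite /lorentz -ge0_integralD//; last 3 first.
  - exact: mp.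
  - by move=> s _; exact: trunc0.
  - exact: mt.
  rewrite -ge0_integralD//; last 3 first.
  - exact: mp.
  - by move=> s _; exact: trunc0.
  - exact: mt.
  rewrite -ge0_integralZl//; last exact: measurable_funTS.
  rewrite -ge0_integralD//; last 3 first.
  - by move=> s _; rewrite adde_ge0// trunc0.
  - by apply: emeasurable_funD; [exact: mp|exact: mt].
  - by move=> s _; rewrite mule_ge0.
  apply: ge0_le_integral => //.
  - by move=> s _; rewrite adde_ge0// trunc0.
  - by apply: emeasurable_funD; [exact: mp|exact: mt].
  - by apply: emeasurable_funD => //; apply: emeasurable_funD; [exact: mp|exact: mt].
  - by move=> s _; rewrite (muleC _ (D s)); exact: ext_phi_incr.
rewrite -(leeD2rE _ _ iX); apply: (le_trans main).
apply: (@le_trans _ _ (lorentz h +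
    ((M * phi b)%:E + \int[leb]_(s in `[0%R, +oo[) trunc H s) +
    (phi b / b)%:E * \int[mu]_x w x)).
  apply: leeD; first exact: leeD2l.
  exact: lee_wpmul2l.
have aux (p q x y : \bar R) : p + (q + x) + y = p + (q + y) + x.
  by rewrite -!addeA (addeC x).
by rewrite aux.
Qed.

(** A relation rather than an infimum, so that a cost always comes with layers on which an operator
    can act. The domination is only almost everywhere, which absorbs null level sets. *)
Definition lorentz_cost v (c : \bar R) : Prop :=
  exists (w : nat -> T -> \bar R) (M b : nat -> R),
  [/\ forall j, measurable_fun setT (w j),
      forall j x, 0 <= w j x <= (M j)%:E,
      forall j, (0 <= M j)%R /\ (0 < b j)%R,
      {ae mu, forall x, v x <= \sum_(0 <= j <oo) w j x} &
      \sum_(0 <= j <oo) ((M j * phi (b j))%:E +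
        (phi (b j) / b j)%:E * \int[mu]_x w j x) <= c].

(** Layers are added one at a time, each paying its own cost on top of the unchanged [lorentz h];
    the infinite sum is reached by [lorentz_limit]. *)
Lemma lorentz_add_cost h v c : measurable_fun setT h -> measurable_fun setT v ->
  (forall x, 0 <= h x) -> (forall x, 0 <= v x) ->
  lorentz_cost v c -> lorentz (h \+ v) <= lorentz h + c.
Proof.
move=> mh mv h0 v0 [w [M [b [mw wM Mb vw wc]]]].
have w0 j x : 0 <= w j x by case/andP: (wM j x).
pose cost j := (M j * phi (b j))%:E + (phi (b j) / b j)%:E * \int[mu]_x w j x.
have cost0 j : 0 <= cost j.
  have [M0 b0] := Mb j.
  by rewrite adde_ge0 ?mule_ge0 ?lee_fin ?mulr_ge0 ?integral_ge0 ?invr_ge0// ltW//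
    (qc_gt0 qc).
pose S n x := h x + \sum_(0 <= j < n) w j x.
have mS n : measurable_fun setT (S n).
  by apply: emeasurable_funD => //; exact: emeasurable_sum.
have S0 n x : 0 <= S n x by rewrite adde_ge0// sume_ge0.
have Sc n : lorentz (S n) <= lorentz h + \sum_(0 <= j < n) cost j.
  elim: n => [|n IH].
    rewrite big_nil adde0 (_ : S 0%N = h)//.
    by apply/funext => x; rewrite /S big_nil adde0.
  have -> : S n.+1 = S n \+ w n.
    by apply/funext => x; rewrite /S big_nat_recr//= addeA.
  have [M0 b0] := Mb n.
  apply: (le_trans (lorentz_add_bounded (mS n) (mw n) (S0 n) (wM n) M0 b0)).
  by rewrite big_nat_recr//= [leRHS]addeA; exact: leeD2r.
pose l x := h x + \sum_(0 <= j <oo) w j x.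
have ml : measurable_fun setT l.
  by apply: emeasurable_funD => //; apply: ge0_emeasurable_sum.
apply: (@le_trans _ _ (lorentz l)).
  apply: lorentz_ae_le => //; first exact: emeasurable_funD.
  by apply: filterS vw => x vx /=; exact: leeD2l.
apply: (lorentz_limit mS ml).
- move=> x m n mn; rewrite /S leeD2l//.
  by apply: lee_sum_nneg_natr => // j _ _; exact: w0.
- move=> x; apply: cvgeD; [|exact: cvg_cst|].
    by rewrite ge0_adde_def// inE// nneseries_ge0.
  by apply: is_cvg_nneseries => *; exact: w0.
- move=> n; apply: (le_trans (Sc n)); rewrite leeD2l//.
  apply: le_trans wc; exact: nneseries_lim_ge.
Qed.

Lemma lorentz0 : lorentz (cst 0) = 0.
Proof.
rewrite /lorentz; apply: integral0_eq => s; rewrite /= in_itv/= andbT => s0.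
rewrite /distr (_ : [set _ | _] = set0) ?measure0 /= ?(qc0 qc)//.
by apply/seteqP; split => x //=; rewrite lte_fin ltNge s0.
Qed.

End lorentz.

(** * Finiteness, vanishing and local integrability *)

Section lorentz_finite.
Context d (T : measurableType d) {R : realType}.
Variable mu : {sigma_finite_measure set T -> \bar R}.
Variable phi : R -> R.
Hypothesis qc : quasiconcave phi.
Local Open Scope ereal_scope.
Local Notation leb := (@lebesgue_measure R).
Local Notation distr := (distr mu).
Local Notation lorentz := (lorentz mu phi).
Implicit Types (v w h : T -> \bar R).

Lemma lorentz_markov w s : measurable_fun setT w -> (0 <= s)%R ->
  s%:E * ext_phi phi (distr w s) <= lorentz w.
Proof.
move=> mw s0.
apply: (@le_trans _ _ (\int[leb]_(t in `[0%R, s]) ext_phi phi (distr w t))).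
  have -> : s%:E * ext_phi phi (distr w s) =
      \int[leb]_(t in `[0%R, s]) cst (ext_phi phi (distr w s)) t.
    rewrite integral_cst//.
    rewrite [X in _ = _ * X](lebesgue_measure_itv (Interval (BLeft 0%R) (BRight s))).
    rewrite /= lte_fin; case: ltP => [_|s0']; first by rewrite sube0 muleC.
    by rewrite (@le_anti _ _ s 0%R) ?s0 ?s0'// mul0e mule0.
  apply: ge0_le_integral => //.
  - by move=> t _; exact: (ext_phi_distr_ge0 _ qc).
  - by apply: measurable_funTS; exact: measurable_ext_phi_distr.
  - move=> t; rewrite /= in_itv/= => /andP[_ ts].
    by apply: (ext_phi_le qc); [exact: distr_ge0|exact: distr_nonincreasing].
apply: ge0_subset_integral => //.
- by apply: measurable_funTS; exact: measurable_ext_phi_distr.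
- by move=> t _; exact: (ext_phi_distr_ge0 _ qc).
- by move=> t /=; rewrite !in_itv/= andbT => /andP[].
Qed.

Lemma ext_phi_gt0 u : 0 < u -> 0 < ext_phi phi u.
Proof. by case: u => [r| |]//=; rewrite !lte_fin; exact: (qc_gt0 qc). Qed.

Lemma distr_fin_num w s : measurable_fun setT w -> lorentz w < +oo ->
  (0 < s)%R -> distr w s < +oo.
Proof.
move=> mw wfin s0; rewrite ltNge; apply/negP; rewrite leye_eq => /eqP dy.
have := lorentz_markov mw (ltW s0).
by rewrite dy /= gt0_muley ?lte_fin// leye_eq => /eqP h; rewrite h ltxx in wfin.
Qed.

(** By the Markov inequality, [n * phi m] stays below [lorentz w] for every [n], where [m] is the
    measure of the set where [w] is infinite. *)
Lemma lorentz_fin_ae w : measurable_fun setT w -> lorentz w < +oo ->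
  {ae mu, forall x, w x < +oo}.
Proof.
move=> mw wfin.
have mY : measurable [set x | w x = +oo].
  by rewrite -[X in measurable X]setTI; apply: (mw measurableT [set +oo]).
exists [set x | w x = +oo]; split => //; last first.
  by move=> x /= /negP; rewrite -leNgt leye_eq => /eqP.
set m := mu _.
have pm n : n%:R%:E * ext_phi phi m <= lorentz w.
  apply: le_trans (lorentz_markov mw (ler0n _ n)).
  apply: lee_wpmul2l; first by rewrite lee_fin.
  apply: (ext_phi_le qc); first exact: measure_ge0.
  apply: le_measure; rewrite ?inE//; first exact: measurable_superlevel.
  by move=> x /= ->; rewrite ltry.
apply/eqP; rewrite eq_le measure_ge0 andbT leNgt; apply/negP => m0.
have := ext_phi_gt0 m0.
have lw : lorentz w \is a fin_num by rewrite ge0_fin_numE// lorentz_ge0.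
case: (ext_phi phi m) pm => [p| |]// pm; last first.
  by move=> _; have := pm 1%N; rewrite mul1e leye_eq => /eqP h; rewrite h in lw.
rewrite lte_fin => p0.
have /archi_boundP := divr_ge0 (fine_ge0 (lorentz_ge0 mu qc w)) (ltW p0).
set n := Num.bound _; rewrite ltr_pdivrMr// => hn.
by have := pm n; rewrite -EFinM -(fineK lw) lee_fin leNgt hn.
Qed.

Lemma lorentz_eq0_ae w : measurable_fun setT w -> lorentz w = 0 ->
  {ae mu, forall x, w x <= 0}.
Proof.
move=> mw w0.
have d0 n : distr w n.+1%:R^-1 = 0.
  have s0 : (0 < n.+1%:R^-1 :> R)%R by rewrite invr_gt0.
  have := lorentz_markov mw (ltW s0); rewrite w0 => h.
  apply/eqP; rewrite eq_le distr_ge0 andbT leNgt; apply/negP => /ext_phi_gt0 p0.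
  by move: h; rewrite leNgt mule_gt0// lte_fin.
apply: (@negligibleS _ _ _ mu (\bigcup_n [set x | n.+1%:R^-1%:E < w x])); last first.
  apply: negligible_bigcup => n; apply/negligibleP; last exact: d0.
  exact: measurable_superlevel.
move=> x /= /negP; rewrite -ltNge => wx0.
case wx : (w x) wx0 => [r| |]// r0; last by exists 0%N => //=; rewrite wx ltry.
rewrite lte_fin in r0.
have ri0 : (0 <= r^-1)%R by rewrite invr_ge0 ltW.
have := archi_boundP ri0; set n := Num.bound _ => hn; exists n => //=.
by rewrite wx lte_fin invf_plt ?posrE// (lt_le_trans hn)// ler_nat.
Qed.

(** On a set of measure at most [a], a layer has integral at most [a / phi a] times its cost. If
    [a <= b j] the sup-norm term pays, since [phi a <= phi (b j)]; otherwise the [L^1] term pays,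
    since [phi a / a <= phi (b j) / b j]. *)
Lemma lorentz_cost_integral v c A : measurable_fun setT v -> (forall x, 0 <= v x) ->
  lorentz_cost mu phi v c -> c < +oo -> measurable A -> mu A < +oo ->
  \int[mu]_(x in A) v x < +oo.
Proof.
move=> mv v0 [w [M [b [mw wM Mb vw wc]]]] cfin mA Afin.
have w0 j x : 0 <= w j x by case/andP: (wM j x).
pose a := (fine (mu A) + 1)%R.
have a0 : (0 < a)%R by rewrite ltr_wpDl// fine_ge0.
have Aa : mu A <= a%:E.
  by rewrite -[leLHS]fineK ?ge0_fin_numE// lee_fin lerDl.
pose C := (a / phi a)%R.
have C0 : (0 < C)%R by rewrite divr_gt0// (qc_gt0 qc).
pose cost j := (M j * phi (b j))%:E + (phi (b j) / b j)%:E * \int[mu]_x w j x.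
have int0 j : 0 <= \int[mu]_x w j x by apply: integral_ge0.
have p1 j : 0 <= (M j * phi (b j))%:E.
  by have [M0 b0] := Mb j; rewrite lee_fin mulr_ge0// ltW// (qc_gt0 qc).
have p2 j : 0 <= (phi (b j) / b j)%:E * \int[mu]_x w j x.
  by have [M0 b0] := Mb j; rewrite mule_ge0// lee_fin divr_ge0// ltW// (qc_gt0 qc).
have step j : \int[mu]_(x in A) w j x <= C%:E * cost j.
  have [M0 b0] := Mb j.
  have [ab|ba] := leP a (b j).
    apply: (@le_trans _ _ (C%:E * (M j * phi (b j))%:E)); last first.
      by apply: lee_wpmul2l; [rewrite lee_fin ltW|exact: leeDl].
    apply: (@le_trans _ _ ((M j)%:E * mu A)).
      rewrite -integral_cst//; apply: ge0_le_integral => //.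
      - exact: measurable_funTS.
      - by move=> x _; case/andP: (wM j x).
    apply: (@le_trans _ _ ((M j)%:E * a%:E)); first by rewrite lee_wpmul2l// lee_fin.
    rewrite -!EFinM lee_fin mulrCA ler_wpM2l//.
    rewrite /C mulrAC ler_pdivlMr ?(qc_gt0 qc)// (ler_wpM2l (ltW a0))//.
    exact: (qc_le qc (ltW a0) ab).
  apply: (@le_trans _ _ (C%:E * ((phi (b j) / b j)%:E * \int[mu]_x w j x))); last first.
    by apply: lee_wpmul2l; [rewrite lee_fin ltW|exact: leeDr].
  apply: (@le_trans _ _ (\int[mu]_x w j x)); first exact: ge0_subset_integral.
  rewrite muleA -EFinM -[leLHS]mul1e; apply: lee_wpmul2r => //.
  rewrite lee_fin /C mulf_div ler_pdivlMr ?mulr_gt0 ?(qc_gt0 qc)// mul1r.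
  by rewrite mulrC (mulrC a); have := qc_ratio qc b0 (ltW ba); rewrite mulrC.
apply: (@le_lt_trans _ _ (\int[mu]_(x in A) \sum_(0 <= j <oo) w j x)).
  apply: ae_ge0_le_integral => //.
  - exact: measurable_funTS.
  - by move=> x _; apply: nneseries_ge0.
  - by apply: measurable_funTS; apply: ge0_emeasurable_sum.
  - by apply: filterS vw.
rewrite integral_nneseries//; last by move=> j; exact: measurable_funTS.
apply: (@le_lt_trans _ _ (\sum_(0 <= j <oo) C%:E * cost j)).
  apply: lee_nneseries => // j _ _; exact: integral_ge0.
rewrite nneseriesZl; last by move=> j _; rewrite adde_ge0.
apply: (@le_lt_trans _ _ (C%:E * c)); first by rewrite lee_wpmul2l// lee_fin ltW.
case: c cfin {wc} => [c| |]// _; first by rewrite -EFinM ltry.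
by rewrite gt0_muleNy ?lte_fin// ltNyr.
Qed.

End lorentz_finite.

(** * Cutting a function along geometric levels *)

Section lorentz_layers.
Context d (T : measurableType d) {R : realType}.
Variable mu : {sigma_finite_measure set T -> \bar R}.
Variable phi : R -> R.
Hypothesis qc : quasiconcave phi.
Local Open Scope ereal_scope.
Local Notation leb := (@lebesgue_measure R).
Local Notation distr := (distr mu).
Local Notation lorentz := (lorentz mu phi).
Implicit Types (v w h : T -> \bar R).

(** A bijection from the naturals to the integers: levels run over the integers, layers of
    [lorentz_cost] over the naturals. *)
Let zn (n : nat) : int := if odd n then Negz n./2 else Posz n./2.

Let zn_inj : injective zn.
Proof.
move=> m n; rewrite /zn.
have := odd_double_half m; have := odd_double_half n.
case: (odd m); case: (odd n) => //= hm hn [] h; rewrite -hm -hn h//.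
Qed.

Let zn_surj z : exists n, zn n = z.
Proof.
case: z => n; rewrite /zn.
  by exists n.*2; rewrite odd_double doubleK.
by exists n.*2.+1; rewrite /= odd_double /= uphalf_double.
Qed.

(* [1_{v > p}] over the geometric grid [p = lam ^ z], [z] an integer, each
   weighted by the length of [(p, lam p]], add up to a majorant of [v]. *)
Lemma lorentz_cost_layers v (lam : R) : measurable_fun setT v ->
  (forall x, 0 <= v x) -> lorentz v < +oo -> (1 < lam)%R ->
  lorentz_cost mu phi v ((2 * lam)%:E * lorentz v).
Proof.
move=> mv v0 vfin lam1.
have lam0 : (0 < lam)%R by apply: lt_trans lam1.
pose k := ln lam; have k0 : (0 < k)%R by exact: ln_gt0.
have lamE : expR k = lam by rewrite lnK.
pose p n := expR (k * (zn n)%:~R).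
have p0 n : (0 < p n)%R by exact: expR_gt0.
have dfin n : distr v (p n) \is a fin_num.
  by rewrite ge0_fin_numE ?distr_ge0//; exact: (distr_fin_num qc).
(* A level whose superlevel set is null gets the zero layer; its [b] would be 0, and the placeholder
   1 keeps it positive. *)
pose nul n := distr v (p n) == 0.
pose M n := if nul n then 0%R else ((lam - 1) * p n)%R.
pose b n := if nul n then 1%R else fine (distr v (p n)).
pose S n : set T := [set x | (p n)%:E < v x].
pose w n x := (M n * \1_(S n) x)%:E.
have mS n : measurable (S n) by exact: measurable_superlevel.
have M0 n : (0 <= M n)%R.
  by rewrite /M; case: ifP => // _; apply: mulr_ge0; rewrite ?subr_ge0 ltW.
have intw n : \int[mu]_x w n x = (M n)%:E * distr v (p n).
  rewrite /w; under eq_integral do rewrite EFinM.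
  have mi : measurable_fun setT (fun x => (\1_(S n) x)%:E : \bar R).
    by apply/measurable_EFinP; exact: measurable_indic.
  rewrite ge0_integralZl//; last by rewrite lee_fin.
  by rewrite integral_indic// setIT.
have b0 n : (0 < b n)%R.
  rewrite /b; case: ifPn => // d0; rewrite fine_gt0//.
  by rewrite lt_def d0 distr_ge0/= -ge0_fin_numE ?distr_ge0.
exists w, M, b; split.
- by move=> n; apply/measurable_EFinP; exact: measurable_funM.
- move=> n x; rewrite !lee_fin mulr_ge0//= indicE.
  by case: (_ \in _); rewrite ?mulr1 ?mulr0.
- by move=> n.
- apply: (@negligibleS _ _ _ mu (\bigcup_n (if nul n then [set x | (p n)%:E < v x] else set0))); last first.
    apply: negligible_bigcup => n; case: ifPn => [|_]; last exact: negligible_set0.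
    by move=> /eqP d0; apply/(negligibleP mu (mS n)).
  move=> x /= /negP; rewrite -ltNge => sumv.
  apply: contrapT => Nx; move: sumv; apply/negP; rewrite -leNgt.
  have wE n : w n x = if (p n)%:E < v x then ((lam - 1) * p n)%:E else 0.
    rewrite /w indicE; case: ifPn => [pv|pv]; last first.
      by rewrite memNset ?mulr0//= ; exact/negP.
    rewrite mem_set// mulr1 /M; case: ifPn => // nn.
    by case: Nx; exists n => //; rewrite nn.
  (* The intervals []p, lam * p]] with [p < v x] cover []0, v x[], and their lengths are the values
     of the layers at [x]. *)
  pose J n : set R := if (p n)%:E < v x then `]p n, (lam * p n)%R]%classic else set0.
  have JE n : leb (J n) = w n x.
    rewrite wE /J; case: ifPn => // _.
    rewrite [LHS](lebesgue_measure_itv (Interval (BRight (p n)) (BRight (lam * p n)%R))).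
    rewrite /= lte_fin ltr_pMl// lam1 -EFinB; congr EFin; ring.
  pose I : set R := [set s | (0 < s)%R /\ s%:E < v x].
  have mI : measurable I.
    rewrite (_ : I = `]0%R, +oo[%classic `&` [set s | s%:E < v x]); last first.
      by apply/seteqP; split => s; rewrite /I /= in_itv/= andbT.
    apply: measurableI => //; rewrite -[X in measurable X]setTI.
    by apply: emeasurable_fun_infty_o => //; exact/measurable_EFinP.
  have IJ : I `<=` \bigcup_n J n.
    move=> s [s0 sv].
    (* For this ceiling [c], [lam ^ (c - 1) < s <= lam ^ c]. *)
    have := real_ceil_itv (num_real (ln s / k)%R).
    set c := Num.ceil _ => /andP[c1 c2].
    have [n nc] := zn_surj (c - 1); exists n => //.
    have ps : (p n < s)%R.
      by rewrite /p nc -[ltRHS]lnK// ltr_expR mulrC -ltr_pdivlMr.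
    rewrite /J ifT; last by apply: lt_trans sv; rewrite lte_fin.
    rewrite /= in_itv/= ps /=.
    rewrite /p nc -lamE -expRD -[leLHS]lnK// ler_expR.
    rewrite rmorphB /= mulrBr mulr1 addrC subrK mulrC -ler_pdivrMr//.
  have : leb I <= \sum_(0 <= n <oo) leb (J n).
    apply: measure_sigma_subadditive => // n.
    by rewrite /J; case: ifP.
  rewrite (eq_eseriesr (fun n _ => JE n)); apply: le_trans.
  have := v0 x; rewrite /I; case vx : (v x) => [r| |]// r0; last first.
    rewrite (_ : [set s | _] = `]0%R, +oo[%classic); last first.
      by apply/seteqP; split => s /=; rewrite in_itv/= andbT ?ltry => // -[].
    by rewrite [leRHS](lebesgue_measure_itv (Interval (BRight 0%R) +oo%O))/= ltry leey.
  rewrite (_ : [set s | _] = `]0%R, r[%classic); last first.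
    by apply/seteqP; split => s /=; rewrite in_itv/= lte_fin; [move=> [-> ->]|move/andP].
  rewrite [leRHS](lebesgue_measure_itv (Interval (BRight 0%R) (BLeft r)))/= lte_fin.
  by case: ltP => [_|]; rewrite ?sube0// lee_fin.
- pose I n : set R := `](p n / lam)%R, p n]%classic.
  have mI n : measurable (I n) by exact: measurable_itv.
  pose F s := ext_phi phi (distr v s).
  have F0 s : 0 <= F s by exact: (ext_phi_distr_ge0 _ qc).
  have mF : measurable_fun [set: R] F by exact: measurable_ext_phi_distr.
  have stepI n : (M n * phi (b n))%:E + (phi (b n) / b n)%:E * \int[mu]_x w n x <=
      (2 * lam)%:E * \int[leb]_(s in I n) F s.
    rewrite intw.
    have int0 : 0 <= \int[leb]_(s in I n) F s by apply: integral_ge0.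
    have [dn|dn] := boolP (nul n).
      rewrite /M dn mul0r mul0e mule0 add0e mule_ge0// lee_fin mulr_ge0// ltW//.
    have db : distr v (p n) = (b n)%:E by rewrite /b (negbTE dn) fineK.
    rewrite db -!EFinM -EFinD.
    (* Both terms equal [M * phi b], whence the 2. The length [(lam - 1) * p] of []p, lam * p]] is
       [lam] times that of []p / lam, p]], the interval on which the distribution function is at
       least [b]. *)
    have -> : (M n * phi (b n) + phi (b n) / b n * (M n * b n) =
        2 * lam * (phi (b n) * (p n - p n / lam)))%R.
      rewrite /M (negbTE dn).
      by field; rewrite !gt_eqF.
    rewrite EFinM; apply: lee_wpmul2l; first by rewrite lee_fin mulr_ge0// ltW.
    have -> : (phi (b n) * (p n - p n / lam))%:E = \int[leb]_(s in I n) cst (phi (b n))%:E s.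
      rewrite integral_cst; last exact: mI.
      rewrite [X in _ = _ * X](lebesgue_measure_itv (Interval (BRight (p n / lam)%R) (BRight (p n)))).
      rewrite /= lte_fin ltr_pdivrMr// ltr_pMr// lam1 -EFinB -EFinM//.
    apply: ge0_le_integral => //; first exact: mI.
    - by move=> s _; rewrite lee_fin ltW// (qc_gt0 qc).
    - exact: measurable_funTS.
    - move=> s; rewrite /I /= in_itv/= => /andP[_ sp].
      rewrite /F -[leLHS]/(ext_phi phi (b n)%:E) -db; apply: (ext_phi_le qc).
        exact: distr_ge0.
      exact: distr_nonincreasing.
  apply: (@le_trans _ _ (\sum_(0 <= n <oo) (2 * lam)%:E * \int[leb]_(s in I n) F s)).
    apply: lee_nneseries => // n _ _; rewrite adde_ge0//.
      by rewrite lee_fin mulr_ge0// ltW// (qc_gt0 qc).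
    rewrite mule_ge0//; first by rewrite lee_fin divr_ge0// ltW// (qc_gt0 qc).
    by apply: integral_ge0 => x _; rewrite lee_fin mulr_ge0.
  rewrite nneseriesZl; last by move=> n _; apply: integral_ge0.
  apply: lee_wpmul2l; first by rewrite lee_fin mulr_ge0// ltW.
  rewrite -ge0_integral_bigcup; last 4 first.
  - exact: mI.
  - exact: measurable_funTS.
  - by move=> s _; exact: F0.
  - apply/trivIsetP => m n _ _ /eqP mn; apply/seteqP; split => // s.
    rewrite /I /= !in_itv/= => -[/andP[m1 m2] /andP[n1 n2]]; apply: mn.
    have s0 : (0 < s)%R by apply: lt_trans m1; rewrite divr_gt0.
    have zc j : (p j / lam < s)%R -> (s <= p j)%R -> Num.ceil (ln s / k) = zn j.
      move=> j1 j2; apply: ceil_def; apply/andP; split.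
        rewrite ltr_pdivlMr// mulrC -ltr_expR lnK// rmorphB mulrBr mulr1.
        by rewrite expRB lamE.
      by rewrite ler_pdivrMr// mulrC -ler_expR lnK.
    by apply: zn_inj; rewrite -(zc m) -?(zc n).
  apply: ge0_subset_integral => //.
  - by apply: bigcup_measurable => n _; exact: mI.
  - exact: measurable_funTS.
  - move=> s [n _]; rewrite /I /= !in_itv/= andbT => /andP[h _].
    by apply/ltW; apply: lt_trans h; rewrite divr_gt0.
Qed.

End lorentz_layers.

(** * Positive operators acting on costs *)

Section lorentz_contraction.
Context d (T : measurableType d) {R : realType}.
Variable mu : {sigma_finite_measure set T -> \bar R}.
Variable phi : R -> R.
Hypothesis qc : quasiconcave phi.
Local Open Scope ereal_scope.
Implicit Types (v w h : T -> \bar R).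

Lemma lorentz_cost_ae_le v w c : {ae mu, forall x, v x <= w x} ->
  lorentz_cost mu phi w c -> lorentz_cost mu phi v c.
Proof.
move=> vw [u [M [b [mu_ uM Mb wu uc]]]]; exists u, M, b; split => //.
by apply: filterS2 vw wu => x; exact: le_trans.
Qed.

Variables (N : nat) (F : 'I_N -> T -> T) (a : 'I_N -> T -> R) (alpha : R).
Hypothesis N_gt0 : (0 < N)%N.
Hypothesis alpha_ge0 : (0 <= alpha)%R.
Hypothesis mF : forall n, measurable_fun setT (F n).
Hypothesis nullF : forall n A, mu.-negligible A -> mu.-negligible (F n @^-1` A).
Hypothesis ma : forall n, measurable_fun setT (a n).
Hypothesis a_bounds : forall n x, (0 <= a n x <= alpha / N%:R)%R.

(** Acts on moduli: with [a n] equal almost everywhere to the modulus of [g_n], it dominates the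
    modulus of [opP]. *)
Definition transfer w x := \sum_(n < N) (a n x)%:E * w (F n x).

Hypothesis transfer_L1 : forall w, measurable_fun setT w -> (forall x, 0 <= w x) ->
  \int[mu]_x transfer w x <= alpha%:E * \int[mu]_x w x.

Lemma ae_comp n (P : T -> Prop) : {ae mu, forall x, P x} ->
  {ae mu, forall x, P (F n x)}.
Proof. by move=> /(nullF n). Qed.

Lemma transfer_ge0 w x : (forall y, 0 <= w y) -> 0 <= transfer w x.
Proof.
move=> w0; apply: sume_ge0 => n _; rewrite mule_ge0// lee_fin.
by case/andP: (a_bounds n x).
Qed.

Lemma measurable_transfer w : measurable_fun setT w ->
  measurable_fun setT (transfer w).
Proof.
move=> mw; apply: emeasurable_sum => n; apply: emeasurable_funM.
  exact/measurable_EFinP.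
exact: measurableT_comp.
Qed.

(** The image layers keep the same [b], so the two terms of a cost scale separately, each by
    [alpha]. *)
Lemma lorentz_cost_transfer v c : (forall x, 0 <= v x) ->
  lorentz_cost mu phi v c -> lorentz_cost mu phi (transfer v) (alpha%:E * c).
Proof.
move=> v0 [w [M [b [mw wM Mb vw wc]]]].
have w0 j x : 0 <= w j x by case/andP: (wM j x).
have a0 n x : (0 <= a n x)%R by case/andP: (a_bounds n x).
exists (fun j => transfer (w j)), (fun j => alpha * M j)%R, b; split.
- by move=> j; exact: measurable_transfer.
- move=> j x; rewrite transfer_ge0//=.
  apply: (@le_trans _ _ (\sum_(n < N) (alpha / N%:R * M j)%:E)).
    apply: lee_sum => n _; rewrite EFinM; apply: lee_pmul => //.
    - by rewrite lee_fin.
    - by rewrite lee_fin; case/andP: (a_bounds n x).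
    - by case/andP: (wM j (F n x)).
  have N0 : (N%:R != 0 :> R)%R by rewrite pnatr_eq0 -lt0n.
  rewrite sumEFin lee_fin sumr_const card_ord -mulr_natr le_eqVlt.
  by apply/orP; left; apply/eqP; field.
- by move=> j; have [M0 b0] := Mb j; split=> //; rewrite mulr_ge0.
- have H n : {ae mu, forall x, v (F n x) <= \sum_(0 <= j <oo) w j (F n x)}.
    exact: ae_comp vw.
  have : {ae mu, forall x, forall n, v (F n x) <= \sum_(0 <= j <oo) w j (F n x)}.
    exact: filter_forall.
  apply: filterS => x vx.
  rewrite /transfer nneseries_sum; last by move=> n j _; rewrite mule_ge0 ?lee_fin.
  apply: lee_sum => n _; rewrite nneseriesZl//.
  by apply: lee_wpmul2l; rewrite ?lee_fin.
- apply: (@le_trans _ _ (alpha%:E * \sum_(0 <= j <oo) ((M j * phi (b j))%:E +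
        (phi (b j) / b j)%:E * \int[mu]_x w j x))); last first.
    by apply: lee_wpmul2l; rewrite ?lee_fin.
  have i0 j : 0 <= \int[mu]_x w j x by apply: integral_ge0.
  have p1 j : 0 <= (M j * phi (b j))%:E.
    by have [M0 b0] := Mb j; rewrite lee_fin mulr_ge0// ltW// (qc_gt0 qc).
  have q0 j : (0 <= phi (b j) / b j)%R.
    by have [M0 b0] := Mb j; rewrite divr_ge0// ltW// (qc_gt0 qc).
  rewrite -nneseriesZl; last first.
    by move=> j _; rewrite adde_ge0// mule_ge0// lee_fin.
  apply: lee_nneseries => [j _ _|j _].
    rewrite adde_ge0//; last first.
      by rewrite mule_ge0 ?lee_fin// integral_ge0// => x _; exact: transfer_ge0.
    by have := p1 j; rewrite !lee_fin => pj; rewrite -mulrA mulr_ge0.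
  have p2 : 0 <= (phi (b j) / b j)%:E * \int[mu]_x w j x by rewrite mule_ge0// lee_fin.
  rewrite (ge0_muleDr _ (p1 j) p2).
  rewrite -EFinM mulrA leeD2l// muleCA; apply: lee_wpmul2l; first by rewrite lee_fin.
  exact: transfer_L1.
Qed.

End lorentz_contraction.

(** * Lebesgue measure *)

Section double_series.
Local Open Scope ereal_scope.

(** The enumeration is fixed before [g], so that one and the same [f] reindexes a doubly indexed
    cover and adds up its volumes. *)
Lemma pair_series_enum : exists2 f : nat -> nat * nat,
  (forall p, exists i, f i = p) &
  forall (R : realType) (g : nat -> nat -> \bar R), (forall i j, 0 <= g i j) ->
    \sum_(0 <= i <oo) g (f i).1 (f i).2 =
    \sum_(0 <= i <oo) \sum_(0 <= j <oo) g i j.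
Proof.
have /card_esym/card_set_bijP[f [_ fi fs]] := card_nat2.
exists f => [p|R g g0].
  by have [i _ <-] := fs p I; exists i.
transitivity (\esum_(i in [set: nat]) \esum_(j in [set: nat]) g i j); last first.
  rewrite [RHS]nneseries_esumT; last by move=> i; apply: nneseries_ge0.
  by apply: eq_esum => i _; rewrite [RHS]nneseries_esumT.
rewrite nneseries_esumT// esum_esum// (_ : [set: nat] `*`` _ = setT); last first.
  by apply/seteqP; split.
by rewrite (@reindex_esum _ _ _ [set: nat] [set: nat * nat] f).
Qed.

End double_series.

(** * The Caratheodory measure of [leb_outer] *)

Section lebesgue_outer.
Context {R : realType} (k : nat).
Local Notation V := 'rV[R]_k.+1.
Implicit Types (a b x : V) (A : set V).
Local Open Scope ereal_scope.

Lemma box_vol_ge0 a b : (0 <= box_vol a b)%R.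
Proof. by apply: prodr_ge0 => i _; rewrite le_max lexx. Qed.

(** Positive dimension matters: the empty product would be 1. Degenerate boxes pad finite covers to
    sequences. *)
Lemma box_vol_xx a : box_vol a a = 0%R.
Proof. by rewrite /box_vol big_ord_recl subrr maxxx mul0r. Qed.

Lemma leb_outer_ge0 A : 0 <= leb_outer A.
Proof.
apply: le_ereal_inf_tmp => _ [a [b [_ ->]]]; apply: nneseries_ge0 => n _ _.
by rewrite lee_fin box_vol_ge0.
Qed.

Lemma leb_outer_cover A (a b : nat -> V) : A `<=` \bigcup_n box (a n) (b n) ->
  leb_outer A <= \sum_(0 <= n <oo) (box_vol (a n) (b n))%:E.
Proof. by move=> Aab; apply: ereal_inf_lbound; exists a, b. Qed.

Lemma leb_outer_fin_cover (I : Type) (s : seq I) A (a b : I -> V) :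
  (forall x, A x -> exists2 i, List.In i s & box (a i) (b i) x) ->
  leb_outer A <= \sum_(i <- s) (box_vol (a i) (b i))%:E.
Proof.
move=> As.
pose a' n := nth 0%R (map a s) n; pose b' n := nth 0%R (map b s) n.
apply: (@le_trans _ _ (\sum_(0 <= n <oo) (box_vol (a' n) (b' n))%:E)).
  apply: leb_outer_cover => x /As[i si abx].
  suff [n [ns an bn]] : exists n, [/\ (n < size s)%N, a' n = a i & b' n = b i].
    by exists n => //; rewrite an bn.
  rewrite /a' /b'; elim: s si {As a' b'} => [//|j s IH] /= [->|/IH[n [ns an bn]]].
    by exists 0%N.
  by exists n.+1.
have vol0 n : (size s <= n)%N -> box_vol (a' n) (b' n) = 0%R.
  by move=> sn; rewrite /a' /b' !nth_default ?size_map// box_vol_xx.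
rewrite (nneseries_split 0 (size s)); last by move=> n _; rewrite lee_fin box_vol_ge0.
rewrite add0n [X in _ + X]eseries0 ?adde0; last first.
  by move=> n sn _; rewrite vol0.
rewrite /a' /b' {As a' b' vol0}; elim: s => [|i s IH]; first by rewrite !big_nil.
by rewrite [leRHS]big_cons -[size (i :: s)]/(size s).+1 big_nat_recl//=; exact: leeD2l.
Qed.

Lemma leb_outer_box a b : leb_outer (box a b) <= (box_vol a b)%:E.
Proof.
have := @leb_outer_fin_cover unit [:: tt] (box a b) (fun=> a) (fun=> b).
by rewrite big_seq1; apply => x abx; exists tt => //; left.
Qed.

Lemma leb_outer_set0 : leb_outer (@set0 V) = 0.
Proof.
apply/eqP; rewrite eq_le leb_outer_ge0 andbT.
have := @leb_outer_fin_cover unit [::] set0 (fun=> 0%R) (fun=> 0%R).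
by rewrite big_nil; apply.
Qed.

Lemma le_leb_outer : {homo @leb_outer R k.+1 : A B / A `<=` B >-> A <= B}.
Proof.
move=> A B AB; apply: le_ereal_inf_tmp => _ [a [b [Bab ->]]].
by apply: leb_outer_cover; exact: subset_trans Bab.
Qed.

Lemma leb_outer_approx A (e : R) : (0 < e)%R -> leb_outer A < +oo ->
  exists a b : nat -> V, A `<=` \bigcup_n box (a n) (b n) /\
    \sum_(0 <= n <oo) (box_vol (a n) (b n))%:E <= leb_outer A + e%:E.
Proof.
move=> e0 Afin.
have fA : leb_outer A \is a fin_num by rewrite ge0_fin_numE// leb_outer_ge0.
have [_ [a [b [Aab ->]]] /ltW h] := lb_ereal_inf_adherent e0 fA.
by exists a, b.
Qed.

Lemma leb_outer_sigma_subadditive : sigma_subadditive (@leb_outer R k.+1).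
Proof.
move=> A; have [[i ioo]|] := pselect (exists i, leb_outer (A i) = +oo).
  rewrite (eseries_pinfty _ _ ioo) ?leey// => n _.
  by rewrite -ltNye (lt_le_trans _ (leb_outer_ge0 _)).
rewrite -forallNE => Aoo.
have Afin n : leb_outer (A n) < +oo by rewrite ltey; apply/eqP; exact: Aoo.
apply/lee_addgt0Pr => e e0.
apply: (le_trans _ (epsilon_trick _ _ (ltW e0))); last first.
  by move=> n; exact: leb_outer_ge0.
have H n : exists ab : (nat -> V) * (nat -> V), A n `<=` \bigcup_j box (ab.1 j) (ab.2 j) /\
    \sum_(0 <= j <oo) (box_vol (ab.1 j) (ab.2 j))%:E <=
    leb_outer (A n) + (e / (2 ^ n.+1)%:R)%:E.
  have en : (0 < e / (2 ^ n.+1)%:R)%R by rewrite divr_gt0// ltr0n expn_gt0.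
  by have [a [b ab]] := leb_outer_approx en (Afin n); exists (a, b).
have [ab abP] := choice H.
have [f fsurj fsum] := pair_series_enum.
apply: (@le_trans _ _ (\sum_(0 <= i <oo)
    (box_vol ((ab (f i).1).1 (f i).2) ((ab (f i).1).2 (f i).2))%:E)).
  apply: leb_outer_cover => x [n _] /(abP n).1[j _ abx].
  by have [i fi] := fsurj (n, j); exists i => //; rewrite fi.
rewrite (fsum R (fun i j => (box_vol ((ab i).1 j) ((ab i).2 j))%:E)); last first.
  by move=> i j; rewrite lee_fin box_vol_ge0.
apply: lee_nneseries => [i _ _|i _]; last exact: (abP i).2.
by apply: nneseries_ge0 => j _ _; rewrite lee_fin box_vol_ge0.
Qed.

HB.instance Definition _ := isOuterMeasure.Build R V (@leb_outer R k.+1)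
  leb_outer_set0 leb_outer_ge0 le_leb_outer leb_outer_sigma_subadditive.

(** A copy of the row vectors carrying the Caratheodory sigma-algebra of [leb_outer]. Its
    measurability unfolds to [leb_measurable], so that general integration theory applies to the
    sets of the statement. *)
Definition lebT : Type := caratheodory_type (@leb_outer R k.+1).

HB.instance Definition _ := Pointed.on lebT.
HB.instance Definition _ := Measurable.copy lebT (caratheodory_type (@leb_outer R k.+1)).

Definition lebk : set lebT -> \bar R := @leb_outer R k.+1.
HB.instance Definition _ := isMeasure.Build _ lebT R lebk
  (@caratheodory_measure0 R V (@leb_outer R k.+1))
  (@caratheodory_measure_ge0 R V (@leb_outer R k.+1))
  (@caratheodory_measure_sigma_additive R V (@leb_outer R k.+1)).

Lemma negligible_lebP A : lebk.-negligible A <-> leb_null A.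
Proof.
split=> [[B [mB B0 AB]]|A0].
  apply/eqP; rewrite eq_le leb_outer_ge0 andbT -B0; exact: le_leb_outer.
exists A; split => //; apply: le_caratheodory_measurable => X /=.
have -> : leb_outer (X `&` A) = 0.
  by apply/eqP; rewrite eq_le leb_outer_ge0 andbT -A0; apply: le_leb_outer => x [].
by rewrite add0e; apply: le_leb_outer => x [].
Qed.

Lemma leb_null_measurable A : leb_null A -> measurable (A : set lebT).
Proof. by move=> /negligible_lebP; exact: measure_is_complete_caratheodory. Qed.

(** The hyperplane cuts each box of a near-optimal cover into two boxes whose volumes add up to at
    most the original one. *)
Lemma measurable_halfspace i (c : R) : measurable ([set x | x 0 i < c] : set lebT)%R.
Proof.
apply: le_caratheodory_measurable => X /=.
have [->|Xfin] := eqVneq (leb_outer X) +oo; first by rewrite leey.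
apply/lee_addgt0Pr => e e0.
have {}Xfin : leb_outer X < +oo by rewrite ltey.
have [a [b [Xab abe]]] := leb_outer_approx e0 Xfin.
apply: le_trans abe.
pose b' n : V := (\row_j if j == i then Num.min (b n 0 j) c else b n 0 j)%R.
pose a' n : V := (\row_j if j == i then Num.max (a n 0 j) c else a n 0 j)%R.
apply: (@le_trans _ _ (\sum_(0 <= n <oo) (box_vol (a n) (b' n))%:E +
   \sum_(0 <= n <oo) (box_vol (a' n) (b n))%:E)).
  apply: leeD; apply: leb_outer_cover => x [Xx /= xc];
    have [n _ abx] := Xab _ Xx; exists n => // j; rewrite mxE.
    case: eqP => [->|_]; last exact: abx.
    by have /andP[-> bx] := abx i; rewrite lt_min bx xc.
  case: eqP => [->|_]; last exact: abx.
  have /andP[ax ->] := abx i; rewrite ge_max ax andbT /= leNgt.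
  exact/negP.
rewrite -nneseriesD; try by move=> n _ _; rewrite lee_fin box_vol_ge0.
apply: lee_nneseries => [n _ _|n _].
  by rewrite -EFinD lee_fin addr_ge0// box_vol_ge0.
rewrite -EFinD lee_fin /box_vol (bigD1 i)//= [X in (_ + X)%R](bigD1 i)//=.
rewrite [leRHS](bigD1 i)//= !mxE eqxx.
rewrite (eq_bigr (fun j => Num.max 0 (b n 0 j - a n 0 j))%R); last first.
  by move=> j /negbTE ji; rewrite mxE ji.
rewrite [X in (_ + _ * X)%R](eq_bigr (fun j => Num.max 0 (b n 0 j - a n 0 j))%R); last first.
  by move=> j /negbTE ji; rewrite mxE ji.
rewrite -mulrDl ler_wpM2r//; first by apply: prodr_ge0 => j _; rewrite le_max lexx.
move: (a n ord0 i) (b n ord0 i) => u v; rewrite /Num.max /Num.min.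
by do ![case: ltP => ?]; lra.
Qed.

Lemma measurable_box a b : measurable (box a b : set lebT).
Proof.
have -> : box a b = \bigcap_(i in [set: 'I_k.+1])
    ([set x | x 0 i < b 0 i] `&` ~` [set x | x 0 i < a 0 i])%R.
  apply/seteqP; split => x.
    by move=> abx i _; have /andP[h1 h2] := abx i; split => //=; apply/negP; rewrite -leNgt.
  by move=> h i; have [/= -> /negP] := h i I; rewrite -leNgt => ->.
apply: fin_bigcap_measurable => // i _; apply: measurableI.
  exact: measurable_halfspace.
by apply: measurableC; exact: measurable_halfspace.
Qed.

End lebesgue_outer.

(** One-sided continuity at [t = 0]. It controls enlarged boxes and, with [l] constant, powers such
    as [(1 + t) ^ k.+1]. *)
Lemma prod_addr_le {R : realType} (I : Type) (s : seq I) (l : I -> R) (e : R) :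
  (forall i, 0 <= l i) -> 0 < e ->
  exists2 dl, 0 < dl & forall t, 0 <= t -> t <= dl ->
    \prod_(i <- s) (l i + t) <= \prod_(i <- s) l i + e.
Proof.
move=> l0; elim: s e => [|i s IH] e e0.
  by exists 1 => // t _ _; rewrite !big_nil lerDl ltW.
pose P := \prod_(j <- s) l j.
have P0 : 0 <= P by apply: prodr_ge0.
have li1 : 0 < 2 * (l i + 1) by rewrite mulr_gt0// ltr_wpDl.
have P1 : 0 < 2 * (P + 1) by rewrite mulr_gt0// ltr_wpDl.
have [dl dl0 H] := IH (e / (2 * (l i + 1))) (divr_gt0 e0 li1).
exists (Num.min 1 (Num.min dl (e / (2 * (P + 1))))).
  by rewrite !lt_min ltr01 dl0 divr_gt0.
move=> t t0; rewrite !le_min => /and3P[t1 td tP]; rewrite !big_cons.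
apply: (@le_trans _ _ ((l i + t) * (P + e / (2 * (l i + 1))))).
  by rewrite ler_wpM2l ?addr_ge0// H.
rewrite -/P.
have h1 : t * (P + 1) <= e / 2.
  by move: tP; rewrite ler_pdivlMr// => h; rewrite ler_pdivlMr//; lra.
have h2 : (l i + t) * (e / (2 * (l i + 1))) <= e / 2.
  rewrite mulrA ler_pdivrMr//.
  have -> : e / 2 * (2 * (l i + 1)) = (l i + 1) * e by field.
  by rewrite (ler_wpM2r (ltW e0))// lerD2l.
rewrite mulrDr [(l i + t) * P]mulrDl.
have : t * P <= t * (P + 1) by rewrite ler_wpM2l// lerDl.
lra.
Qed.

(** * Sup norm, open sets and sigma-finiteness *)

Section lebesgue_topology.
Context {R : realType} (k : nat).
Local Notation V := 'rV[R]_k.+1.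
Local Notation lebT := (@lebT R k).
Local Notation lebk := (@lebk R k).
Implicit Types (a b x : V) (A : set V).

Lemma normv_ltP x e : 0 < e -> `|x| < e <-> forall i, `|x 0 i| < e.
Proof.
move=> e0.
have E : ball (0 : V) e x = (`|0 - x| < e) :> Prop by rewrite mx_norm_ball.
have {E} : (`|x| < e) <-> ball (0 : V) e x by rewrite E sub0r normrN.
move=> ->; split.
  by move=> [_ h] i; have := h 0 i; rewrite /ball/= mxE sub0r normrN.
by move=> h; split=> // i j; rewrite /ball/= mxE sub0r normrN (ord1 i).
Qed.

Lemma normv_coord x i : `|x 0 i| <= `|x|.
Proof.
apply/ler_addgt0Pr => e e0; apply/ltW.
have [|h _] := @normv_ltP x (`|x| + e); first by rewrite ltr_wpDl.
by apply: h; rewrite ltrDl.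
Qed.

Lemma normv_leP x e : 0 <= e -> `|x| <= e <-> forall i, `|x 0 i| <= e.
Proof.
move=> e0; split=> [xe i|h]; first exact: le_trans (normv_coord x i) xe.
apply/ler_addgt0Pr => d d0; apply/ltW/normv_ltP; first by rewrite ltr_wpDl.
by move=> i; rewrite (le_lt_trans (h i))// ltrDl.
Qed.

Lemma openvP (U : set V) :
  open U <-> forall x, U x -> exists2 e, 0 < e & forall y, `|y - x| < e -> U y.
Proof.
split=> [oU x Ux|H].
  have : nbhs x U by apply: open_nbhs_nbhs; split.
  move=> /nbhs_normP[e /= e0 h]; exists e => // y yx.
  by apply: h; rewrite /= distrC.
rewrite openE => x /H[e e0 h]; suff : nbhs x U by [].
apply/nbhs_ballP; exists e => // y; rewrite mx_norm_ball /ball_ /=.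
by rewrite distrC; exact: h.
Qed.

(** An open set is the union of the countably many boxes with rational corners that it contains. *)
Lemma measurable_open (U : set V) : open U -> measurable (U : set lebT).
Proof.
move=> /openvP oU.
pose rv (p : 'rV[rat]_k.+1) : V := map_mx ratr p.
pose F (p : 'rV[rat]_k.+1 * 'rV[rat]_k.+1) : set lebT :=
  if `[< box (rv p.1) (rv p.2) `<=` U >] then box (rv p.1) (rv p.2) else set0.
have -> : U = \bigcup_p F p.
  apply/seteqP; split => x; last first.
    by move=> [p _]; rewrite /F; case: asboolP => // pU; exact: pU.
  move=> Ux; have [e e0 xe] := oU x Ux.
  have Hp i : exists p : rat, x 0 i - e < ratr p < x 0 i.
    have : x 0 i - e < x 0 i by rewrite ltrBlDr ltrDl.
    by move=> /rat_in_itvoo[p]; rewrite in_itv/=; exists p.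
  have Hq i : exists q : rat, x 0 i < ratr q < x 0 i + e.
    have : x 0 i < x 0 i + e by rewrite ltrDl.
    by move=> /rat_in_itvoo[p]; rewrite in_itv/=; exists p.
  have [p pP] := choice Hp; have [q qP] := choice Hq.
  exists (\row_i p i, \row_i q i) => //; rewrite /F /rv /=.
  rewrite asboolT => [i|y abx].
    move: (pP i) (qP i); rewrite !mxE => /andP[_ px] /andP[xq _].
    by rewrite (ltW px).
  apply: xe; apply/normv_ltP => // i.
  move: (pP i) (qP i) (abx i); rewrite !mxE => /andP[p1 _] /andP[_ q1] /andP[py yq].
  by rewrite ltr_norml; apply/andP; split; lra.
apply: countable_bigcupT_measurable; first exact: countableP.
by move=> p; rewrite /F; case: asboolP => // _; exact: measurable_box.
Qed.

Lemma measurable_closed (C : set V) : closed C -> measurable (C : set lebT).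
Proof.
by move=> cC; rewrite -[C]setCK; apply: measurableC; apply: measurable_open;
  rewrite openC.
Qed.

Definition cube (n : nat) : set V := box (const_mx (- n%:R)) (const_mx n%:R).

Lemma cube_bigcup : \bigcup_n cube n = setT.
Proof.
apply/seteqP; split => // x _.
have := archi_boundP (normr_ge0 x); set n := Num.bound _ => xn.
exists n => // i; rewrite !mxE.
have := le_lt_trans (normv_coord x i) xn; rewrite ltr_norml => /andP[h1 ->].
by rewrite ltW.
Qed.

Lemma cube_fin n : (leb_outer (cube n) < +oo)%E.
Proof. by apply: (le_lt_trans (leb_outer_box _ _)); rewrite ltry. Qed.

Lemma measurable_cube n : measurable (cube n : set lebT).
Proof. exact: measurable_box. Qed.

Lemma lebk_sigma_finite : sigma_finite [set: lebT] lebk.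
Proof.
exists cube; first by rewrite cube_bigcup.
by move=> n; split; [exact: measurable_cube|exact: cube_fin].
Qed.

HB.instance Definition _ := @Measure_isSigmaFinite.Build _ lebT R lebk lebk_sigma_finite.

Lemma open_obox a b : open [set x : V | forall i, a 0 i < x 0 i < b 0 i].
Proof.
apply/openvP => x h.
have H i : exists e, 0 < e /\ forall t, `|t - x 0 i| < e -> a 0 i < t < b 0 i.
  have /andP[h1 h2] := h i.
  exists (Num.min (x 0 i - a 0 i) (b 0 i - x 0 i)); split.
    by rewrite lt_min !subr_gt0 h1.
  move=> t; rewrite lt_min !ltr_norml => /andP[/andP[? ?] /andP[? ?]].
  by apply/andP; split; lra.
have [e e0] := choice H.
pose m := \big[Num.min/1]_i e i.
exists m.
  rewrite /m; elim/big_ind: _ => // [y z y0 z0|i _]; first by rewrite lt_min y0.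
  exact: (e0 i).1.
move=> y yx i; apply: (e0 i).2.
have := le_lt_trans (normv_coord _ i) yx; rewrite !mxE => /lt_le_trans; apply.
exact: bigmin_le_cond.
Qed.

End lebesgue_topology.

(** * Outer and inner regularity *)

Section lebesgue_regularity.
Context {R : realType} (k : nat).
Local Notation V := 'rV[R]_k.+1.
Local Notation lebT := (@lebT R k).
Local Notation lebk := (@lebk R k).
Implicit Types (a b x : V) (A E : set V).
Local Open Scope ereal_scope.

Lemma box_enlarge a b (e : R) : (0 < e)%R ->
  exists U, [/\ open U, box a b `<=` U & leb_outer U <= (box_vol a b + e)%:E].
Proof.
move=> e0.
have l0 i : (0 <= Num.max 0 (b 0 i - a 0 i))%R by rewrite le_max lexx.
have [dl dl0 H] := @prod_addr_le R _ (enum 'I_k.+1) _ e l0 e0.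
pose a' : V := (\row_i (a 0 i - dl))%R.
exists [set x : V | forall i, a' 0%R i < x 0%R i < b 0%R i]%R; split.
- exact: open_obox.
- move=> x abx i; have /andP[ax ->] := abx i; rewrite andbT mxE.
  by rewrite ltrBlDr (le_lt_trans ax)// ltrDl.
- apply: (@le_trans _ _ (leb_outer (box a' b))).
    by apply: le_leb_outer => x h i; have /andP[/ltW -> ->] := h i.
  apply: (le_trans (leb_outer_box _ _)); rewrite lee_fin.
  have := H dl (ltW dl0) (lexx _); rewrite !big_enum/=; apply: le_trans.
  apply: ler_prod => i _; rewrite le_max lexx/= mxE ge_max (addr_ge0 (l0 i) (ltW dl0))/=.
  have : (b 0 i - a 0 i <= Num.max 0 (b 0 i - a 0 i))%R by rewrite le_max lexx orbT.
  by lra.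
Qed.

Lemma leb_outer_open A (e : R) : (0 < e)%R -> leb_outer A < +oo ->
  exists U, [/\ open U, A `<=` U & leb_outer U <= leb_outer A + e%:E].
Proof.
move=> e0 Afin.
have e2 : (0 < e / 2)%R by rewrite divr_gt0.
have [a [b [Aab abe]]] := leb_outer_approx e2 Afin.
have H n : exists U, [/\ open U, box (a n) (b n) `<=` U &
    leb_outer U <= (box_vol (a n) (b n))%:E + ((e / 2) / (2 ^ n.+1)%:R)%:E].
  by rewrite -EFinD; apply: box_enlarge; rewrite divr_gt0// ltr0n expn_gt0.
have [U UP] := choice H.
exists (\bigcup_n U n); split.
- by apply: bigcup_open => n _; have [] := UP n.
- by move=> x /Aab[n _ abx]; exists n => //; have [_ + _] := UP n; apply.
- apply: (le_trans (leb_outer_sigma_subadditive _)).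
  apply: (@le_trans _ _ (\sum_(0 <= n <oo) ((box_vol (a n) (b n))%:E +
     ((e / 2) / (2 ^ n.+1)%:R)%:E))).
    apply: lee_nneseries => [n _ _|n _]; first exact: leb_outer_ge0.
    by have [] := UP n.
  apply: (le_trans (epsilon_trick _ _ (ltW e2))).
    by move=> n; rewrite lee_fin box_vol_ge0.
  apply: (@le_trans _ _ ((leb_outer A + (e / 2)%:E) + (e / 2)%:E)).
    exact: leeD2r.
  by rewrite -addeA -EFinD -splitr.
Qed.

(** Subtracting measures requires finiteness, hence the cut by cubes with errors [e / 2 ^ n.+1]. *)
Lemma measurable_open_approx E (e : R) : measurable (E : set lebT) -> (0 < e)%R ->
  exists U, [/\ open U, E `<=` U & leb_outer (U `\` E) <= e%:E].
Proof.
move=> mE e0.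
have mEn n : measurable (E `&` cube n : set lebT).
  by apply: measurableI => //; exact: measurable_cube.
have Efin n : leb_outer (E `&` cube n) < +oo.
  by apply: (le_lt_trans _ (@cube_fin R k n)); apply: le_leb_outer => x [].
have H n : exists U, [/\ open U, E `&` cube n `<=` U &
    leb_outer (U `\` (E `&` cube n)) <= (e / (2 ^ n.+1)%:R)%:E].
  have en : (0 < e / (2 ^ n.+1)%:R)%R by rewrite divr_gt0// ltr0n expn_gt0.
  have [U [oU EU Ue]] := leb_outer_open en (Efin n); exists U; split => //.
  have Ef : leb_outer (E `&` cube n) \is a fin_num.
    by rewrite ge0_fin_numE ?leb_outer_ge0.
  rewrite -(leeD2lE _ _ Ef); apply: le_trans Ue.
  rewrite (mEn n U) setDE leeD2r// le_leb_outer// => x h; split => //; exact: EU.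
have [U UP] := choice H.
exists (\bigcup_n U n); split.
- by apply: bigcup_open => n _; have [] := UP n.
- move=> x Ex; have : [set: V] x by []; rewrite -cube_bigcup => -[n _ nx].
  by exists n => //; have [_ + _] := UP n; apply.
- apply: (@le_trans _ _ (leb_outer (\bigcup_n (U n `\` (E `&` cube n))))).
    by apply: le_leb_outer => x [[n _ Ux] nE]; exists n => //; split => // -[].
  apply: (le_trans (leb_outer_sigma_subadditive _)).
  apply: le_trans (epsilon_trick0 xpredT (ltW e0)).
  apply: lee_nneseries => [n _ _|n _]; first exact: leb_outer_ge0.
  by have [] := UP n.
Qed.

(** Open approximations of the complement of [E] are complemented and cut by closed balls.
    Compactness will make Lipschitz images measurable and reduce preimages of measurable sets, up to
    a null set, to preimages of open ones. *)
Lemma measurable_sigma_compact E : measurable (E : set lebT) ->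
  exists C : nat -> set V, [/\ forall n, compact (C n), forall n, C n `<=` E &
    leb_outer (E `\` \bigcup_n C n) = 0].
Proof.
move=> mE.
have H (n : nat) : exists U, [/\ open U, ~` E `<=` U &
    leb_outer (U `\` ~` E) <= (n.+1%:R^-1)%:E].
  by apply: measurable_open_approx; [exact: measurableC|rewrite invr_gt0].
have [U UP] := choice H.
have [f fsurj _] := pair_series_enum.
pose Q (m : nat) : set V := [set x | `|x| <= m%:R]%R.
have Qcl m : closed (Q m).
  rewrite -[Q m]setCK closedC; apply/openvP => x /negP; rewrite -ltNge => mx.
  exists (`|x| - m%:R)%R; first by rewrite subr_gt0.
  move=> y yx; apply/negP; rewrite -ltNge.
  have h : (`|x| <= `|y| + `|y - x|)%R.
    by have := ler_normB y (y - x)%R; rewrite opprB addrC subrK.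
  by rewrite ltNge; apply/negP => h2; lra.
exists (fun i => ~` U (f i).1 `&` Q (f i).2); split.
- move=> i; apply: bounded_closed_compact.
    exists (f i).2%:R; split; first exact: num_real.
    by move=> M /ltW mM x [_ /le_trans]; apply.
  by apply: closedI => //; apply: open_closedC; have [] := UP (f i).1.
- move=> i x [nU _]; apply: contrapT => nE; apply: nU.
  by have [_ + _] := UP (f i).1; apply.
- apply/eqP; rewrite eq_le leb_outer_ge0 andbT; apply/lee_addgt0Pr => e e0.
  rewrite add0e.
  have ei0 : (0 <= e^-1)%R by rewrite invr_ge0 ltW.
  have := archi_boundP ei0; set n := Num.bound _ => en.
  apply: (@le_trans _ _ (leb_outer (U n `\` ~` E))).
    apply: le_leb_outer => x [Ex nx]; split; last by [].
    apply: contrapT => nU; apply: nx.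
    have := archi_boundP (normr_ge0 x); set m := Num.bound _ => xm.
    have [i fi] := fsurj (n, m); exists i => //; rewrite fi; split => //=.
    exact: ltW.
  have [_ _ h] := UP n; apply: (le_trans h); rewrite lee_fin.
  by rewrite invf_ple ?posrE// (le_trans (ltW en))// ler_nat.
Qed.

End lebesgue_regularity.

(** * Measure of Lipschitz images *)

Section lipschitz_image.
Context {R : realType} (k : nat).
Local Notation V := 'rV[R]_k.+1.
Implicit Types a b : V.

(** A grid of step [dl] anchored at [a] needs at most [l i / dl + 1] cells along axis [i], so the
    total volume is at most the product of the [l i + dl]. *)
Lemma box_cubes a b (e : R) : 0 < e ->
  exists (dl : R) (s : seq V), [/\ 0 < dl,
    forall x, box a b x -> exists2 c, c \in s & box c (c + const_mx dl) x &
    (size s)%:R * dl ^+ k.+1 <= box_vol a b + e].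
Proof.
move=> e0.
pose l i := Num.max 0 (b 0 i - a 0 i).
have l0 i : 0 <= l i by rewrite le_max lexx.
have [dl dl0 H] := @prod_addr_le R _ (enum 'I_k.+1) _ e l0 e0.
pose t i := Num.truncn (l i / dl).
pose pt (m : {dffun forall i : 'I_k.+1, 'I_(t i).+1}) : V :=
  \row_i (a 0 i + (m i)%:R * dl).
exists dl, [seq pt m | m <- enum {dffun forall i : 'I_k.+1, 'I_(t i).+1}]; split => //.
- move=> x abx.
  have xa i : 0 <= (x 0 i - a 0 i) / dl.
    by have /andP[h _] := abx i; rewrite divr_ge0 ?subr_ge0// ltW.
  pose m : {dffun forall i : 'I_k.+1, 'I_(t i).+1} :=
    finfun (fun i => inord (Num.truncn ((x 0 i - a 0 i) / dl)) : 'I_(t i).+1).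
  exists (pt m); first by rewrite map_f// mem_enum.
  move=> i; rewrite !mxE ffunE inordK; last first.
    rewrite ltnS /t; apply: le_truncn; rewrite ler_pM2r ?invr_gt0//.
    by have /andP[_ /ltW h] := abx i; rewrite le_max lerB ?orbT.
  have /andP[h1 h2] := truncn_itv (xa i).
  move: h1 h2; rewrite ler_pdivlMr// ltr_pdivrMr// => h1 h2.
  by rewrite -natr1 mulrDl mul1r in h2; apply/andP; split; lra.
- have := H dl (ltW dl0) (lexx _); rewrite !big_enum/=; apply: le_trans.
  rewrite size_map -cardE card_dep_ffun foldrE big_map enumT.
  rewrite -[Finite.enum _]enumT big_enum/=.
  rewrite natr_prod -[X in _ ^+ X](card_ord k.+1) -prodr_const -big_split/=.
  apply: ler_prod => i _; rewrite mulr_ge0 ?ler0n ?(ltW dl0)//=.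
  rewrite card_ord -natr1 mulrDl mul1r lerD2r -ler_pdivlMr//.
  by rewrite /t truncn_le// divr_ge0// ltW.
Qed.

Local Open Scope ereal_scope.

(** In the sup norm, the points that [q] sends into a cube of side [dl] are sent by [p] into a set
    whose coordinates oscillate by at most [L * dl]. Boxes are half-open, hence the larger side
    [L' * dl]. *)
Lemma lipschitz_box (X : Type) (S : set X) (p q : X -> V) (L L' : R) a b (e : R) :
  (0 < L)%R -> (L < L')%R -> (0 < e)%R ->
  (forall x y, S x -> S y -> `|p x - p y| <= L * `|q x - q y|)%R ->
  leb_outer (p @` (S `&` q @^-1` (box a b))) <= (L' ^+ k.+1 * (box_vol a b + e))%:E.
Proof.
move=> L0 LL' e0 pq; have L'0 := lt_trans L0 LL'.
have [dl [s [dl0 cov vol]]] := box_cubes a b e0.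
pose Sc c : set X := S `&` q @^-1` (box c (c + const_mx dl)%R).
pose a' c : V := (\row_i inf [set p x 0 i | x in Sc c])%R.
pose b' c : V := (a' c + const_mx (L' * dl))%R.
apply: (@le_trans _ _ (\sum_(c <- s) (box_vol (a' c) (b' c))%:E)).
  apply: leb_outer_fin_cover => _ [x [Sx qx] <-].
  have [c cs cx] := cov _ qx; exists c.
    by elim: (s) cs => //= c' s' IH; rewrite inE => /orP[/eqP ->|/IH]; [left|right].
  have osc y i : Sc c y -> (p x 0%R i - p y 0%R i <= L * dl)%R.
    move=> [Sy qy]; apply: (le_trans (ler_norm _)).
    have := normv_coord (p x - p y)%R i; rewrite !mxE => /le_trans; apply.
    apply: (le_trans (pq _ _ Sx Sy)); rewrite ler_pM2l//.
    apply/(normv_leP _ (ltW dl0)) => j; rewrite !mxE ler_norml.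
    by move: (qy j) (cx j); rewrite !mxE => /andP[? ?] /andP[? ?]; apply/andP; split; lra.
  have Sxc : Sc c x by [].
  move=> i; rewrite !mxE; set I := [set _ | _ in _].
  have Ilb : has_lbound I.
    by exists (p x 0%R i - L * dl)%R => _ [y Scy <-]; have := osc y i Scy; lra.
  have -> /= : (inf I <= p x 0 i)%R by apply: ge_inf => //; exists x.
  have : (p x 0%R i - L * dl <= inf I)%R.
    apply: lb_le_inf; first by exists (p x 0%R i), x.
    by move=> _ [y Scy <-]; have := osc y i Scy; lra.
  have : (L * dl < L' * dl)%R by rewrite ltr_pM2r.
  lra.
have vol' c : box_vol (a' c) (b' c) = (L' ^+ k.+1 * dl ^+ k.+1)%R.
  rewrite /box_vol (eq_bigr (fun=> (L' * dl)%R)); last first.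
    move=> i _; rewrite !mxE addrAC subrr add0r; apply/max_idPr; by rewrite mulr_ge0 ?ltW.
  by rewrite prodr_const card_ord exprMn.
rewrite (eq_bigr (fun=> (L' ^+ k.+1 * dl ^+ k.+1)%:E)); last by move=> c _; rewrite vol'.
rewrite sumEFin lee_fin big_const_seq count_predT iter_addr_0 -mulr_natl mulrCA.
by rewrite ler_pM2l// exprn_gt0.
Qed.

(** Comparing two maps on one set covers both uses: [q] the identity gives upper bounds on images,
    while [p] linear and [q] the map under study gives lower bounds without inverting it. *)
Lemma lipschitz_leb_outer (X : Type) (S : set X) (p q : X -> V) (L : R) :
  (0 < L)%R ->
  (forall x y, S x -> S y -> `|p x - p y| <= L * `|q x - q y|)%R ->
  leb_outer (p @` S) <= (L ^+ k.+1)%:E * leb_outer (q @` S).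
Proof.
move=> L0 pq.
have [->|qfin] := eqVneq (leb_outer (q @` S)) +oo.
  by rewrite gt0_muley ?leey// lte_fin exprn_gt0.
have {}qfin : leb_outer (q @` S) < +oo by rewrite ltey.
have qf : leb_outer (q @` S) \is a fin_num.
  by rewrite ge0_fin_numE ?leb_outer_ge0.
have step (L' e : R) : (L < L')%R -> (0 < e)%R ->
    leb_outer (p @` S) <= (L' ^+ k.+1)%:E * (leb_outer (q @` S) + e%:E + e%:E).
  move=> LL' e0; have L'0 := lt_trans L0 LL'.
  have [a [b [qab abe]]] := leb_outer_approx e0 qfin.
  apply: (@le_trans _ _ (leb_outer
      (\bigcup_n (p @` (S `&` q @^-1` (box (a n) (b n))))))).
    apply: le_leb_outer => _ [x Sx <-].
    by have [|n _ nx] := qab (q x); [exists x|exists n => //; exists x].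
  apply: (le_trans (leb_outer_sigma_subadditive _)).
  apply: (@le_trans _ _ (\sum_(0 <= n <oo) (L' ^+ k.+1)%:E *
     ((box_vol (a n) (b n))%:E + (e / (2 ^ n.+1)%:R)%:E))).
    apply: lee_nneseries => [n _ _|n _]; first exact: leb_outer_ge0.
    rewrite -EFinD -EFinM; apply: lipschitz_box L0 LL' _ pq.
    by rewrite divr_gt0// ltr0n expn_gt0.
  rewrite nneseriesZl; last first.
    by move=> n _; rewrite -EFinD lee_fin addr_ge0 ?box_vol_ge0// divr_ge0// ltW.
  apply: lee_wpmul2l; first by rewrite lee_fin exprn_ge0// ltW.
  apply: (le_trans (epsilon_trick _ _ (ltW e0))).
    by move=> n; rewrite lee_fin box_vol_ge0.
  exact: leeD2r.
have step2 (L' : R) : (L < L')%R ->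
    leb_outer (p @` S) <= (L' ^+ k.+1)%:E * leb_outer (q @` S).
  move=> LL'; have L'0 : (0 < L' ^+ k.+1)%R by rewrite exprn_gt0// (lt_trans L0).
  apply/lee_addgt0Pr => e e0.
  have e'0 : (0 < e / (2 * L' ^+ k.+1))%R by rewrite divr_gt0// mulr_gt0.
  apply: (le_trans (step _ _ LL' e'0)).
  rewrite -addeA -EFinD ge0_muleDr ?leb_outer_ge0 ?lee_fin ?addr_ge0 ?(ltW e'0)//.
  rewrite leeD2l// -EFinM lee_fin le_eqVlt; apply/orP; left; apply/eqP.
  by field; rewrite gt_eqF// (lt_trans L0).
apply/lee_addgt0Pr => e e0.
pose M := (fine (leb_outer (q @` S)) + 1)%R.
have M0 : (0 < M)%R by rewrite ltr_wpDl// fine_ge0// leb_outer_ge0.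
have [dl dl0 H] := @prod_addr_le R _ (enum 'I_k.+1) (fun=> L) (e / M)%R
  (fun=> ltW L0) (divr_gt0 e0 M0).
have LL' : (L < L + dl)%R by rewrite ltrDl.
apply: (le_trans (step2 _ LL')).
have := H dl (ltW dl0) (lexx _); rewrite !big_enum/= !prodr_const card_ord => h.
apply: (@le_trans _ _ ((L ^+ k.+1 + e / M)%:E * leb_outer (q @` S))).
  by apply: lee_wpmul2r; rewrite ?leb_outer_ge0// lee_fin.
rewrite -(fineK qf) -!EFinM -EFinD lee_fin mulrDl lerD2l.
rewrite mulrAC ler_pdivrMr// ler_wpM2l ?ltW// ltrDl//.
Qed.

End lipschitz_image.

(** * Linear images and determinants *)

Section linear_image.
Context {R : realType} (k : nat).
Local Notation V := 'rV[R]_k.+1.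
Local Notation M := 'M[R]_k.+1.

Definition scales_by (B : M) (c : R) : Prop :=
  forall S : set V,
    (leb_outer ((fun x : V => x *m B) @` S) <= c%:E * leb_outer S)%E.

Lemma scales_by_mul (B C : M) (c d : R) : 0 <= d ->
  scales_by B c -> scales_by C d -> scales_by (B *m C) (c * d).
Proof.
move=> d0 Bc Cd S.
have -> : (fun x : V => x *m (B *m C)) @` S =
    (fun x : V => x *m C) @` ((fun x : V => x *m B) @` S).
  apply/seteqP; split => [_ [x Sx <-]|_ [_ [x Sx <-] <-]].
    by exists (x *m B); [exists x|rewrite mulmxA].
  by exists x => //; rewrite mulmxA.
apply: (le_trans (Cd _)); rewrite mulrC EFinM -muleA.
by apply: lee_wpmul2l; rewrite ?lee_fin.
Qed.

Lemma scales_by_lipschitz (B : M) (L : R) : 0 < L ->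
  (forall x : V, `|x *m B| <= L * `|x|) -> scales_by B (L ^+ k.+1).
Proof.
move=> L0 BL S.
have := @lipschitz_leb_outer R k V S (fun x => x *m B) id L L0.
rewrite image_id; apply => x y _ _; rewrite -mulmxBl; exact: BL.
Qed.

Lemma scales_by_diag (d : V) : (forall i, 0 < d 0 i) ->
  scales_by (diag_mx d) (\prod_i d 0 i).
Proof.
move=> d0 S.
have p0 : 0 < \prod_i d 0 i by apply: prodr_gt0.
have [->|Sfin] := eqVneq (leb_outer S) +oo%E.
  by rewrite gt0_muley ?leey// lte_fin.
apply/lee_addgt0Pr => e e0.
have e1 : 0 < e / \prod_i d 0 i by rewrite divr_gt0.
have {}Sfin : (leb_outer S < +oo)%E by rewrite ltey.
have [a [b [Sab abe]]] := leb_outer_approx e1 Sfin.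
apply: (@le_trans _ _ ((\prod_i d 0 i)%:E * \sum_(0 <= n <oo) (box_vol (a n) (b n))%:E)%E).
  rewrite -nneseriesZl; last by move=> n _; rewrite lee_fin box_vol_ge0.
  pose sc (u : V) := u *m diag_mx d.
  apply: (@le_trans _ _ (\sum_(0 <= n <oo) (box_vol (sc (a n)) (sc (b n)))%:E)%E).
    apply: leb_outer_cover => _ [x /Sab[n _ abx] <-]; exists n => // i.
    rewrite /sc !mul_mx_diag !mxE ler_pM2r ?ltr_pM2r//; exact: abx.
  apply: lee_nneseries => [n _ _|n _]; first by rewrite lee_fin box_vol_ge0.
  rewrite -EFinM lee_fin /box_vol -big_split/=; apply: ler_prod => i _.
  rewrite le_max lexx/= /sc !mul_mx_diag !mxE -mulrBl mulrC ge_max mulr_ge0 ?(ltW (d0 i)) ?le_max ?lexx//=.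
  by rewrite ler_pM2l// le_max lexx orbT.
apply: (@le_trans _ _ ((\prod_i d 0 i)%:E * (leb_outer S + (e / \prod_i d 0 i)%:E))%E).
  by apply: lee_wpmul2l; rewrite ?lee_fin ?(ltW p0).
rewrite ge0_muleDr ?leb_outer_ge0 ?lee_fin ?(ltW e1)// leeD2l// -EFinM lee_fin.
by rewrite mulrC mulfVK// gt_eqF.
Qed.

Lemma scales_by_perm (s : 'S_k.+1) : scales_by (perm_mx s) 1.
Proof.
rewrite -(expr1n R k.+1); apply: scales_by_lipschitz => // x; rewrite mul1r.
apply/normv_leP => // i; rewrite -[s]invgK -col_permE mxE; exact: normv_coord.
Qed.

Lemma normv_mulmx (x : V) (B : M) j :
  `|(x *m B) 0 j| <= (\sum_i `|B i j|) * `|x|.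
Proof.
rewrite mxE; apply: (le_trans (ler_norm_sum _ _ _)).
rewrite mulr_suml; apply: ler_sum => i _.
by rewrite normrM mulrC ler_wpM2l// normv_coord.
Qed.

(* Conjugating by [diag (t ^ w i)] multiplies the off-diagonal entries by at
   most [t], so that [B] becomes nearly diagonal as [t -> 0]. *)
Lemma scales_by_triangular (B : M) (w : 'I_k.+1 -> nat) :
  (forall i j, i != j -> (w i <= w j)%N -> B i j = 0) ->
  (forall i, B i i != 0) -> scales_by B (\prod_i `|B i i|).
Proof.
move=> Bw Bd S.
pose C := \sum_i \sum_j `|B i j| / `|B i i| + 1.
have C0 : 0 < C.
  by rewrite ltr_wpDl// sumr_ge0// => i _; rewrite sumr_ge0// => j _; rewrite divr_ge0.
have p0 : 0 < \prod_i `|B i i| by apply: prodr_gt0 => i _; rewrite normr_gt0.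
have step t : 0 < t -> t <= 1 ->
    scales_by B ((1 + t * C) ^+ k.+1 * \prod_i `|B i i|).
  move=> t0 t1.
  pose u : V := \row_i t ^- (w i); pose v : V := \row_i t ^+ (w i).
  pose bd : V := \row_i `|B i i|.
  (* [N] is [B] conjugated by [diag (t ^ w i)], its rows scaled to a diagonal of modulus 1. It is
     Lipschitz with constant [1 + t * C], and the determinants of the conjugating factors cancel. *)
  pose N : M := \matrix_(i, j) (`|B i i|^-1 * (v 0 i * B i j * u 0 j)).
  have u0 i : 0 < u 0 i by rewrite mxE invr_gt0 exprn_gt0.
  have v0 i : 0 < v 0 i by rewrite mxE exprn_gt0.
  have bd0 i : 0 < bd 0 i by rewrite mxE normr_gt0.
  have uv i : v 0 i * u 0 i = 1.
    by rewrite !mxE divff// expf_neq0// gt_eqF.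
  have BE : B = diag_mx u *m (diag_mx bd *m (N *m diag_mx v)).
    apply/matrixP => i j; rewrite !mul_diag_mx mul_mx_diag !mxE.
    have bi : `|B i i| != 0 by rewrite normr_eq0.
    have tw n : t ^+ n != 0 by rewrite expf_neq0// gt_eqF.
    have := tw (w i); have := tw (w j).
    move: (t ^+ w i) (t ^+ w j) (`|B i i|) bi => x y z z0 y0 x0.
    by field; rewrite x0 y0 z0.
  have Nij i j : i != j -> `|N i j| <= t * (`|B i j| / `|B i i|).
    move=> ij; rewrite mxE.
    have [wij|wij] := leqP (w i) (w j).
      by rewrite (Bw _ _ ij wij) !(mulr0, mul0r, normr0).
    rewrite !normrM normrV ?unitfE ?normr_eq0// normr_id.
    rewrite (gtr0_norm (v0 i)) (gtr0_norm (u0 j)) !mxE.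
    rewrite mulrC mulrA ler_wpM2r ?invr_ge0//.
    rewrite mulrAC ler_wpM2r// -expfB//.
    by rewrite -[leRHS]expr1 ler_wiXn2l ?(ltW t0)// subn_gt0.
  have Nii i : `|N i i| = 1.
    rewrite mxE (_ : v 0 i * B i i * u 0 i = B i i); last by rewrite mulrAC uv mul1r.
    by rewrite normrM normrV ?unitfE ?normr_eq0// normr_id mulVf// normr_eq0.
  have tC0 : 0 < 1 + t * C by rewrite addr_gt0// mulr_gt0.
  have Nlip : scales_by N ((1 + t * C) ^+ k.+1).
    apply: scales_by_lipschitz => // x.
    apply/normv_leP => [|j]; first by rewrite mulr_ge0 ?(ltW tC0).
    apply: (le_trans (normv_mulmx x N j)); rewrite ler_wpM2r//.
    rewrite (bigD1 j)//= Nii lerD2l.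
    apply: (@le_trans _ _ (\sum_(i | i != j) t * (`|B i j| / `|B i i|))).
      by apply: ler_sum => i ij; exact: Nij.
    rewrite -mulr_sumr ler_pM2l// /C; apply: ler_wpDr => //.
    apply: (@le_trans _ _ (\sum_i `|B i j| / `|B i i|)).
      rewrite [leRHS](bigD1 j)//= lerDr divr_ge0//.
    by apply: ler_sum => i _; rewrite [leRHS](bigD1 j)//= lerDl sumr_ge0.
  have := scales_by_mul _ (scales_by_diag u0)
    (scales_by_mul _ (scales_by_diag bd0) (scales_by_mul _ Nlip (scales_by_diag v0))).
  rewrite -BE.
  have h1 : 0 <= \prod_i v 0 i by apply: prodr_ge0 => i _; exact: ltW.
  have h2 : 0 <= (1 + t * C) ^+ k.+1 * \prod_i v 0 i.
    by rewrite mulr_ge0// exprn_ge0// ltW.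
  have h3 : 0 <= (\prod_i bd 0 i) * ((1 + t * C) ^+ k.+1 * \prod_i v 0 i).
    by rewrite mulr_ge0// prodr_ge0// => i _; exact: ltW.
  move=> /(_ h3 h2 h1); congr scales_by.
  have -> : \prod_i bd 0 i = \prod_i `|B i i| by apply: eq_bigr => i _; rewrite mxE.
  have : (\prod_i v 0 i) * (\prod_i u 0 i) = 1.
    by rewrite -big_split/= big1.
  set pv := \prod_i v 0 i; set pu := \prod_i u 0 i; set pb := \prod_i `|B i i|.
  by move=> e; transitivity (pv * pu * ((1 + t * C) ^+ k.+1 * pb)); [ring|rewrite e mul1r].
have [->|Sfin] := eqVneq (leb_outer S) +oo%E.
  by rewrite gt0_muley ?leey// lte_fin.
have Sf : leb_outer S \is a fin_num by rewrite ge0_fin_numE ?leb_outer_ge0// ltey.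
apply/lee_addgt0Pr => e e0.
pose z := fine (leb_outer S); pose m := z * \prod_i `|B i i| + 1.
have m0 : 0 < m by rewrite ltr_wpDl// mulr_ge0 ?(ltW p0)// fine_ge0// leb_outer_ge0.
have [dl dl0 H] := @prod_addr_le R _ (enum 'I_k.+1) (fun=> 1) (e / m)
  (fun=> ler01) (divr_gt0 e0 m0).
pose t := Num.min 1 (dl / C).
have t0 : 0 < t by rewrite lt_min ltr01 divr_gt0.
have t1 : t <= 1 by rewrite ge_min lexx.
have tC : t * C <= dl by rewrite -ler_pdivlMr// ge_min lexx orbT.
have := H (t * C) (ltW (mulr_gt0 t0 C0)) tC.
rewrite !big_enum/= !prodr_const card_ord expr1n => h.
apply: (le_trans (step t t0 t1 S)).
rewrite -(fineK Sf) -!EFinM -EFinD lee_fin -mulrA.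
rewrite -/z.
apply: (@le_trans _ _ ((1 + e / m) * ((\prod_i `|B i i|) * z))).
  by rewrite ler_wpM2r// mulr_ge0 ?(ltW p0)// fine_ge0// leb_outer_ge0.
rewrite mulrDl mul1r lerD2l mulrAC ler_pdivrMr// ler_wpM2l ?(ltW e0)//.
by rewrite /m mulrC lerDl.
Qed.

(** LUP factorization: permutations do not increase the sup norm, and the triangular factors fall
    under [scales_by_triangular] with weights [i] for [L] and [k - i] for [U]. *)
Lemma scales_by_det (B : M) : \det B != 0 -> scales_by B `|\det B|.
Proof.
move=> B0.
have := cormen_lup_perm B; have := cormen_lup_correct B.
have := cormen_lup_detL B; have := cormen_lup_lower B; have := @cormen_lup_upper R k B.
case: (cormen_lup B) => [[P L] U] /= Uu Ll detL PB /is_perm_mxP[s Ps].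
have Ldiag i : L i i = 1 by rewrite Ll// eqxx.
have detU : `|\det U| = `|\det B|.
  have := congr1 determinant PB; rewrite !det_mulmx detL mul1r => <-.
  by rewrite normrM Ps det_perm normrX normrN1 expr1n mul1r.
have detUE : \det U = \prod_i U i i.
  rewrite -det_tr det_trig; first by apply: eq_bigr => i _; rewrite mxE.
  by apply/is_trig_mxP => i j ij; rewrite mxE Uu.
have Ud i : U i i != 0.
  have : \det U != 0 by rewrite -normr_eq0 detU normr_eq0.
  by rewrite detUE => /prodf_neq0 /(_ i isT).
have BE : B = perm_mx (s^-1)%g *m (L *m U).
  rewrite (_ : L *m U = P *m B) //; rewrite Ps mulmxA -perm_mxM mulVg perm_mx1.
  by rewrite mul1mx.
have SL : scales_by L 1.
  have -> : 1 = \prod_(i < k.+1) `|L i i| :> R.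
    by rewrite big1// => i _; rewrite Ldiag normr1.
  apply: (@scales_by_triangular L (fun i => i)) => [i j ij wij|i].
    by rewrite Ll// (negbTE ij).
  by rewrite Ldiag oner_neq0.
have SU : scales_by U `|\det U|.
  rewrite detUE normr_prod.
  apply: (@scales_by_triangular U (fun i => (k - i)%N)) => [i j ij wij|i]; last exact: Ud.
  apply: Uu; rewrite ltn_neqAle eq_sym ij /=.
  by move: wij; rewrite leq_sub2lE// -ltnS.
have := scales_by_mul _ (scales_by_perm (s^-1)%g) (scales_by_mul (normr_ge0 _) SL SU).
by rewrite -BE !mul1r detU; apply.
Qed.

(** The upper bound [scales_by_det], applied to the inverse matrix. *)
Lemma leb_outer_linear_ge (B : M) (S : set V) : \det B != 0 ->
  (`|\det B|%:E * leb_outer S <= leb_outer ((fun x : V => x *m B) @` S))%E.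
Proof.
move=> B0.
have uB : B \in unitmx by rewrite unitmxE unitfE.
have iB0 : \det (invmx B) != 0 by rewrite det_inv invr_eq0.
have := scales_by_det iB0 ((fun x : V => x *m B) @` S).
rewrite image_comp (_ : _ \o _ = id) ?image_id; last first.
  by apply/funext => x /=; rewrite mulmxK.
rewrite det_inv normrV ?unitfE// => h.
have b0 : 0 < `|\det B| by rewrite normr_gt0.
rewrite (_ : leb_outer (_ @` S) = (`|\det B|%:E * (`|\det B|^-1%:E *
   leb_outer ((fun x : V => x *m B) @` S)))%E).
  by apply: lee_wpmul2l => //; rewrite lee_fin ltW.
by rewrite muleA -EFinM divff ?mul1e// gt_eqF.
Qed.

(** The hypothesis makes [x *m B] a Lipschitz function of [f x], so the measure of the linear image
    bounds that of [f]'s image from below. *)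
Lemma almost_linear_leb_outer_ge (B : M) (S : set V) (f : V -> V) (L : R) :
  \det B != 0 -> 0 < L ->
  (forall x y, S x -> S y -> `|(x - y) *m B| <= L * `|f x - f y|) ->
  (`|\det B|%:E * leb_outer S <= (L ^+ k.+1)%:E * leb_outer (f @` S))%E.
Proof.
move=> B0 L0 H; apply: (le_trans (leb_outer_linear_ge S B0)).
apply: lipschitz_leb_outer => // x y Sx Sy; rewrite -mulmxBl; exact: H.
Qed.

End linear_image.

(** * The area inequality *)

Section separable_measurability.
Context {R : realType} (k : nat).
Local Notation V := 'rV[R]_k.+1.
Local Notation lebT := (@lebT R k).

Definition separable (X : normedZmodType R) : Prop :=
  exists d : nat -> X, forall x (e : R), 0 < e -> exists n, `|x - d n| < e.

Lemma kopen_ball (X : normedZmodType R) (z : X) (r : R) :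
  kopen [set w : X | `|w - z| < r].
Proof.
move=> w /= wr; exists (r - `|w - z|); first by rewrite subr_gt0.
move=> u uw; have := ler_distD w u z; lra.
Qed.

(** In separable spaces an open set of pairs is a countable union of products of balls centred on
    dense sequences, which separates the conditions on [u] and [v]. *)
Lemma kmeasurable_pair (X Y : normedZmodType R) (Om : set V) (u : V -> X)
    (v : V -> Y) (W : X -> Y -> Prop) :
  separable X -> separable Y -> kmeasurable Om u -> kmeasurable Om v ->
  (forall x y, W x y -> exists2 e : R, 0 < e &
     forall x' y', `|x' - x| < e -> `|y' - y| < e -> W x' y') ->
  measurable (Om `&` [set x | W (u x) (v x)] : set lebT).
Proof.
move=> [d dP] [d' dP'] mu_ mv oW.
pose r (j : nat) : R := j.+1%:R^-1.
pose BX (p : nat * nat * nat) : set X := [set w : X | `|w - d p.1.1| < r p.2].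
pose BY (p : nat * nat * nat) : set Y := [set w : Y | `|w - d' p.1.2| < r p.2].
pose F (p : nat * nat * nat) : set lebT :=
  if `[< forall x y, BX p x -> BY p y -> W x y >] then
    (Om `&` u @^-1` (BX p)) `&` (Om `&` v @^-1` (BY p)) else set0.
have -> : Om `&` [set x | W (u x) (v x)] = \bigcup_p F p.
  apply/seteqP; split => x; last first.
    move=> [p _]; rewrite /F; case: asboolP => // pW [[Ox ux] [_ vx]].
    by split => //; exact: pW.
  move=> [Ox /oW[e e0 eW]].
  have e2 : 0 <= 2 / e by rewrite divr_ge0// ltW.
  have := archi_boundP e2; set j := Num.bound _ => ej.
  have rj0 : 0 < r j by rewrite invr_gt0.
  have rj : 2 * r j < e.
    move: ej; rewrite /r !ltr_pdivrMr// => ej.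
    by rewrite (lt_trans ej)// mulrC ltr_pM2l// ltr_nat.
  have [n xn] := dP (u x) _ rj0; have [m ym] := dP' (v x) _ rj0.
  exists (n, m, j) => //; rewrite /F asboolT//.
  move=> x' y'; rewrite /BX /BY /= => x'n y'm; apply: eW.
    by have := ler_distD (d n) x' (u x); rewrite (distrC (d n)); lra.
  by have := ler_distD (d' m) y' (v x); rewrite (distrC (d' m)); lra.
apply: countable_bigcupT_measurable; first exact: countableP.
move=> p; rewrite /F; case: asboolP => // _; apply: measurableI.
  by apply: mu_; exact: kopen_ball.
by apply: mv; exact: kopen_ball.
Qed.

Lemma separable_rV : separable (V : normedZmodType R).
Proof.
pose rv (p : 'rV[rat]_k.+1) : V := map_mx ratr p.
exists (fun n => if unpickle n is Some p then rv p else 0) => x e e0.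
have H i : exists p : rat, x 0 i - e < ratr p < x 0 i.
  have : x 0 i - e < x 0 i by rewrite ltrBlDr ltrDl.
  by move=> /rat_in_itvoo[p]; rewrite in_itv/=; exists p.
have [p pP] := choice H.
exists (pickle (\row_i p i)); rewrite pickleK; apply/normv_ltP => // i.
have /andP[h1 h2] := pP i.
by rewrite !mxE ltr_norml; apply/andP; split; lra.
Qed.

Lemma kopen_openE (U : set V) : kopen (K := (V : normedZmodType R)) U <-> open U.
Proof. by split => [kU|/openvP oU z Uz]; [apply/openvP => x Ux; exact: kU|exact: oU]. Qed.

Lemma vmeasurable_kmeasurable (Om : set V) (f : V -> V) :
  vmeasurable Om f -> kmeasurable (K := (V : normedZmodType R)) Om f.
Proof. by move=> mf U /kopen_openE; exact: mf. Qed.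

Lemma kmeasurable_id (Om : set V) : open Om ->
  kmeasurable (K := (V : normedZmodType R)) Om id.
Proof.
move=> oO U /kopen_openE oU; apply: (measurable_open (U := Om `&` U)).
exact: openI.
Qed.

End separable_measurability.

(** * From density points to estimates on pairs of points *)

Section density_overlap.
Context {R : realType} (k : nat).
Local Notation V := 'rV[R]_k.+1.
Local Notation M := 'M[R]_k.+1.
Local Notation lebT := (@lebT R k).
Local Notation kap := (k.+1%:R : R).
Implicit Types (x y z : V).

(** Density is defined with Euclidean balls, whereas Lipschitz estimates use the sup norm; the crude
    factor [kap], the dimension, passes from one to the other. *)
Definition supball x (r : R) : set V := [set y | `|y - x| < r].

Lemma normv_le_enorm x : `|x| <= enorm x.
Proof.
apply/normv_leP => [|i]; first exact: sqrtr_ge0.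
rewrite -sqrtr_sqr; apply: ler_wsqrtr; rewrite (bigD1 i)//= lerDl.
by apply: sumr_ge0 => j _; exact: sqr_ge0.
Qed.

Lemma enorm_le_normv x : enorm x <= kap * `|x|.
Proof.
rewrite -[leRHS]ger0_norm ?mulr_ge0// -sqrtr_sqr; apply: ler_wsqrtr.
apply: (@le_trans _ _ (\sum_(i < k.+1) `|x| ^+ 2)).
  apply: ler_sum => i _; rewrite -real_normK ?num_real//.
  by rewrite lerXn2r ?nnegrE ?normv_coord.
rewrite sumr_const card_ord -[leLHS]mulr_natl exprMn ler_wpM2r ?sqr_ge0//.
by rewrite -natrX ler_nat expnS expn1 leq_pmull.
Qed.

Lemma leb_supball_scale x y (r s : R) : 0 < r -> 0 < s ->
  (leb_outer (supball y s) <= ((s / r) ^+ k.+1)%:E * leb_outer (supball x r))%E.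
Proof.
move=> r0 s0; have L0 : 0 < s / r by rewrite divr_gt0.
have := @lipschitz_leb_outer R k V (supball x r)
   (fun z => y + (s / r) *: (z - x)) id _ L0.
rewrite image_id => H; apply: (le_trans _ (H _)); last first.
  move=> u v _ _; rewrite opprD addrACA subrr add0r -scalerBr opprB addrA addrNK.
  by rewrite normrZ gtr0_norm.
apply: le_leb_outer => z /= zy; exists (x + (r / s) *: (z - y)).
  rewrite /supball /= addrAC subrr add0r normrZ gtr0_norm ?divr_gt0//.
  by rewrite mulrAC ltr_pdivrMr// ltr_pM2l.
rewrite [x + _]addrC addrK scalerA mulf_div [s * r]mulrC divff.
  by rewrite scale1r addrC subrK.
by rewrite mulf_neq0// gt_eqF.
Qed.

Lemma leb_supball_fin x (r : R) : (leb_outer (supball x r) < +oo)%E.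
Proof.
apply: (@le_lt_trans _ _ (leb_outer (box (x - const_mx r) (x + const_mx r)))); last first.
  by apply: (le_lt_trans (leb_outer_box _ _)); rewrite ltry.
apply: le_leb_outer => y /= yx i; rewrite !mxE.
have := le_lt_trans (normv_coord _ i) yx; rewrite !mxE ltr_norml => /andP[h1 h2].
by apply/andP; split; lra.
Qed.

(** Every ball is an affine image of the given one, and balls of integer radius exhaust the
    space. *)
Lemma leb_supball0 x (r : R) : 0 < r -> leb_outer (supball x r) = 0%E ->
  forall A : set V, leb_outer A = 0%E.
Proof.
move=> r0 x0 A; apply/eqP; rewrite eq_le leb_outer_ge0 andbT.
apply: (@le_trans _ _ (leb_outer (\bigcup_n supball 0 n.+1%:R))).
  apply: le_leb_outer => y _; have := archi_boundP (normr_ge0 y).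
  set n := Num.bound _ => yn; exists n => //; rewrite /supball/= subr0.
  by rewrite (lt_trans yn)// ltr_nat.
apply: (le_trans (leb_outer_sigma_subadditive _)).
rewrite eseries0// => n _ _; apply/eqP; rewrite eq_le leb_outer_ge0 andbT.
by apply: (le_trans (leb_supball_scale x 0 r0 _)) => //; rewrite x0 mule0.
Qed.

(** Determinants are compared through volumes: the image of the unit ball under [B] is a Lipschitz
    image, with constant [L], of its image under [A]. *)
Lemma det_le_dominated (A B : M) (L : R) : (0 < leb_outer (supball (0 : V) 1%R))%E ->
  0 < L -> \det A != 0 -> \det B != 0 ->
  (forall v : V, `|v *m B| <= L * `|v *m A|) ->
  `|\det B| <= L ^+ k.+1 * `|\det A|.
Proof.
move=> m0 L0 A0 B0 BA.
set S := supball (0 : V) 1%R in m0.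
have mf : leb_outer S \is a fin_num.
  by rewrite ge0_fin_numE ?leb_outer_ge0// leb_supball_fin.
have := leb_outer_linear_ge S B0.
have h2 : (leb_outer ((fun x : V => x *m B) @` S) <=
    (L ^+ k.+1)%:E * leb_outer ((fun x : V => x *m A) @` S))%E.
  by apply: lipschitz_leb_outer => // x y _ _; rewrite -!mulmxBl; exact: BA.
have Lk : 0 < L ^+ k.+1 by rewrite exprn_gt0.
move=> /le_trans /(_ h2) /le_trans.
move=> /(_ ((L ^+ k.+1)%:E * (`|\det A|%:E * leb_outer S))%E).
have h3 : ((L ^+ k.+1)%:E * leb_outer ((fun x : V => x *m A) @` S) <=
    (L ^+ k.+1)%:E * (`|\det A|%:E * leb_outer S))%E.
  by apply: lee_wpmul2l; [rewrite lee_fin ltW|exact: scales_by_det].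
move=> /(_ h3); rewrite -(fineK mf) -!EFinM lee_fin mulrA ler_pM2r// fine_gt0//.
by rewrite m0 leb_supball_fin.
Qed.

Variables (Om : set V) (f : V -> V).

Definition almost_affine_set (A : M) (e : R) x : set V :=
  [set z | Om z /\ `|f z - f x - (z - x) *m A| < e * `|z - x|].

(** A Euclidean ball of radius [2 * kap * rho] has at most [(2 * kap) ^+ k.+1] times the measure of
    a sup-norm ball of radius [rho]. Missing this proportion of the former is missing at most a
    quarter of the latter, so two such defects cannot fill it. *)
Definition overlap_cst : R := (4 * (2 * kap) ^+ k.+1)^-1.

(** Density made uniform: one fixed proportion, below a radius from the countable list
    [1 / (m + 1)]. *)
Definition almost_affine_dense (A : M) (e : R) (m : nat) x : Prop :=
  forall r : R, 0 < r -> r < m.+1%:R^-1 ->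
    ((1 - overlap_cst)%:E * leb_outer (eball x r) <=
     leb_outer (almost_affine_set A e x `&` eball x r))%E.

Hypothesis oOm : open Om.
Hypothesis mf : vmeasurable Om f.

Lemma overlap_cst_gt0 : 0 < overlap_cst.
Proof. by rewrite invr_gt0 mulr_gt0// exprn_gt0// mulr_gt0. Qed.

Lemma measurable_almost_affine_set A e x :
  measurable (almost_affine_set A e x : set lebT).
Proof.
pose C := \sum_i \sum_j `|A i j| + `|e| + 2.
have C0 : 0 < C.
  by rewrite ltr_wpDl// addr_ge0// sumr_ge0// => i _; rewrite sumr_ge0.
have AC (v : V) : `|v *m A| + `|e| * `|v| <= (C - 2) * `|v|.
  rewrite /C addrK mulrDl lerD2r.
  apply/normv_leP => [|j].
    by rewrite mulr_ge0// sumr_ge0// => i _; rewrite sumr_ge0.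
  apply: (le_trans (normv_mulmx _ _ _)); rewrite ler_wpM2r//.
  apply: ler_sum => i _; rewrite (bigD1 j)//= lerDl sumr_ge0//.
apply: (kmeasurable_pair (W := fun (z : V) (w : V) =>
   `|w - f x - (z - x) *m A| < e * `|z - x|) _ _ _ (vmeasurable_kmeasurable mf)).
- exact: separable_rV.
- exact: separable_rV.
- exact: kmeasurable_id.
move=> z w h.
exists ((e * `|z - x| - `|w - f x - (z - x) *m A|) / (2 * C)).
  by rewrite divr_gt0 ?mulr_gt0// subr_gt0.
have C20 : 0 < 2 * C by rewrite mulr_gt0.
move=> z' w'; rewrite !ltr_pdivlMr// => hz hw.
have h1 : `|w' - f x - (z' - x) *m A| <=
    `|w - f x - (z - x) *m A| + `|w' - w| + `|(z' - z) *m A|.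
  rewrite [X in `|X| <= _](_ : _ = (w - f x - (z - x) *m A) + (w' - w) - (z' - z) *m A).
    by rewrite (le_trans (ler_normB _ _))// lerD2r ler_normD.
  by apply/rowP => i; rewrite !mulmxBl !mxE; ring.
have h2 : e * `|z - x| - `|e| * `|z' - z| <= e * `|z' - x|.
  have d1 : `| `|z' - x| - `|z - x| | <= `|z' - z|.
    apply: (le_trans (ler_dist_dist _ _)).
    by rewrite opprB addrA addrNK.
  have : `|e * (`|z' - x| - `|z - x|)| <= `|e| * `|z' - z|.
    by rewrite normrM ler_wpM2l.
  by rewrite ler_norml mulrBr => /andP[? _]; lra.
have h3 := AC (z' - z).
have c1 : `|w' - w| * 2 <= `|w' - w| * C.
  rewrite ler_wpM2l// /C lerDr addr_ge0// sumr_ge0// => i _; exact: sumr_ge0.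
have := normr_ge0 (w' - w); have := normr_ge0 (z' - z).
lra.
Qed.

(* Points with dense almost-affine sets see a common good point [z] in the
   overlap of two balls. *)
Lemma almost_affine_pair A e m x y : (0 < leb_outer (supball (0 : V) 1%R))%E ->
  0 < e -> almost_affine_dense A e m x -> almost_affine_dense A e m y ->
  2 * kap * `|x - y| < m.+1%:R^-1 ->
  `|f x - f y - (x - y) *m A| <= 3 * e * `|x - y|.
Proof.
move=> m0 e0 dx dy xym.
have [->|xy] := eqVneq x y; first by rewrite !subrr mul0mx subr0 normr0 mulr0.
pose rho := `|x - y|; have rho0 : 0 < rho by rewrite normr_gt0 subr_eq0.
have kap0 : 0 < kap by [].
(* A point of [Q] is within [2 * rho] of both [x] and [y] in the sup norm, hence within [r] in the
   Euclidean norm. *)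
pose r := 2 * kap * rho; have r0 : 0 < r by rewrite !mulr_gt0.
pose Q := supball x rho.
have Qf : leb_outer Q \is a fin_num.
  by rewrite ge0_fin_numE ?leb_outer_ge0// leb_supball_fin.
have Q0 : (0 < leb_outer Q)%E.
  rewrite lt0e leb_outer_ge0 andbT; apply/eqP => /(leb_supball0 rho0) h.
  by rewrite h ltxx in m0.
have bad u : almost_affine_dense A e m u ->
    (leb_outer (eball u r `\` almost_affine_set A e u) <=
     (4^-1 * fine (leb_outer Q))%:E)%E.
  move=> /(_ r r0 xym) du.
  have eu : (leb_outer (eball u r) <= ((2 * kap) ^+ k.+1)%:E * leb_outer Q)%E.
    apply: (@le_trans _ _ (leb_outer (supball u r))).
      by apply: le_leb_outer => z /=; exact: le_lt_trans (normv_le_enorm _).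
    have := leb_supball_scale x u rho0 r0.
    by rewrite /r mulfK// gt_eqF.
  have ef : leb_outer (eball u r) \is a fin_num.
    rewrite ge0_fin_numE ?leb_outer_ge0//; apply: (le_lt_trans eu).
    by rewrite -(fineK Qf) -EFinM ltry.
  have := measurable_almost_affine_set A e u (eball u r).
  rewrite [eball u r `&` almost_affine_set A e u]setIC -setDE => split_e.
  have : ((1 - overlap_cst)%:E * leb_outer (eball u r) +
      leb_outer (eball u r `\` almost_affine_set A e u) <= leb_outer (eball u r))%E.
    by rewrite [leRHS]split_e; exact: leeD2r.
  have bf : leb_outer (eball u r `\` almost_affine_set A e u) \is a fin_num.
    rewrite ge0_fin_numE ?leb_outer_ge0//.
    apply: (@le_lt_trans _ _ (leb_outer (eball u r))).
      by apply: le_leb_outer => z [].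
    by rewrite -ge0_fin_numE ?leb_outer_ge0.
  rewrite -(fineK bf) -(fineK ef) -EFinM -EFinD !lee_fin => h.
  move: eu; rewrite -(fineK ef) -(fineK Qf) -EFinM lee_fin => eu.
  have := overlap_cst_gt0 => c0.
  have : overlap_cst * fine (leb_outer (eball u r)) <= 4^-1 * fine (leb_outer Q).
    apply: (@le_trans _ _ (overlap_cst * ((2 * kap) ^+ k.+1 * fine (leb_outer Q)))).
      by rewrite ler_pM2l.
    rewrite mulrA ler_wpM2r ?fine_ge0 ?leb_outer_ge0// /overlap_cst invfM.
    by rewrite mulfVK// gt_eqF// exprn_gt0// mulr_gt0.
  lra.
have enlt u : u \in [:: x; y] -> Q `<=` eball u r.
  move=> ux z Qz; apply: (le_lt_trans (enorm_le_normv _)).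
  rewrite /r [2 * kap]mulrC -mulrA ltr_pM2l//.
  have : `|z - u| <= `|z - x| + `|x - u| by exact: ler_distD.
  move: ux; rewrite !inE => /orP[] /eqP ->; rewrite ?subrr ?normr0 -/rho.
    by move: Qz; rewrite /Q /supball/=; lra.
  by move: Qz; rewrite /Q /supball/=; lra.
have [[z [Qz gx gy]]|no] := pselect (exists z,
    [/\ Q z, almost_affine_set A e x z & almost_affine_set A e y z]); last first.
  exfalso.
  have : (leb_outer Q <= (4^-1 * fine (leb_outer Q))%:E + (4^-1 * fine (leb_outer Q))%:E)%E.
    apply: (le_trans _ (leeD (bad x dx) (bad y dy))).
    apply: (le_trans _ (outer_measureU2 _ _ _)); apply: le_leb_outer => z Qz.
    have [gx|gx] := pselect (almost_affine_set A e x z); [right|left]; split => //.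
    - by apply: (enlt y); rewrite ?inE ?eqxx ?orbT.
    - by move=> gy; apply: no; exists z.
    - by apply: (enlt x); rewrite ?inE ?eqxx.
  rewrite -{1}(fineK Qf) -EFinD lee_fin.
  have : 0 < fine (leb_outer Q) by rewrite fine_gt0// Q0 leb_supball_fin.
  lra.
have [_ hx] := gx; have [_ hy] := gy.
(* The error at [z] is [2 * e * rho] seen from [y] and [e * rho] seen from [x], whence the factor
   3. *)
have -> : f x - f y - (x - y) *m A =
   (f z - f y - (z - y) *m A) - (f z - f x - (z - x) *m A).
  by apply/rowP => i; rewrite !mulmxBl !mxE; ring.
apply: (le_trans (ler_normB _ _)).
have zy : `|z - y| <= `|z - x| + `|x - y| by exact: ler_distD.
have zx : `|z - x| < rho by [].
have : e * `|z - y| <= e * (2 * rho) by rewrite ler_pM2l//; move: zy; rewrite -/rho; lra.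
have : e * `|z - x| <= e * rho by rewrite ler_pM2l// ltW.
rewrite -/rho; lra.
Qed.

End density_overlap.

(** * Decomposition into almost linear pieces *)

Section almost_linear_pieces.
Context {R : realType} (k : nat).
Local Notation V := 'rV[R]_k.+1.
Local Notation M := 'M[R]_k.+1.
Local Notation lebT := (@lebT R k).
Local Notation kap := (k.+1%:R : R).
Implicit Types (x y z : V).

Lemma normv_mulmx_sum (B : M) (d : R) x : \sum_i \sum_j `|B i j| <= d ->
  `|x *m B| <= d * `|x|.
Proof.
move=> Bd; apply/normv_leP => [|j].
  by rewrite mulr_ge0// (le_trans _ Bd)// sumr_ge0// => i _; rewrite sumr_ge0.
apply: (le_trans (normv_mulmx _ _ _)); rewrite ler_wpM2r// (le_trans _ Bd)//.
by apply: ler_sum => i _; rewrite (bigD1 j)//= lerDl sumr_ge0.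
Qed.

Lemma rational_matrix_approx (B : M) (d : R) : 0 < d ->
  exists A : 'M[rat]_k.+1, forall x, `|x *m (B - map_mx ratr A)| <= d * `|x|.
Proof.
move=> d0; pose d1 := d / (k.+1 * k.+1)%:R.
have d10 : 0 < d1 by rewrite divr_gt0// ltr0n muln_gt0.
have H i : exists q : 'I_k.+1 -> rat, forall j, B i j - d1 < ratr (q j) < B i j.
  have Hj j : exists q : rat, B i j - d1 < ratr q < B i j.
    have : B i j - d1 < B i j by rewrite ltrBlDr ltrDl.
    by move=> /rat_in_itvoo[q]; rewrite in_itv/=; exists q.
  by have [q qP] := choice Hj; exists q.
have [q qP] := choice H.
exists (\matrix_(i, j) q i j) => x; apply: normv_mulmx_sum.
apply: (@le_trans _ _ (\sum_(i < k.+1) \sum_(j < k.+1) d1)).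
  apply: ler_sum => i _; apply: ler_sum => j _; rewrite !mxE ler_norml.
  by have /andP[h1 h2] := qP i j; apply/andP; split; lra.
by rewrite !sumr_const !card_ord -mulrnA -[leLHS]mulr_natr /d1 mulfVK//.
Qed.

(** [B] is the approximate differential, [A] its stand-in from a countable set. The factor 3 is the
    loss in [almost_affine_pair]; the half in the third bound leaves the other half of the tolerance
    to [approx_diff_dense]. *)
Lemma rational_matrix_dominates (B : M) (eta : R) :
  (0 < leb_outer (supball (0 : V) 1%R))%E -> 0 < eta -> \det B != 0 ->
  exists (A : 'M[rat]_k.+1) (j : nat), let A' : M := map_mx ratr A in
    [/\ \det A' != 0,
        forall x, 3 * j.+1%:R^-1 * `|x| <= eta * `|x *m A'|,
        forall x, `|x *m (B - A')| <= j.+1%:R^-1 / 2 * `|x| &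
        `|\det B| <= (1 + eta) ^+ k.+1 * `|\det A'|].
Proof.
move=> m0 eta0 B0.
have uB : B \in unitmx by rewrite unitmxE unitfE.
pose b := \sum_i \sum_j `|invmx B i j| + 1.
have b0 : 0 < b by rewrite ltr_wpDl// sumr_ge0// => i _; rewrite sumr_ge0.
have xB x : `|x| <= b * `|x *m B|.
  rewrite -{1}(mulmxK uB x); apply: normv_mulmx_sum.
  by rewrite /b lerDl.
(* [j > 6 * b / eta] makes [3 / (j + 1)] at most [eta / (2 * b)], which [low] turns into the second
   conclusion. *)
have j0 : 0 <= 6 * b / eta by rewrite divr_ge0 ?mulr_ge0// ltW.
have := archi_boundP j0; set j := Num.bound _ => jb.
have e0 : 0 < j.+1%:R^-1 :> R by rewrite invr_gt0.
(* The three bounds serve, in order, the third conclusion, the estimate [low], and the comparison of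
   determinants. *)
pose d := Num.min (j.+1%:R^-1 / 2) (Num.min ((2 * b)^-1) (eta / (2 * b))).
have b20 : 0 < 2 * b by rewrite mulr_gt0.
have d0 : 0 < d by rewrite !lt_min divr_gt0//= invr_gt0 b20/= divr_gt0.
have d1 : d <= j.+1%:R^-1 / 2 by rewrite ge_min lexx.
have d2 : d <= (2 * b)^-1 by rewrite !ge_min lexx orbT.
have d3 : d <= eta / (2 * b) by rewrite !ge_min lexx !orbT.
have [A AB] := rational_matrix_approx B d0.
exists A, j => A'.
have split_ x : x *m B = x *m A' + x *m (B - A') by rewrite mulmxBr addrC subrK.
have low x : `|x| <= 2 * b * `|x *m A'|.
  have h1 : `|x *m B| <= `|x *m A'| + d * `|x|.
    by rewrite split_ (le_trans (ler_normD _ _))// lerD2l.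
  have h2 := xB x.
  have h3 : b * (d * `|x|) <= `|x| / 2.
    rewrite mulrA [leRHS]mulrC ler_wpM2r//.
    apply: (@le_trans _ _ (b * (2 * b)^-1)); first by rewrite ler_pM2l.
    by rewrite invfM mulrCA divff ?mulr1// gt_eqF.
  have : b * `|x *m B| <= b * (`|x *m A'| + d * `|x|) by rewrite ler_pM2l.
  lra.
have A0 : \det A' != 0.
  apply/negP => /det0P[v v0 vA].
  have := low v; rewrite vA normr0 mulr0 normr_le0; exact/negP.
split=> //.
- move=> x; apply: (@le_trans _ _ (eta / (2 * b) * `|x|)).
    rewrite ler_wpM2r// ler_pdivlMr//.
    move: jb; rewrite ltr_pdivrMr// => jb.
    have : 3 * (2 * b) <= eta * j.+1%:R.
      have : j%:R * eta <= j.+1%:R * eta by rewrite ler_pM2r// ler_nat.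
      by lra.
    by move=> h; rewrite [leLHS]mulrAC ler_pdivrMr.
  rewrite mulrAC ler_pdivrMr// -mulrA ler_pM2l// mulrC; exact: low.
- by move=> x; apply: (le_trans (AB x)); rewrite ler_wpM2r.
- apply: det_le_dominated => //; first by rewrite addr_gt0.
  move=> x; rewrite split_ (le_trans (ler_normD _ _))// mulrDl mul1r lerD2l.
  apply: (le_trans (AB x)); apply: (@le_trans _ _ (eta / (2 * b) * `|x|)).
    by rewrite ler_wpM2r.
  rewrite mulrAC ler_pdivrMr// -mulrA ler_pM2l// mulrC; exact: low.
Qed.

Variables (Om : set V) (f : V -> V).

(** Half of [e] pays for replacing [B] by [A]; the other half, divided by [kap], is the tolerance
    used in the Euclidean definition of the differential. *)
Lemma approx_diff_dense (A B : M) (e : R) x : 0 < e ->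
  (forall y, `|y *m (B - A)| <= e / 2 * `|y|) -> approx_diff Om f x B ->
  exists m, almost_affine_dense Om f A e m x.
Proof.
move=> e0 BA dB.
have kap0 : 0 < kap by [].
have e10 : 0 < e / (2 * kap) by rewrite divr_gt0// mulr_gt0.
have [d d0 dP] := dB _ e10 _ (@overlap_cst_gt0 R k).
have di : 0 <= d^-1 by rewrite invr_ge0 ltW.
have := archi_boundP di; set m := Num.bound _ => dm.
exists m => r r0 rm.
have rd : r < d.
  apply: (lt_trans rm); rewrite invf_plt ?posrE//.
  by rewrite (lt_trans dm)// ltr_nat.
apply: (le_trans (dP r r0 rd)); apply: le_leb_outer => z [[Oz [zx hz]] bz].
split => //; split => //.
have n0 : 0 < `|z - x| by rewrite normr_gt0 subr_eq0; apply/eqP.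
have en0 : 0 < enorm (z - x) by exact: lt_le_trans (normv_le_enorm _).
move: hz; rewrite ltr_pdivrMr// => hz.
have -> : f z - f x - (z - x) *m A = (f z - f x - (z - x) *m B) + (z - x) *m (B - A).
  by rewrite mulmxBr addrA addrNK.
have h1 := normv_le_enorm (f z - f x - (z - x) *m B).
have h2 := BA (z - x).
have h3 : e / (2 * kap) * enorm (z - x) <= e / 2 * `|z - x|.
  apply: (@le_trans _ _ (e / (2 * kap) * (kap * `|z - x|))).
    by rewrite ler_pM2l// enorm_le_normv.
  by rewrite mulrA invfM mulrA mulfVK ?gt_eqF.
have := ler_normD (f z - f x - (z - x) *m B) ((z - x) *m (B - A)).
move: hz h1 h2 h3; set X := e / (2 * kap) * _ => hz h1 h2 h3 h4.
apply: (le_lt_trans h4); lra.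
Qed.

(* A measurable hull of [E] that inherits every closed condition on pairs
   [(x, f x)] holding on [E]. *)
Definition graph_closure (E : set V) : set V :=
  [set x | Om x /\ forall e : R, 0 < e ->
     exists y, [/\ E y, `|y - x| < e & `|f y - f x| < e]].

Lemma sub_graph_closure E : E `<=` Om -> E `<=` graph_closure E.
Proof.
by move=> EO x Ex; split; [exact: EO|move=> e e0; exists x; rewrite !subrr normr0].
Qed.

(** Within [Om], lying outside the closure is an open condition on the pair [(x, f x)]. *)
Lemma measurable_graph_closure E : open Om -> vmeasurable Om f ->
  measurable (graph_closure E : set lebT).
Proof.
move=> oO mf.
pose W (x w : V) := exists2 e : R, 0 < e & forall y, E y -> `|y - x| < e ->
   `|f y - w| < e -> False.
have -> : graph_closure E = Om `\` (Om `&` [set x | W x (f x)]).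
  apply/seteqP; split => x.
    move=> [Ox xE]; split => // -[_ [e e0 h]].
    by have [y [Ey yx fy]] := xE e e0; exact: h fy.
  move=> [Ox nW]; split => // e e0; apply: contrapT => h; apply: nW; split => //.
  by exists e => // y Ey yx fy; apply: h; exists y.
apply: measurableD; first exact: measurable_open.
apply: (kmeasurable_pair (W := W) _ _ _ (vmeasurable_kmeasurable mf)).
- exact: separable_rV.
- exact: separable_rV.
- exact: kmeasurable_id.
move=> x w [e e0 h]; exists (e / 2); first by rewrite divr_gt0.
move=> x' w' xx ww; exists (e / 2); first by rewrite divr_gt0.
move=> y Ey yx yw; apply: (h y) => //.
  by have := ler_distD x' y x; lra.
by have := ler_distD w' (f y) w; lra.
Qed.

Lemma graph_closure_pair E (A : M) (c s : R) : 0 <= c ->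
  (forall x y, E x -> E y -> `|x - y| < s ->
     `|f x - f y - (x - y) *m A| <= c * `|x - y|) ->
  forall x y, graph_closure E x -> graph_closure E y -> `|x - y| < s ->
     `|f x - f y - (x - y) *m A| <= c * `|x - y|.
Proof.
move=> c0 H x y [_ xE] [_ yE] xys; apply/ler_addgt0Pr => e e0.
pose a := \sum_i \sum_j `|A i j|.
have a0 : 0 <= a by apply: sumr_ge0 => i _; rewrite sumr_ge0.
pose C := 2 * c + 2 + 2 * a.
have C0 : 0 < C by rewrite /C; lra.
pose t := Num.min (e / C) ((s - `|x - y|) / 2).
have t0 : 0 < t by rewrite lt_min divr_gt0//= divr_gt0// subr_gt0.
have tC : t * C <= e by rewrite -ler_pdivlMr// ge_min lexx.
have ts : t <= (s - `|x - y|) / 2 by rewrite ge_min lexx orbT.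
have [x' [Ex' xx' fx']] := xE t t0; have [y' [Ey' yy' fy']] := yE t t0.
have x'y' : `|x' - y'| <= `|x - y| + `|x' - x| + `|y' - y|.
  have := ler_distD x x' y'; have := ler_distD y x y'.
  by rewrite (distrC y y'); lra.
have x'y's : `|x' - y'| < s by lra.
have h := H _ _ Ex' Ey' x'y's.
have -> : f x - f y - (x - y) *m A =
   (f x' - f y' - (x' - y') *m A) - (f x' - f x) + (f y' - f y)
   + (x' - x) *m A - (y' - y) *m A.
  by apply/rowP => i; rewrite !mulmxBl !mxE; ring.
have hx : `|(x' - x) *m A| <= a * `|x' - x| by exact: normv_mulmx_sum.
have hy : `|(y' - y) *m A| <= a * `|y' - y| by exact: normv_mulmx_sum.
have hx2 : a * `|x' - x| <= a * t by rewrite ler_wpM2l// ltW.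
have hy2 : a * `|y' - y| <= a * t by rewrite ler_wpM2l// ltW.
have hc : c * `|x' - y'| <= c * (`|x - y| + 2 * t) by rewrite ler_wpM2l//; lra.
apply: (le_trans (ler_normB _ _)).
have n1 := ler_normD ((f x' - f y' - (x' - y') *m A) - (f x' - f x) + (f y' - f y))
   ((x' - x) *m A).
have n2 := ler_normD ((f x' - f y' - (x' - y') *m A) - (f x' - f x)) (f y' - f y).
have n3 := ler_normB (f x' - f y' - (x' - y') *m A) (f x' - f x).
move: tC; rewrite /C; lra.
Qed.

Hypothesis oOm : open Om.
Hypothesis mf : vmeasurable Om f.

(** [piece_expand] gives the lower bound on the volume of images, [piece_lip] the measurability of
    images of compact subsets. [piece_weight] exchanges the Jacobian for a constant. *)
Record almost_linear_piece (L c : R) (a : V -> R) (S : set V) (A : M) : Prop :=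
  AlmostLinearPiece {
    piece_measurable : measurable (S : set lebT);
    piece_sub : S `<=` Om;
    piece_det : \det A != 0;
    piece_expand : forall x y, S x -> S y -> `|(x - y) *m A| <= L * `|f x - f y|;
    piece_lip : exists C, forall x y, S x -> S y -> `|f x - f y| <= C * `|x - y|;
    piece_weight : forall x, S x -> a x <= c * `|\det A| }.

(** Pieces are indexed by a rational matrix, a tolerance, a density radius and a centre. The graph
    closure makes them measurable, and a sublevel set of [a] imposes the weight bound. *)
Lemma almost_linear_cover (eta c : R) (a : V -> R) :
  (0 < leb_outer (supball (0 : V) 1%R))%E -> 0 < eta -> eta < 1 -> 0 <= c ->
  measurable_fun [set: lebT] a ->
  exists (S : nat -> set V) (A : nat -> M),
    (forall i, almost_linear_piece (1 - eta)^-1 (c * (1 + eta) ^+ k.+1) a (S i) (A i)) /\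
    forall x, Om x -> approx_differentiable Om f x -> Defs.jacobian Om f x != 0 ->
      a x <= c * `|Defs.jacobian Om f x| -> exists i, S i x.
Proof.
move=> m0 eta0 eta1 c0 ma.
have kap0 : 0 < kap by [].
have [d dP] := @separable_rV R k.
pose I := ('M[rat]_k.+1 * nat * nat * nat)%type.
pose mat (p : I) : M := map_mx ratr p.1.1.1.
pose ep (p : I) : R := p.1.1.2.+1%:R^-1.
pose m (p : I) := p.1.2.
(* Two points in a ball of this radius satisfy [2 * kap * |x - y| < 1 / (m + 1)], as
   [almost_affine_pair] requires. *)
pose rad (p : I) : R := (8 * kap * (m p).+1%:R)^-1.
pose cond (p : I) := \det (mat p) != 0 /\
  forall x, 3 * ep p * `|x| <= eta * `|x *m mat p|.
pose E p : set V := [set x | Om x /\ almost_affine_dense Om f (mat p) (ep p) (m p) x].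
pose S p : set V := graph_closure (E p) `&` supball (d p.2) (rad p) `&`
  [set x | a x <= c * (1 + eta) ^+ k.+1 * `|\det (mat p)|].
pose S' (n : nat) : set V := if unpickle n is Some p then
  if `[< cond p >] then S p else set0 else set0.
pose A' (n : nat) : M := if unpickle n is Some p then
  if `[< cond p >] then mat p else 1%:M else 1%:M.
(* Numbers that code no index, or one failing [cond], stand for the empty piece with the identity
   matrix. *)
have piece0 : almost_linear_piece (1 - eta)^-1 (c * (1 + eta) ^+ k.+1) a set0 1%:M.
  split => //; first by rewrite det1 oner_neq0.
  by exists 0.
exists S', A'; split.
  move=> n; rewrite /S' /A'; case: unpickle => // p.
  case: asboolP => // -[det0 low].
  have ep0 : 0 < ep p by rewrite invr_gt0.
  have rad0 : 0 < rad p by rewrite invr_gt0 !mulr_gt0.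
  have pair x y : S p x -> S p y ->
      `|f x - f y - (x - y) *m mat p| <= 3 * ep p * `|x - y|.
    move=> [[gx bx] _] [[gy by_] _].
    have xy : `|x - y| < (2 * kap * (m p).+1%:R)^-1.
      have := ler_distD (d p.2) x y; rewrite (distrC (d p.2)) => h.
      apply: (@lt_trans _ _ (2 * rad p)).
        by move: bx by_; rewrite /supball/=; lra.
      have q0 : 0 < (kap * (m p).+1%:R)^-1 by rewrite invr_gt0 mulr_gt0.
      rewrite /rad -[8 * _ * _]mulrA -[2 * _ * _]mulrA invfM [ltRHS]invfM.
      by move: q0; set q := (kap * _)^-1; lra.
    move: xy; apply: (graph_closure_pair (E := E p)) => //.
      by rewrite mulr_ge0// ltW.
    move=> u v [_ du] [_ dv] uv; apply: almost_affine_pair du dv _ => //.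
    by rewrite mulrC -ltr_pdivlMr ?mulr_gt0// -invfM mulrC.
  split.
  - apply: measurableI; first apply: measurableI.
    + exact: measurable_graph_closure.
    + apply: measurable_open; apply/openvP => x xr.
      exact: (@kopen_ball R (V : normedZmodType R) (d p.2) (rad p) x xr).
    + rewrite -[X in measurable X]setTI.
      have := ma measurableT _ (measurable_itv (Interval -oo%O
        (BRight (c * (1 + eta) ^+ k.+1 * `|\det (mat p)|)))).
      by congr (measurable _); apply/seteqP; split => x [_ /=] h; split => //=;
        rewrite in_itv/= in h *.
  - by move=> x [[[]]].
  - by [].
  - move=> x y Sx Sy; have := pair x y Sx Sy.
    have := low (x - y) => h1 h2.
    rewrite ler_pdivlMl ?subr_gt0//.
    have h3 : `|(x - y) *m mat p| <= `|f x - f y| + `|f x - f y - (x - y) *m mat p|.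
      by have := ler_normB (f x - f y) (f x - f y - (x - y) *m mat p); rewrite subKr.
    lra.
  - exists (3 * ep p + \sum_i \sum_j `|mat p i j|) => x y Sx Sy.
    have := pair x y Sx Sy.
    have h1 : `|(x - y) *m mat p| <= (\sum_i \sum_j `|mat p i j|) * `|x - y|.
      exact: normv_mulmx_sum.
    have := ler_normD (f x - f y - (x - y) *m mat p) ((x - y) *m mat p).
    by rewrite subrK mulrDl; lra.
  - by move=> x [_].
move=> x Ox dx; rewrite /Defs.jacobian; case: pselect => // {}dx J0 aJ.
set B := projT1 (cid dx) in J0 aJ.
have dB : approx_diff Om f x B by rewrite /B; case: cid.
have [A [j [A0 low AB detB]]] := rational_matrix_dominates m0 eta0 J0.
have e0 : 0 < j.+1%:R^-1 :> R by rewrite invr_gt0.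
have [m' mP] := approx_diff_dense e0 AB dB.
pose p0 : I := (A, j, m', 0%N).
have rad0 : 0 < rad p0 by rewrite invr_gt0 !mulr_gt0.
have [n xn] := dP x _ rad0.
exists (pickle (A, j, m', n)); rewrite /S' pickleK asboolT//.
split; first split.
- by apply: sub_graph_closure; [move=> y []|split].
- exact: xn.
- rewrite /=; apply: (le_trans aJ); rewrite -mulrA ler_wpM2l//.
Qed.

End almost_linear_pieces.

(** * Summation over the pieces *)

Section area_inequality.
Context {R : realType} (k : nat).
Local Notation V := 'rV[R]_k.+1.
Local Notation M := 'M[R]_k.+1.
Local Notation lebT := (@lebT R k).
Local Notation lebk := (@lebk R k).

Lemma lipschitz_compact_image (C : set V) (f : V -> V) (c : R) :
  compact C -> (forall x y, C x -> C y -> `|f x - f y| <= c * `|x - y|) ->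
  measurable (f @` C : set lebT).
Proof.
move=> cC fC; apply: measurable_closed; apply: compact_closed.
  exact: norm_hausdorff.
apply: continuous_compact => //; apply/subspace_continuousP => x Cx.
apply/cvgrPdist_lt => e e0.
have c0 : 0 < `|c| + 1 by rewrite ltr_wpDl.
have : nbhs x [set y | `|y - x| < e / (`|c| + 1)].
  apply: open_nbhs_nbhs; split; last by rewrite /= subrr normr0 divr_gt0.
  apply/openvP => z zr; exact: (@kopen_ball R (V : normedZmodType R) x _ z zr).
rewrite /within /=; apply: filterS => y /= yx Cy.
apply: (le_lt_trans (fC _ _ Cx Cy)); rewrite distrC.
apply: (@le_lt_trans _ _ ((`|c| + 1) * `|y - x|)).
  by rewrite ler_wpM2r// (le_trans (ler_norm _))// lerDl.
by rewrite mulrC -ltr_pdivlMr.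
Qed.

Variables (Om : set V) (f : V -> V) (a : V -> R) (c : R) (K : nat).
Hypothesis oOm : open Om.
Hypothesis fOm : forall x, Om x -> Om (f x).
Hypothesis mf : vmeasurable Om f.
Hypothesis a0 : forall x, 0 <= a x.
Hypothesis ma : measurable_fun [set: lebT] a.
Hypothesis c0 : 0 <= c.
Hypothesis aJ : ae_on Om (fun x => a x <= c * `|Defs.jacobian Om f x|).
Hypothesis manyK : leb_null (many_preimages Om f K).

(** One preimage of [y] from each of [K + 1] disjoint sets makes [K + 1] distinct preimages. *)
Lemma multiplicity_le (D : nat -> set V) (y : V) : trivIset setT D ->
  (forall i, D i `<=` Om) -> ~ many_preimages Om f K y ->
  (\sum_(0 <= i <oo) (\1_(f @` D i) y)%:E <=
   (K%:R * \1_(\bigcup_i (f @` D i)) y)%:E :> \bar R)%E.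
Proof.
move=> tD DO nmany.
have i0 i : (0 <= (\1_(f @` D i) y)%:E :> \bar R)%E by rewrite lee_fin.
apply: lime_le; first by apply: is_cvg_nneseries.
apply: nearW => n; rewrite sumEFin lee_fin.
have [[j _ yj]|ny] := pselect ((\bigcup_i (f @` D i)) y); last first.
  rewrite [X in _ * X]indicE memNset// mulr0 big1// => i _.
  by rewrite indicE memNset// => yi; apply: ny; exists i.
rewrite [X in _ * X]indicE mem_set ?mulr1; last by exists j.
pose s := [seq i <- iota 0 n | `[< (f @` D i) y >]].
have -> : \sum_(0 <= i < n) \1_(f @` D i) y = (size s)%:R :> R.
  rewrite size_filter -sum1_count natr_sum /index_iota subn0 [RHS]big_mkcond/=.
  apply: eq_bigr => i _; rewrite indicE.
  by case: asboolP => h; [rewrite mem_set|rewrite memNset].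
rewrite ler_nat leqNgt; apply/negP => Ks; apply: nmany.
have H i : exists x, (f @` D i) y -> D i x /\ f x = y.
  have [[x Dx fx]|ny] := pselect ((f @` D i) y); first by exists x.
  by exists 0.
have [g gP] := choice H.
pose t := take K.+1 s.
have tP i : i \in t -> D i (g i) /\ f (g i) = y.
  by move=> /mem_take; rewrite mem_filter => /andP[/asboolP yi _]; exact: gP.
split.
  by have [x Dx <-] := yj; apply: fOm; exact: (DO j).
exists (map g t); split.
- rewrite map_inj_in_uniq ?take_uniq ?filter_uniq ?iota_uniq//.
  move=> i i' it i't gg; apply: contrapT => /eqP ii'.
  have /trivIsetP/(_ i i' I I ii') := tD => /seteqP[h _].
  by apply: (h (g i)); split; [exact: (tP i it).1|rewrite gg; exact: (tP i' i't).1].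
- by rewrite size_map size_takel.
- by move=> _ /mapP[i it ->]; have [Di fi] := tP i it; split => //; exact: (DO i).
Qed.

(** [B] is a measurable substitute for the image of [Om]: a countable union of images of compact
    sets. At almost all points of [Om] left out of these compact sets, [a] vanishes. *)
Lemma area_inequality (eta : R) : 0 < eta ->
  exists B : set V, [/\ measurable (B : set lebT), B `<=` f @` Om &
    forall A : set V, measurable (A : set lebT) ->
      measurable (Om `&` f @^-1` A : set lebT) ->
      (\int[lebk]_(x in (Om `&` f @^-1` A : set lebT)) (a x)%:E <=
       ((1 + eta) * c * K%:R)%:E * lebk (A `&` B))%E].
Proof.
move=> eta0.
(* If the unit ball were null, all sets would be: this spares the proof that
   Lebesgue measure does not vanish. *)
have [m0|m0] := boolP (0 < leb_outer (supball (0 : V) 1%R))%E; last first.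
  exists set0; split => // A mA mX.
  have nullX : lebk (Om `&` f @^-1` A) = 0%E.
    apply: (@leb_supball0 R k 0 1) => //; apply/eqP.
    by rewrite eq_le leb_outer_ge0 andbT leNgt.
  rewrite (_ : integral _ _ _ = 0%E); first by rewrite mule_ge0 ?lee_fin ?mulr_ge0 ?addr_ge0 ?(ltW eta0).
  rewrite (eq_integral (fun x : lebT => `|(a x)%:E|%E)); last by move=> x _; rewrite gee0_abs ?lee_fin.
  apply: integral_abs_eq0 => //; apply: measurable_funTS; exact/measurable_EFinP.
have [t t0 tP] := @prod_addr_le R _ (enum 'I_k.+1) (fun=> 1) eta (fun=> ler01) eta0.
have := tP t (ltW t0) (lexx _); rewrite !big_enum/= !prodr_const card_ord expr1n => tk.
(* Solves [(1 + e) / (1 - e) = 1 + t]: the loss [1 + e] on determinants and [1 / (1 - e)] on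
   expansion combine to [(1 + t) ^+ k.+1 <= 1 + eta]. *)
pose e := t / (2 + t).
have t20 : 0 < 2 + t by rewrite addr_gt0.
have e0 : 0 < e by rewrite divr_gt0.
have e1 : e < 1 by rewrite ltr_pdivrMr// mul1r ltrDr.
have eE : (1 + e) * (1 - e)^-1 = 1 + t.
  have ne : 1 - e != 0 by rewrite subr_eq0 gt_eqF.
  rewrite /e in ne *; field.
  by rewrite gt_eqF//=; move: (gt_eqF t20); lra.
have [S [Ai [piece cover]]] := almost_linear_cover oOm mf m0 e0 e1 c0 ma.
pose D := seqDU S.
have mD i : measurable (D i : set lebT).
  by apply: seqDU_measurable => j; exact: (piece_measurable (piece j)).
have DS i : D i `<=` S i by exact: subset_seqDU.
have HC i : exists C : nat -> set V, [/\ forall n, compact (C n), forall n, C n `<=` D i &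
    leb_outer (D i `\` \bigcup_n C n) = 0%E] by exact: measurable_sigma_compact.
have [C CP] := choice HC.
pose D' i := \bigcup_n C i n.
have D'D i : D' i `<=` D i by move=> x [n _]; have [_ + _] := CP i; apply.
have mD' i : measurable (D' i : set lebT).
  apply: bigcupT_measurable => n; apply: measurable_closed; apply: compact_closed.
    exact: norm_hausdorff.
  by have [+ _ _] := CP i; apply.
pose B i := f @` D' i.
have mB i : measurable (B i : set lebT).
  rewrite /B /D' image_bigcup; apply: bigcupT_measurable => n.
  have [L fL] := piece_lip (piece i); have [cC CD _] := CP i.
  apply: (lipschitz_compact_image (cC n) (c := L)) => x y Cx Cy.
  by apply: fL; apply: DS; exact: (CD n).
have D'O i : D' i `<=` Om.
  by move=> x /D'D/DS; exact: (piece_sub (piece i)).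
have tD' : trivIset setT D'.
  have /trivIsetP tD := trivIset_seqDU S.
  apply/trivIsetP => i j _ _ ij; apply/seteqP; split => // x [xi xj].
  have /seteqP[h _] := tD i j I I ij.
  by apply: (h x); split; exact: D'D.
exists (\bigcup_i B i); split.
- exact: bigcupT_measurable.
- by move=> y [i _ [x /D'O Ox <-]]; exists x.
move=> A mA mX; set X := Om `&` _.
pose L := (1 - e)^-1.
have L0 : 0 < L by rewrite invr_gt0 subr_gt0.
pose cst_ := c * (1 + e) ^+ k.+1.
have cst0 : 0 <= cst_ by rewrite mulr_ge0// exprn_ge0// addr_ge0// ltW.
have mai i : measurable_fun [set: lebT] (fun x : lebT => (a x * \1_(D' i) x)%:E).
  by apply/measurable_EFinP; apply: measurable_funM => //; exact: measurable_indic.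
have ai0 i x : (0 <= (a x * \1_(D' i) x)%:E)%E by rewrite lee_fin mulr_ge0.
apply: (@le_trans _ _ (\int[lebk]_(x in (X : set lebT)) \sum_(0 <= i <oo) (a x * \1_(D' i) x)%:E)%E).
  apply: ae_ge0_le_integral => //.
  - by move=> x _; rewrite lee_fin.
  - by apply: measurable_funTS; exact/measurable_EFinP.
  - by move=> x _; apply: nneseries_ge0.
  - apply: measurable_funTS; exact: ge0_emeasurable_sum.
  (* Off this null set, a point with [a x > 0] has a nonzero Jacobian, so [f] is approximately
     differentiable there (else [jacobian] is 0) and the point lies in some piece. *)
  have nN : lebk.-negligible ([set x | Om x /\ ~ a x <= c * `|Defs.jacobian Om f x|] `|`
      \bigcup_i (D i `\` D' i)).
    apply: negligibleU; first exact/negligible_lebP.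
    by apply: negligible_bigcup => i; apply/negligible_lebP; have [_ _ +] := CP i.
  apply: negligibleS nN => x /= /not_implyP[[Ox _] /negP]; rewrite -ltNge => sx.
  have ax : 0 < a x.
    rewrite lt_neqAle a0 andbT; apply/eqP => ax; move: sx; apply/negP; rewrite -leNgt.
    by rewrite -ax; apply: nneseries_ge0 => i _ _; rewrite mul0r.
  have [xJ|xJ] := pselect (a x <= c * `|Defs.jacobian Om f x|); last by left.
  right.
  have J0 : Defs.jacobian Om f x != 0.
    by apply/eqP => J; move: xJ; rewrite J normr0 mulr0 leNgt ax.
  have dx : approx_differentiable Om f x.
    by apply: contrapT => nd; move/eqP: J0; apply; rewrite /Defs.jacobian; case: pselect.
  have [i Six] := cover x Ox dx J0 xJ.
  have : (\bigcup_k S k) x by exists i.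
  rewrite seqDU_bigcup_eq => -[j _ Djx]; exists j => //; split => // D'jx.
  move: sx; apply/negP; rewrite -leNgt.
  apply: (@le_trans _ _ (\sum_(0 <= i < j.+1) (a x * \1_(D' i) x)%:E)%E); last first.
    exact: nneseries_lim_ge.
  rewrite big_nat_recr//= [in X in (_ + X)%E]indicE mem_set// mulr1 leeDr//.
  exact: sume_ge0.
rewrite integral_nneseries//; last by move=> i; exact: measurable_funTS.
apply: (@le_trans _ _ (\sum_(0 <= i <oo) ((c * (1 + eta))%:E * lebk (A `&` B i)))%E).
  apply: lee_nneseries => [i _ _|i _]; first by apply: integral_ge0 => x _.
  apply: (@le_trans _ _ ((cst_ * `|\det (Ai i)|)%:E * lebk (X `&` D' i))%E).
    have mXD : measurable (X `&` D' i : set lebT) by exact: measurableI.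
    have mi : measurable_fun [set: lebT] (fun x => (\1_(X `&` D' i) x)%:E : \bar R).
      by apply/measurable_EFinP; exact: measurable_indic.
    have -> : lebk (X `&` D' i) = (\int[lebk]_x (\1_(X `&` D' i) x)%:E)%E.
      by rewrite integral_indic// setIT.
    rewrite -ge0_integralZl//; last by rewrite lee_fin mulr_ge0.
    rewrite integral_mkcond; apply: ge0_le_integral => //.
    + by move=> x _; rewrite patchE; case: ifP.
    + by apply/(measurable_restrictT _ _).1 => //; exact: measurable_funTS.
    + exact: measurable_funeM.
    + move=> x _; rewrite patchE; case: ifPn => [/set_mem Xx|_]; last first.
        by rewrite -EFinM lee_fin mulr_ge0// mulr_ge0.
      rewrite -EFinM lee_fin !indicE in_setI (mem_set Xx)/=.
      have [D'x|D'x] := boolP (x \in D' i); last by rewrite !mulr0.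
      rewrite !mulr1; apply: (piece_weight (piece i)); apply: DS; apply: D'D.
      exact: set_mem.
  apply: (@le_trans _ _ (cst_%:E * ((L ^+ k.+1)%:E * leb_outer (f @` (X `&` D' i))))%E).
    rewrite EFinM -muleA; apply: lee_wpmul2l; first by rewrite lee_fin.
    apply: almost_linear_leb_outer_ge => //; first exact: (piece_det (piece i)).
    by move=> x y [_ Dx] [_ Dy]; apply: (piece_expand (piece i)); apply: DS; exact: D'D.
  rewrite muleA -EFinM; apply: lee_pmul.
  - by rewrite lee_fin mulr_ge0// exprn_ge0// ltW.
  - exact: leb_outer_ge0.
  - by rewrite lee_fin /cst_ -mulrA -exprMn eE ler_wpM2l.
  - by apply: le_leb_outer => _ [x [[Ox Ax] Dx] <-]; split => //; exists x.
rewrite nneseriesZl; last by move=> i _; exact: leb_outer_ge0.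
rewrite (_ : (1 + eta) * c * K%:R = c * (1 + eta) * K%:R); last by rewrite [c * _]mulrC.
rewrite [in leRHS]EFinM -muleA; apply: lee_wpmul2l.
  by rewrite lee_fin mulr_ge0// addr_ge0// ltW.
have mind i : measurable_fun (A : set lebT) (fun y => (\1_(B i) y)%:E : \bar R).
  by apply/measurable_EFinP; exact: measurable_indic.
rewrite (eq_eseriesr (g := fun i => (\int[lebk]_(y in (A : set lebT)) (\1_(B i) y)%:E)%E)); last first.
  by move=> i _; rewrite integral_indic// setIC.
rewrite -integral_nneseries//.
apply: (@le_trans _ _ (\int[lebk]_(y in (A : set lebT)) (K%:R * \1_(\bigcup_i B i) y)%:E)%E).
  apply: ae_ge0_le_integral => //.
  - by move=> y _; apply: nneseries_ge0 => i _ _; rewrite lee_fin.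
  - by apply: ge0_emeasurable_sum => // i _.
  - apply/measurable_EFinP; apply: measurable_funM => //.
    by apply: measurable_indic; exact: bigcupT_measurable.
  apply: (negligibleS _ ((negligible_lebP _).2 manyK)) => y /= ny.
  by apply: contrapT => nm; apply: ny => _; exact: multiplicity_le.
under eq_integral do rewrite EFinM.
rewrite ge0_integralZl//; last by apply/measurable_EFinP; apply: measurable_indic; exact: bigcupT_measurable.
by rewrite integral_indic//; [rewrite setIC|exact: bigcupT_measurable].
Qed.

End area_inequality.

(** * The space $L^{\psi,1}$ *)

Section transfer_L1.
Context d (T : measurableType d) {R : realType}.
Variable mu : {sigma_finite_measure set T -> \bar R}.
Local Open Scope ereal_scope.
Variables (N : nat) (F : 'I_N -> T -> T) (a : 'I_N -> T -> R) (alpha : R).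
Hypothesis mF : forall n, measurable_fun setT (F n).
Hypothesis ma : forall n, measurable_fun setT (a n).
Hypothesis a0 : forall n x, (0 <= a n x)%R.
Hypothesis alpha0 : (0 <= alpha)%R.
Hypothesis transfer_indic : forall A : set T, measurable A ->
  \int[mu]_x transfer F a (fun y => (\1_A y)%:E) x <= alpha%:E * mu A.

Import HBNNSimple.

(** From indicators to simple functions by linearity, then to nonnegative functions by monotone
    limits. *)
Lemma transfer_L1 w : measurable_fun setT w -> (forall x, 0 <= w x) ->
  \int[mu]_x transfer F a w x <= alpha%:E * \int[mu]_x w x.
Proof.
move=> mw w0.
have tr0 u x : (forall y, 0 <= u y) -> 0 <= transfer F a u x.
  by move=> u0; apply: sume_ge0 => n _; rewrite mule_ge0 ?lee_fin.
have simple (g : {nnsfun T >-> R}) :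
    \int[mu]_x transfer F a (EFin \o g) x <= alpha%:E * \int[mu]_x (g x)%:E.
  pose s := finmap.enum_fset (fset_set (range g)).
  (* Clamping makes the coefficient nonnegative for every real [y]; values of [g] are unchanged. *)
  pose p (y : R) : R := Num.max 0%R y.
  have p0 y : (0 <= p y)%R by rewrite le_max lexx.
  pose I (y : R) : set T := g @^-1` [set y].
  have mI y : measurable (I y) by exact: measurable_funPTI.
  have gE x : (g x)%:E = \sum_(y <- s) (p y)%:E * (\1_(I y) x)%:E.
    rewrite {1}[g x]fimfunE fsbig_finite//= -sumEFin.
    apply: eq_big_seq => y ys; rewrite EFinM (_ : p y = y)//; apply/max_idPr.
    by move: ys; rewrite in_fset_set// inE => -[z _ <-]; exact: fun_ge0.
  have mi y : measurable_fun setT (fun x => (\1_(I y) x)%:E : \bar R).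
    by apply/measurable_EFinP; exact: measurable_indic.
  have mt y := measurable_transfer mF ma (mi y).
  have t0 y x : 0 <= transfer F a (fun z => (\1_(I y) z)%:E) x.
    by apply: tr0 => z; rewrite lee_fin.
  have -> : transfer F a (EFin \o g) = (fun x => \sum_(y <- s) (p y)%:E *
        transfer F a (fun z => (\1_(I y) z)%:E) x).
    apply/funext => x; rewrite /transfer.
    transitivity (\sum_(n < N) \sum_(y <- s) (p y)%:E * ((a n x)%:E * (\1_(I y) (F n x))%:E)).
      apply: eq_bigr => n _; rewrite /= gE ge0_sume_distrr; last first.
        by move=> y ys; rewrite mule_ge0 ?lee_fin.
      by apply: eq_bigr => y _; rewrite muleCA.
    rewrite exchange_big/=; apply: eq_bigr => y ys.
    by rewrite ge0_sume_distrr// => n _; rewrite mule_ge0 ?lee_fin.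
  rewrite ge0_integral_sum//; last 2 first.
  - by move=> y; exact: measurable_funeM.
  - by move=> y x _; rewrite mule_ge0 ?lee_fin.
  rewrite (_ : \int[mu]_x (g x)%:E = \sum_(y <- s) (p y)%:E * mu (I y)); last first.
    under eq_integral do rewrite gE.
    rewrite ge0_integral_sum//; last 2 first.
    - by move=> y; exact: measurable_funeM.
    - by move=> y x _; rewrite mule_ge0 ?lee_fin.
    apply: eq_bigr => y _; rewrite ge0_integralZl ?lee_fin//.
    by rewrite integral_indic// setIT.
  rewrite ge0_sume_distrr; last by move=> y _; rewrite mule_ge0 ?lee_fin.
  apply: lee_sum => y _; rewrite ge0_integralZl ?lee_fin// muleCA.
  by apply: lee_wpmul2l; [rewrite lee_fin|exact: transfer_indic].
pose g := nnsfun_approx measurableT mw.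
have gw x : (g m x)%:E @[m --> \oo] --> w x by exact: cvg_nnsfun_approx.
have ndg x : nondecreasing_seq (fun m => (g m x)%:E).
  by move=> m n mn; rewrite lee_fin; exact/lefP/nd_nnsfun_approx.
have gle m x : (g m x)%:E <= w x.
  have -> : w x = ereal_sup (range (fun m => (g m x)%:E)).
    by apply: cvg_unique (gw x) (ereal_nondecreasing_cvgn (ndg x)).
  by apply: ereal_sup_ubound; exists m.
have mg m : measurable_fun setT (EFin \o g m) by exact/measurable_EFinP.
have cvt x : transfer F a (EFin \o g m) x @[m --> \oo] --> transfer F a w x.
  apply: cvg_nnesum => n _.
    by apply: nearW => m; rewrite mule_ge0 ?lee_fin.
  by apply: cvgeZl => //; exact: gw.
have -> : \int[mu]_x transfer F a w x =
    limn (fun m => \int[mu]_x transfer F a (EFin \o g m) x).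
  rewrite -monotone_convergence//.
  - by apply: eq_integral => x _; apply/esym/cvg_lim => //; exact: cvt.
  - by move=> m; exact: measurable_transfer.
  - by move=> m x _; apply: tr0 => y; rewrite lee_fin.
  - move=> x _ m n mn; apply: lee_sum => i _; apply: lee_wpmul2l; first by rewrite lee_fin.
    exact: ndg.
apply: lime_le.
  apply: ereal_nondecreasing_is_cvgn => m n mn; apply: ge0_le_integral => //.
  - by move=> x _; apply: tr0 => y; rewrite lee_fin.
  - exact: measurable_transfer.
  - exact: measurable_transfer.
  - move=> x _; apply: lee_sum => i _; apply: lee_wpmul2l; first by rewrite lee_fin.
    exact: ndg.
apply: nearW => m; apply: (le_trans (simple (g m))).
apply: lee_wpmul2l; first by rewrite lee_fin.
by apply: ge0_le_integral => //; [move=> x _; rewrite lee_fin|exact: mg].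
Qed.

End transfer_L1.

(** * The inverse of [tau] is quasi-concave *)

Section psi_quasiconcave.
Context {R : realType}.
Variable psi : R -> R.
Hypothesis adm : admissible_psi psi.

Let sincr s t : 0 <= s -> s < t -> psi s < psi t.
Proof. by case: adm => _ + _ _ _; apply. Qed.

Let psi0 : psi 0 = 0.
Proof. by case: adm => -[_ [_ [_ [_ [h _]]]]] _ _ _ _. Qed.

Let psi_gt0 t : 0 < t -> 0 < psi t.
Proof. by move=> t0; rewrite -psi0 sincr. Qed.

Let psi_convex s t l : 0 <= s -> 0 <= t -> 0 <= l <= 1 ->
  psi (l * s + (1 - l) * t) <= l * psi s + (1 - l) * psi t.
Proof. by case: adm => -[_ [_ [_ [h _]]]] _ _ _ _; exact: h. Qed.

(** At the supremum [u] of the sublevel set, left continuity gives [psi u <= c]; convexity on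
    [[u, u + 1]] excludes an upward jump and gives the converse. *)
Lemma psi_surjective c : 0 < c -> exists2 u, 0 < u & psi u = c.
Proof.
move=> c0; case: adm => -[_ [_ [lc [_ [_ [_ infty]]]]]] _ _ _ _.
have [T TP] := infty (c + 1).
pose E := [set u | 0 <= u /\ psi u <= c].
have E0 : E 0 by split => //; rewrite psi0 ltW.
have ubE : ubound E T.
  move=> u [u0 uc]; rewrite leNgt; apply/negP => Tu.
  by have := TP u (ltW Tu); lra.
have hsE : has_sup E by split; [exists 0|exists T].
pose u := sup E.
have u0 : 0 <= u by apply: sup_upper_bound.
have uc : psi u <= c.
  have [->|un0] := eqVneq u 0; first by rewrite psi0 ltW.
  have {}un0 : 0 < u by rewrite lt_neqAle eq_sym un0.
  rewrite leNgt; apply/negP => cu.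
  have e0 : 0 < psi u - c by rewrite subr_gt0.
  have [dl dl0 H] := lc u un0 _ e0.
  have [v [v0 vc] uv] := sup_adherent dl0 hsE.
  have vu : v <= u by apply: sup_upper_bound.
  have := H v uv vu; rewrite ltr_norml => /andP[h _]; lra.
have cu : c <= psi u.
  rewrite leNgt; apply/negP => uc'.
  have p1 : 0 < psi (u + 1) by apply: psi_gt0; rewrite ltr_wpDl.
  pose dl := Num.min 1 ((c - psi u) / psi (u + 1)).
  have dl0 : 0 < dl by rewrite lt_min ltr01 divr_gt0// subr_gt0.
  have dl1 : dl <= 1 by rewrite ge_min lexx.
  have dlc : dl * psi (u + 1) <= c - psi u by rewrite -ler_pdivlMr// ge_min lexx orbT.
  have u10 : 0 <= u + 1 by rewrite addr_ge0.
  have dl01 : 0 <= dl <= 1 by rewrite dl1 ltW.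
  have := psi_convex u10 u0 dl01.
  have -> : dl * (u + 1) + (1 - dl) * u = u + dl by ring.
  have pu : 0 <= psi u.
    by move: u0; rewrite le_eqVlt => /orP[/eqP <-|/psi_gt0/ltW//]; rewrite psi0.
  move=> h; have : E (u + dl).
    split; first by rewrite addr_ge0// ltW.
    by apply: (le_trans h); have := mulr_ge0 (ltW dl0) pu; lra.
  by move=> /(sup_upper_bound hsE); rewrite -/u; lra.
exists u; last by apply/eqP; rewrite eq_le uc.
rewrite lt_neqAle u0 andbT; apply/eqP => u0'.
by move: cu; rewrite -u0' psi0 leNgt c0.
Qed.

Lemma tau_gt0 t : 0 < t -> 0 < tau psi t.
Proof.
by move=> t0; rewrite /tau gt_eqF// invr_gt0 psi_gt0// invr_gt0.
Qed.

Lemma tau_increasing s t : 0 <= s -> s < t -> tau psi s < tau psi t.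
Proof.
move=> s0 st; have t0 : 0 < t by exact: le_lt_trans st.
move: s0; rewrite le_eqVlt => /orP[/eqP <-|s0].
  by rewrite {1}/tau eqxx tau_gt0.
rewrite /tau !gt_eqF// ltf_pV2 ?posrE ?psi_gt0 ?invr_gt0//.
by apply: sincr; rewrite ?invr_ge0 ?(ltW t0)// ltf_pV2 ?posrE.
Qed.

Definition tau_inv_fin (r : R) : R := xget 0 [set t | 0 <= t /\ tau psi t = r].

Lemma tau_inv_finP r : 0 <= r -> 0 <= tau_inv_fin r /\ tau psi (tau_inv_fin r) = r.
Proof.
move=> r0; apply: (@xgetPex _ 0 [set t | 0 <= t /\ tau psi t = r]).
move: r0; rewrite le_eqVlt => /orP[/eqP <-|r0].
  by exists 0; split => //; rewrite /tau eqxx.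
have [|u u0 pu] := @psi_surjective r^-1; first by rewrite invr_gt0.
exists u^-1; split; first by rewrite invr_ge0 ltW.
by rewrite /tau gt_eqF ?invr_gt0// invrK pu invrK.
Qed.

Lemma tau_inv_ext (u : \bar R) : tau_inv psi u = ext_phi tau_inv_fin u.
Proof. by case: u. Qed.

Lemma tau_invK t : 0 <= t -> tau_inv_fin (tau psi t) = t.
Proof.
move=> t0.
have tt0 : 0 <= tau psi t.
  by move: t0; rewrite le_eqVlt => /orP[/eqP <-|/tau_gt0/ltW//]; rewrite /tau eqxx.
have [i0 it] := tau_inv_finP tt0.
have [h|h|//] := ltgtP (tau_inv_fin (tau psi t)) t.
  by have := tau_increasing i0 h; rewrite it ltxx.
by have := tau_increasing t0 h; rewrite it ltxx.
Qed.

(** Convexity and [psi 0 = 0] give [psi (l * x) <= l * psi x]. With [x = 1 / s] and [l = s / t] this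
    is [t * psi (1 / t) <= s * psi (1 / s)] for [s <= t]: [tau t / t] is nondecreasing, so the
    inverse has a nonincreasing ratio. *)
Lemma quasiconcave_tau_inv : quasiconcave tau_inv_fin.
Proof.
have t00 : tau psi 0 = 0 by rewrite /tau eqxx.
split.
- by rewrite -[X in tau_inv_fin X]t00 tau_invK.
- move=> r r0; have [i0 it] := tau_inv_finP (ltW r0).
  rewrite lt_neqAle i0 andbT; apply/eqP => i00.
  by move: r0; rewrite -it -i00 t00 ltxx.
- move=> s t s0 st; have [is0 its] := tau_inv_finP s0.
  have [it0 itt] := tau_inv_finP (le_trans s0 st).
  rewrite leNgt; apply/negP => h.
  by have := tau_increasing it0 h; rewrite its itt ltNge st.
- move=> a b b0 ba.
  have [t0 at_] := tau_inv_finP (le_trans (ltW b0) ba).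
  have [s0 bs] := tau_inv_finP (ltW b0).
  set t := tau_inv_fin a in t0 at_ *; set s := tau_inv_fin b in s0 bs *.
  have {}s0 : 0 < s.
    by rewrite lt_neqAle s0 andbT; apply/eqP => s00; move: b0; rewrite -bs -s00 t00 ltxx.
  have st : s <= t.
    rewrite leNgt; apply/negP => ts; have := tau_increasing t0 ts.
    by rewrite at_ bs ltNge ba.
  have {}t0 : 0 < t by exact: lt_le_trans st.
  rewrite -at_ -bs /tau !gt_eqF//.
  have pt : 0 < psi t^-1 by rewrite psi_gt0// invr_gt0.
  have ps : 0 < psi s^-1 by rewrite psi_gt0// invr_gt0.
  rewrite ler_pdivrMr// mulrAC ler_pdivlMr//.
  have l01 : 0 <= s / t <= 1 by rewrite divr_ge0 ?(ltW s0) ?(ltW t0)//= ler_pdivrMr// mul1r.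
  have si : 0 <= s^-1 by rewrite invr_ge0 ltW.
  have := psi_convex si (lexx 0) l01.
  rewrite psi0 !mulr0 !addr0 mulrAC divff ?gt_eqF// mul1r.
  by rewrite mulrAC ler_pdivlMr// mulrC.
- move=> M; have n0 : 0 <= `|M| + 1 by rewrite addr_ge0.
  exists (tau psi (`|M| + 1)); first by rewrite ltW// tau_gt0// ltr_wpDl.
  by rewrite tau_invK// (le_trans (ler_norm _))// lerDl.
Qed.

End psi_quasiconcave.

(** * Functions on [Om] extended to the whole space *)

Section lebesgue_functions.
Context {R : realType} (k : nat).
Local Notation V := 'rV[R]_k.+1.
Local Notation lebT := (@lebT R k).
Local Notation lebk := (@lebk R k).
Variable Om : set V.
Hypothesis oOm : open Om.

Lemma ae_onP (P : V -> Prop) : ae_on Om P <-> {ae lebk, forall x : lebT, Om x -> P x}.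
Proof.
rewrite /ae_on -negligible_lebP.
have -> : [set x | Om x /\ ~ P x] = ~` [set x | Om x -> P x].
  by apply/seteqP; split => x /=; [move=> [Ox nP] /(_ Ox)|move/not_implyP].
by [].
Qed.

(** [vmeasurable] only speaks of open sets. A measurable set is a countable union of compact sets up
    to a null set, and [null_preimages] takes care of the latter. *)
Lemma measurable_preimage (f : V -> V) (A : set V) : vmeasurable Om f ->
  null_preimages Om f -> measurable (A : set lebT) ->
  measurable (Om `&` f @^-1` A : set lebT).
Proof.
move=> mf nf mA; have [C [cC CA C0]] := measurable_sigma_compact mA.
have -> : Om `&` f @^-1` A = (\bigcup_n (Om `\` (Om `&` f @^-1` (~` C n)))) `|`
    (Om `&` f @^-1` (A `\` \bigcup_n C n)).
  apply/seteqP; split => x.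
    move=> [Ox Ax]; have [[n _ Cn]|nC] := pselect ((\bigcup_n C n) (f x)).
      by left; exists n => //; split => // -[_]; apply.
    by right; split.
  move=> [[n _ [Ox nC]]|[Ox [Ax _]]]; split => //.
  by apply: (CA n); apply: contrapT => nCx; apply: nC.
apply: measurableU; last by apply: leb_null_measurable; exact: nf.
apply: bigcupT_measurable => n; apply: measurableD; first exact: measurable_open.
apply: mf; rewrite openC; apply: compact_closed => //; exact: norm_hausdorff.
Qed.

(** The identity outside [Om] keeps the property of pulling null sets back to null sets, which a
    constant value could destroy. *)
Definition extend_id (f : V -> V) (x : lebT) : lebT :=
  if `[< Om x >] then f x else x.

Lemma measurable_extend_id (f : V -> V) : vmeasurable Om f ->
  null_preimages Om f -> measurable_fun setT (extend_id f).
Proof.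
move=> mf nf _ A mA; rewrite setTI.
have -> : extend_id f @^-1` A = (Om `&` f @^-1` A) `|` (A `\` Om).
  apply/seteqP; split => x; rewrite /extend_id /=; case: asboolP => Ox.
  - by left.
  - by right.
  - by move=> [[]//|[_ /(_ Ox)]].
  - by move=> [[/Ox]//|[]].
apply: measurableU; first exact: measurable_preimage.
by apply: measurableD => //; exact: measurable_open.
Qed.

Lemma negligible_extend_id (f : V -> V) (A : set lebT) : null_preimages Om f ->
  lebk.-negligible A -> lebk.-negligible (extend_id f @^-1` A).
Proof.
move=> nf nA.
have nU : lebk.-negligible ((Om `&` f @^-1` A) `|` A).
  by apply: negligibleU => //; apply/negligible_lebP; apply: nf; apply/negligible_lebP.
apply: negligibleS nU => x; rewrite /extend_id /=.
by case: asboolP => Ox; [left|right].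
Qed.

Section scalar.
Context {Kf : normedZmodType R}.
Implicit Types u v : V -> Kf.

Definition norm_on u (x : lebT) : R := if `[< Om x >] then `|u x| else 0.

Lemma norm_on_ge0 u x : 0 <= norm_on u x.
Proof. by rewrite /norm_on; case: asboolP. Qed.

Lemma norm_onE u x : Om x -> norm_on u x = `|u x|.
Proof. by move=> Ox; rewrite /norm_on asboolT. Qed.

Lemma norm_on0 u x : ~ Om x -> norm_on u x = 0.
Proof. by move=> Ox; rewrite /norm_on asboolF. Qed.

Lemma measurable_norm_on u : kmeasurable Om u -> measurable_fun setT (norm_on u).
Proof.
move=> mu_; apply: (measurability _ (RGenOInfty.measurableE R)).
move=> /= _ [_ [r ->] <-]; rewrite setTI.
have [r0|r0] := ltP r 0.
  rewrite (_ : _ @^-1` _ = setT)//; apply/seteqP; split => // x _ /=.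
  by rewrite in_itv/= andbT (lt_le_trans r0)// norm_on_ge0.
rewrite (_ : _ @^-1` _ = Om `&` u @^-1` [set z | r < `|z|]); last first.
  apply/seteqP; split => x /=; rewrite in_itv/= andbT /norm_on; case: asboolP => // Ox.
  - by rewrite ltNge r0.
  - by move=> [].
  - by move=> [].
apply: mu_ => z /= rz; exists (`|z| - r); first by rewrite subr_gt0.
move=> w wz; have := ler_normB w (w - z); rewrite subKr; lra.
Qed.

Lemma lorentz_normE (psi : R -> R) u :
  lorentz_norm psi Om u = lorentz lebk (tau_inv_fin psi) (EFin \o norm_on u).
Proof.
apply: eq_integral => s; rewrite inE/= in_itv/= andbT => s0.
rewrite tau_inv_ext; congr (ext_phi _ _); rewrite /distribution /distr.
congr (leb_outer _); apply/seteqP; split => x /=; rewrite lte_fin /norm_on.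
  by move=> [Ox h]; rewrite asboolT.
by case: asboolP => // _; rewrite ltNge s0.
Qed.

Lemma compact_leb_fin (C : set V) : compact C -> (leb_outer C < +oo)%E.
Proof.
move=> cC; have [M [_ MP]] := compact_bounded cC.
have := MP (M + 1); rewrite ltrDl ltr01 => /(_ isT) h.
apply: (le_lt_trans _ (@leb_supball_fin R k 0 (M + 2))).
apply: le_leb_outer => x Cx; rewrite /supball/= subr0.
by apply: (le_lt_trans (h x Cx)); lra.
Qed.

Lemma simple_integral (C : set V) (s : seq (R * set V)) : measurable (C : set lebT) ->
  (forall p, p \in s -> 0 <= p.1 /\ leb_measurable p.2 /\ p.2 `<=` C) ->
  measurable_fun (C : set lebT) (fun x => (\sum_(p <- s) p.1 * \1_(p.2) x)%:E) /\
  (\sum_(p <- s) (p.1%:E * leb_outer p.2) =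
   \int[lebk]_(x in (C : set lebT)) (\sum_(p <- s) p.1 * \1_(p.2) x)%:E)%E.
Proof.
move=> mC; elim: s => [|p s IH] sP.
  split; first by apply: (eq_measurable_fun (cst 0%E)) => [x _|//]; rewrite big_nil.
  by rewrite big_nil integral0_eq// => x _; rewrite big_nil.
have [p0 [mp pC]] : 0 <= p.1 /\ leb_measurable p.2 /\ p.2 `<=` C.
  by apply: sP; rewrite inE eqxx.
have sP' q : q \in s -> 0 <= q.1 /\ leb_measurable q.2 /\ q.2 `<=` C.
  by move=> qs; apply: sP; rewrite inE qs orbT.
have [ms sE] := IH sP'.
have mp1 : measurable_fun (C : set lebT) (fun x => (p.1 * \1_(p.2) x)%:E).
  by apply/measurable_EFinP; apply: measurable_funM => //; exact: measurable_indic.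
have E : (fun x : lebT => (\sum_(q <- p :: s) q.1 * \1_(q.2) x)%:E) =
   (fun x => (p.1 * \1_(p.2) x)%:E + (\sum_(q <- s) q.1 * \1_(q.2) x)%:E)%E.
  by apply/funext => x; rewrite big_cons EFinD.
split; first by rewrite E; exact: emeasurable_funD.
rewrite big_cons E ge0_integralD//.
- congr (_ + _)%E; last exact: sE.
  under eq_integral do rewrite EFinM.
  rewrite ge0_integralZl//; last by apply/measurable_EFinP; exact: measurable_indic.
  rewrite integral_indic//; congr (_ * leb_outer _)%E.
  by apply/seteqP; split => x; [move=> px; split => //; exact: pC|move=> []].
- by move=> x _; rewrite lee_fin mulr_ge0.
- move=> x _; rewrite lee_fin big_seq; apply: sumr_ge0 => q /sP'[q0 _].
  by rewrite mulr_ge0.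
Qed.

(** Cutting at ratio 2 gives a finite cost, and a finite cost gives finite integrals over sets of
    finite measure, compact sets among them. *)
Lemma L1loc_of_lorentz (psi : R -> R) u : admissible_psi psi -> kmeasurable Om u ->
  (lorentz_norm psi Om u < +oo)%E -> L1loc Om u.
Proof.
move=> adm mu_; rewrite lorentz_normE => ufin; split => // C cC CO.
have mn := measurable_norm_on mu_.
have mC : measurable (C : set lebT).
  by apply: measurable_closed; apply: compact_closed => //; exact: norm_hausdorff.
have qc := quasiconcave_tau_inv adm.
have men : measurable_fun setT (EFin \o norm_on u) by exact/measurable_EFinP.
have n0 x : (0 <= (EFin \o norm_on u) x)%E by rewrite lee_fin norm_on_ge0.
have two1 : (1 < 2 :> R) by rewrite ltr1n.
have fin2 : ((2 * 2)%:E * lorentz lebk (tau_inv_fin psi) (EFin \o norm_on u) < +oo)%E.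
  have f : lorentz lebk (tau_inv_fin psi) (EFin \o norm_on u) \is a fin_num.
    by rewrite ge0_fin_numE// lorentz_ge0.
  by rewrite -(fineK f) -EFinM ltry.
have := lorentz_cost_integral qc men n0 (lorentz_cost_layers qc men n0 ufin two1)
  fin2 mC (compact_leb_fin cC).
apply: le_lt_trans; apply: ge_ereal_sup => _ [s [sP su ->]].
have [ms ->] := simple_integral mC sP.
apply: ge0_le_integral => //.
- move=> x _; rewrite lee_fin big_seq; apply: sumr_ge0 => p /sP[p0 _].
  by rewrite mulr_ge0.
- exact: measurable_funTS.
- by move=> x Cx; apply: (le_trans (su x Cx)); rewrite /= norm_onE//; exact: CO.
Qed.

End scalar.
End lebesgue_functions.

(** * Contraction of the integral *)

Section L1_contraction.
Context {R : realType} (k N : nat) {Kf : normedZmodType R}.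
Local Notation V := 'rV[R]_k.+1.
Local Notation lebT := (@lebT R k).
Local Notation lebk := (@lebk R k).
Variables (Om : set V) (f : 'I_N -> V -> V) (g : 'I_N -> V -> Kf).
Variables (K L : nat) (alpha : R).
Hypothesis oOm : open Om.

(** A point in more than [L] of the [B n] lies in an intersection of more than [L] images, which is
    null by maximality of [L]; there are finitely many such intersections. *)
Lemma images_multiplicity (B : 'I_N -> set V) : is_L Om f L ->
  (forall n, B n `<=` f n @` Om) ->
  {ae lebk, forall y : lebT, \sum_(n < N) \1_(B n) y <= L%:R :> R}.
Proof.
move=> [_ LP] Bf.
pose s (A : {set 'I_N}) := [seq n <- enum 'I_N | n \in A].
have sorted_s A : sorted (fun a b : 'I_N => (a < b)%N) (s A).
  apply: sorted_filter; first by move=> a b c; exact: ltn_trans.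
  have := iota_ltn_sorted 0 N; rewrite -val_enum_ord sorted_map.
  by [].
have H (A : {set 'I_N}) : {ae lebk, forall y : lebT,
    (L < size (s A))%N -> ~ images_cap Om f (s A) y}.
  have [LA|LA] := ltnP L (size (s A)); last by apply: aeW.
  have : leb_null (images_cap Om f (s A)).
    apply/eqP; rewrite eq_le leb_outer_ge0 andbT leNgt; apply/negP => h.
    have it : incr_tuple (s A) by split => //; exact: leq_ltn_trans LA.
    by have := LP _ it h; rewrite leqNgt LA.
  move=> /negligible_lebP; apply: negligibleS => y /= h.
  by apply: contrapT => ny; apply: h.
have {}H : {ae lebk, forall y : lebT, forall A : {set 'I_N},
    (L < size (s A))%N -> ~ images_cap Om f (s A) y} by exact: filter_forall.
apply: filterS H => y yH.
pose A := [set n : 'I_N | `[< B n y >]]%SET.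
have -> : \sum_(n < N) \1_(B n) y = (size (s A))%:R :> R.
  rewrite size_filter -sum1_count natr_sum [RHS]big_mkcond/= big_enum/=.
  apply: eq_bigr => n _; rewrite indicE inE.
  by case: asboolP => h; [rewrite mem_set|rewrite memNset].
rewrite ler_nat leqNgt; apply/negP => LA; apply: (yH A LA).
move=> n; rewrite mem_filter inE => /andP[/asboolP ny _]; exact: Bf.
Qed.

(** Truncation makes the bound by [alpha / N] hold everywhere; on [Om] the weight is the modulus of
    [g n] almost everywhere. *)
Definition weight n (x : lebT) : R := Num.min (norm_on Om (g n) x) (alpha / N%:R).

Hypothesis N0 : (0 < N)%N.
Hypothesis K0 : (0 < K)%N.
Hypothesis alpha0 : 0 <= alpha.
Hypothesis fOm : forall n x, Om x -> Om (f n x).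
Hypothesis mf : forall n, vmeasurable Om (f n).
Hypothesis nf : forall n, null_preimages Om (f n).
Hypothesis manyK : forall n, leb_null (many_preimages Om (f n) K).
Hypothesis mg : forall n, kmeasurable Om (g n).
Hypothesis HL : is_L Om f L.
Hypothesis gJ : forall n, ae_on Om (fun x =>
   `|g n x| <= alpha * Num.min (`|Defs.jacobian Om (f n) x| / (K * L)%:R) (N%:R^-1)).

Lemma weight_bounds n x : 0 <= weight n x <= alpha / N%:R.
Proof. by rewrite le_min norm_on_ge0 divr_ge0//= ge_min lexx orbT. Qed.

Lemma measurable_weight n : measurable_fun setT (weight n).
Proof. by apply: measurable_minr => //; exact: measurable_norm_on. Qed.

Lemma weight0 n x : ~ Om x -> weight n x = 0.
Proof. by move=> Ox; rewrite /weight norm_on0//; apply/min_idPl; rewrite divr_ge0. Qed.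

Lemma weight_ae n : {ae lebk, forall x : lebT, Om x -> weight n x = `|g n x|}.
Proof.
have H := (ae_onP Om _).1 (gJ n); apply: filterS H => x gx Ox.
rewrite /weight norm_onE//; apply/min_idPl; apply: (le_trans (gx Ox)).
by rewrite ler_wpM2l// ge_min lexx orbT.
Qed.

Let L_gt0 : (0 < L)%N.
Proof. by have [[s [[_ s0] <- _]] _] := HL. Qed.

Local Open Scope ereal_scope.

Lemma transfer_indic_le (A : set lebT) : measurable A ->
  \int[lebk]_x transfer (fun n => extend_id Om (f n)) weight (fun y => (\1_A y)%:E) x
  <= alpha%:E * lebk A.
Proof.
move=> mA.
have KL0 : (0 < (K * L)%:R :> R)%R by rewrite ltr0n muln_gt0 K0.
have mF n := measurable_extend_id oOm (mf n) (nf n).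
have mA1 : measurable_fun [set: lebT] (fun y => (\1_A y)%:E : \bar R).
  by apply/measurable_EFinP; exact: measurable_indic.
have step (eta : R) : (0 < eta)%R ->
    \int[lebk]_x transfer (fun n => extend_id Om (f n)) weight (fun y => (\1_A y)%:E) x
    <= ((1 + eta) * alpha)%:E * lebk A.
  move=> eta0.
  (* In [c], [K] compensates the multiplicity of each map and [L] the overlap of the images, leaving
     [(1 + eta) * alpha]. *)
  pose c : R := (alpha / (K * L)%:R)%R.
  have c0 : (0 <= c)%R by rewrite divr_ge0.
  have H n : exists B : set V, [/\ measurable (B : set lebT), B `<=` f n @` Om &
      \int[lebk]_x ((weight n x)%:E * (\1_A (extend_id Om (f n) x))%:E) <=
       ((1 + eta) * c * K%:R)%:E * lebk (A `&` B)].
    have aJ : ae_on Om (fun x => weight n x <= c * `|Defs.jacobian Om (f n) x|)%R.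
      apply/ae_onP; have aeg := (ae_onP Om _).1 (gJ n); apply: filterS aeg => x gx Ox.
      rewrite ge_min norm_onE// (le_trans (gx Ox))//.
      apply: (@le_trans _ _ (alpha * (`|Defs.jacobian Om (f n) x| / (K * L)%:R))%R).
        by rewrite ler_wpM2l// ge_min lexx.
      by rewrite /c mulrA mulrAC.
    have w0 x : (0 <= weight n x)%R by case/andP: (weight_bounds n x).
    have [B [mB Bf BP]] := area_inequality oOm (@fOm n) (mf n) w0
      (measurable_weight n) c0 aJ (manyK n) eta0.
    exists B; split => //.
    have mX := measurable_preimage oOm (mf n) (nf n) mA.
    apply: le_trans (BP A mA mX); rewrite [leRHS]integral_mkcond.
    rewrite le_eqVlt; apply/orP; left; apply/eqP; apply: eq_integral => x _.
    rewrite patchE; have [Ox|Ox] := pselect (Om x).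
      rewrite /extend_id asboolT// indicE.
      have [Ax|Ax] := pselect (A (f n x)).
        by rewrite !mem_set// mule1.
      by rewrite !memNset ?mule0// => -[].
    by rewrite weight0// mul0e memNset// => -[].
  have [B BP] := choice H.
  have LL : (L%:R != 0 :> R)%R by rewrite pnatr_eq0 -lt0n.
  have KK : (K%:R != 0 :> R)%R by rewrite pnatr_eq0 -lt0n.
  have cE : ((1 + eta) * c * K%:R = (1 + eta) * alpha / L%:R)%R.
    by rewrite /c natrM; field; rewrite LL KK.
  have m1 n : measurable_fun [set: lebT] (fun x => (weight n x)%:E).
    by apply/measurable_EFinP; exact: measurable_weight.
  have m2 n : measurable_fun [set: lebT]
      (fun x => (\1_A (extend_id Om (f n) x))%:E : \bar R).
    exact: (measurableT_comp mA1 (mF n)).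
  rewrite /transfer ge0_integral_sum//; last 2 first.
  - by move=> n; exact: emeasurable_funM.
  - by move=> n x _; rewrite mule_ge0 ?lee_fin//; case/andP: (weight_bounds n x).
  apply: (@le_trans _ _ (\sum_(n < N) ((1 + eta) * alpha / L%:R)%:E * lebk (A `&` B n))).
    by apply: lee_sum => n _; rewrite -cE; have [] := BP n.
  have e0 : (0 <= (1 + eta) * alpha / L%:R)%R.
    by rewrite divr_ge0// mulr_ge0// addr_ge0// ltW.
  rewrite -ge0_sume_distrr; last by move=> n _; exact: measure_ge0.
  apply: (@le_trans _ _ (((1 + eta) * alpha / L%:R)%:E * (L%:R%:E * lebk A))).
    apply: lee_wpmul2l; first by rewrite lee_fin.
    have mB n : measurable (B n : set lebT) by have [] := BP n.
    have mi n : measurable_fun A (fun y => (\1_(B n) y)%:E : \bar R).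
      by apply/measurable_EFinP; exact: measurable_indic.
    rewrite (eq_bigr (fun n => \int[lebk]_(y in A) (\1_(B n) y)%:E)); last first.
      by move=> n _; rewrite integral_indic// setIC.
    rewrite -ge0_integral_sum//.
    rewrite -integral_cst//; apply: ae_ge0_le_integral => //.
    - by move=> y _; apply: sume_ge0 => n _; rewrite lee_fin.
    - exact: emeasurable_sum.
    - by move=> y _; rewrite lee_fin.
    have Bf n : B n `<=` f n @` Om by have [] := BP n.
    have := images_multiplicity HL Bf; apply: filterS => y yL _.
    by rewrite /= sumEFin lee_fin.
  by rewrite muleA -EFinM mulfVK.
(* Letting [eta] tend to 0 takes a finite [lebk A]. If it is infinite, so is the right-hand side,
   unless [alpha] is 0 and [step] already gives 0. *)
have [Ay|Afin] := eqVneq (lebk A) +oo.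
  have [a00|an0] := eqVneq alpha 0%R.
    by have := step 1%R ltr01; rewrite a00 mulr0 !mul0e.
  by rewrite Ay gt0_muley ?leey// lte_fin lt_neqAle eq_sym an0.
have Af : lebk A \is a fin_num by rewrite ge0_fin_numE// ltey.
apply/lee_addgt0Pr => e e0.
pose m := (alpha * fine (lebk A) + 1)%R.
have m0 : (0 < m)%R by rewrite ltr_wpDl// mulr_ge0// fine_ge0.
apply: (le_trans (step (e / m)%R (divr_gt0 e0 m0))).
rewrite -(fineK Af) -!EFinM -EFinD lee_fin -mulrA mulrDl mul1r lerD2l.
by rewrite mulrAC ler_pdivrMr// ler_wpM2l ?(ltW e0)// /m lerDl.
Qed.

Lemma transfer_L1_le w : measurable_fun [set: lebT] w -> (forall x, 0 <= w x) ->
  \int[lebk]_x transfer (fun n => extend_id Om (f n)) weight w x <=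
  alpha%:E * \int[lebk]_x w x.
Proof.
apply: transfer_L1 => //.
- by move=> n; exact: measurable_extend_id.
- by move=> n; exact: measurable_weight.
- by move=> n x; case/andP: (weight_bounds n x).
- exact: transfer_indic_le.
Qed.

End L1_contraction.

(** * The elementary solution *)

Section lorentz_series.
Context d (T : measurableType d) {R : realType}.
Variable mu : {sigma_finite_measure set T -> \bar R}.
Variable phi : R -> R.
Hypothesis qc : quasiconcave phi.
Local Open Scope ereal_scope.

Lemma lorentz_sum_cost (I : Type) (s : seq I) (h : T -> \bar R)
    (v : I -> T -> \bar R) (c : I -> \bar R) :
  measurable_fun setT h -> (forall x, 0 <= h x) ->
  (forall i, measurable_fun setT (v i)) -> (forall i x, 0 <= v i x) ->
  (forall i, lorentz_cost mu phi (v i) (c i)) ->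
  lorentz mu phi (fun x => h x + \sum_(i <- s) v i x) <=
  lorentz mu phi h + \sum_(i <- s) c i.
Proof.
move=> mh h0 mv v0 vc; elim: s h mh h0 => [|i s IH] h mh h0.
  rewrite big_nil adde0 (_ : (fun x => _) = h)//.
  by apply/funext => x; rewrite big_nil adde0.
have -> : (fun x => h x + \sum_(j <- i :: s) v j x) =
    (fun x => (h \+ v i) x + \sum_(j <- s) v j x).
  by apply/funext => x; rewrite big_cons addeA.
have mhv : measurable_fun setT (h \+ v i) by exact: emeasurable_funD.
have hv0 x : 0 <= (h \+ v i) x by rewrite adde_ge0.
apply: (le_trans (IH _ mhv hv0)); rewrite big_cons [leRHS]addeA leeD2r//.
exact: lorentz_add_cost.
Qed.

End lorentz_series.

Lemma geometric_sum_le {R : realType} (a : R) (j n : nat) : 0 <= a -> a < 1 ->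
  \sum_(j <= i < n) a ^+ i <= a ^+ j / (1 - a).
Proof.
move=> a0 a1; have b0 : 0 < 1 - a by rewrite subr_gt0.
have [nj|/subnKC jn] := leqP n j.
  by rewrite big_geq// divr_ge0 ?exprn_ge0// ltW.
have E m : (\sum_(j <= i < j + m) a ^+ i) * (1 - a) = a ^+ j - a ^+ (j + m).
  elim: m => [|m IH]; first by rewrite addn0 big_geq// mul0r subrr.
  by rewrite addnS big_nat_recr ?leq_addr//= mulrDl IH exprS; ring.
rewrite ler_pdivlMr//; have := E (n - j)%N.
have -> : (j + (n - j) = n)%N by move: jn; lia.
by move=> ->; rewrite gerBl exprn_ge0.
Qed.

(** What the argument uses of the scalars, with an [R]-valued multiplicative norm. Completeness is
    stated for absolutely convergent series, the form applied at each point. *)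
Record scalar_algebra {R : realType} (Kf : normedZmodType R)
    (mul : Kf -> Kf -> Kf) : Prop := ScalarAlgebra {
  sa_separable : separable Kf;
  sa_mulDl : forall x y z, mul (x + y) z = mul x z + mul y z;
  sa_mulDr : forall x y z, mul x (y + z) = mul x y + mul x z;
  sa_norm : forall x y, `|mul x y| = `|x| * `|y|;
  sa_complete : forall u : nat -> Kf,
    (\sum_(0 <= i <oo) (`|u i|)%:E < +oo)%E ->
    exists l, forall e : R, 0 < e -> exists n, forall m, (n <= m)%N ->
      `|l - \sum_(0 <= i < m) u i| < e }.

(** * Measurability of scalar functions *)

Section kmeasurable_algebra.
Context {R : realType} (k : nat) {Kf : normedZmodType R}.
Local Notation V := 'rV[R]_k.+1.
Local Notation lebT := (@lebT R k).
Local Notation lebk := (@lebk R k).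
Variables (mul : Kf -> Kf -> Kf) (Om : set V).
Hypothesis sa : scalar_algebra mul.
Hypothesis oOm : open Om.
Implicit Types u v : V -> Kf.

Lemma sa_mul0r x : mul x 0 = 0.
Proof. by apply: (addrI (mul x 0)); rewrite -(sa_mulDr sa) !addr0. Qed.

Lemma sa_mulBl x y z : mul (x - y) z = mul x z - mul y z.
Proof. by apply: (addIr (mul y z)); rewrite -(sa_mulDl sa) !subrK. Qed.

Lemma sa_mulBr x y z : mul x (y - z) = mul x y - mul x z.
Proof. by apply: (addIr (mul x z)); rewrite -(sa_mulDr sa) !subrK. Qed.

Lemma kmeasurable_op (op : Kf -> Kf -> Kf) u v :
  (forall x y (e : R), 0 < e -> exists2 dl : R, 0 < dl & forall x' y',
     `|x' - x| < dl -> `|y' - y| < dl -> `|op x' y' - op x y| < e) ->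
  kmeasurable Om u -> kmeasurable Om v -> kmeasurable Om (fun x => op (u x) (v x)).
Proof.
move=> cop mu_ mv U oU.
have sK := sa_separable sa.
apply: (kmeasurable_pair (W := fun x y => U (op x y)) sK sK mu_ mv).
move=> x y Uxy; have [e e0 eU] := oU _ Uxy; have [dl dl0 H] := cop x y e e0.
by exists dl => // x' y' xx yy; apply: eU; exact: H.
Qed.

Lemma kmeasurable_add u v : kmeasurable Om u -> kmeasurable Om v ->
  kmeasurable Om (fun x => u x + v x).
Proof.
apply: kmeasurable_op => x y e e0; exists (e / 2); first by rewrite divr_gt0.
move=> x' y' xx yy; rewrite opprD addrACA.
by have := ler_normD (x' - x) (y' - y); lra.
Qed.

Lemma kmeasurable_sub u v : kmeasurable Om u -> kmeasurable Om v ->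
  kmeasurable Om (fun x => u x - v x).
Proof.
apply: (@kmeasurable_op (fun x y => x - y)) => x y e e0; exists (e / 2); first by rewrite divr_gt0.
move=> x' y' xx yy.
have -> : x' - y' - (x - y) = (x' - x) - (y' - y) by rewrite !opprD !opprK addrACA.
by have := ler_normB (x' - x) (y' - y); lra.
Qed.

Lemma kmeasurable_mul u v : kmeasurable Om u -> kmeasurable Om v ->
  kmeasurable Om (fun x => mul (u x) (v x)).
Proof.
apply: kmeasurable_op => x y e e0.
have C0 : 0 < `|x| + `|y| + 2 by rewrite ltr_wpDl// addr_ge0.
exists (Num.min 1 (e / (`|x| + `|y| + 2))); first by rewrite lt_min ltr01 divr_gt0.
move=> x' y'; rewrite !lt_min => /andP[_ xx] /andP[y1 yy].
have -> : mul x' y' - mul x y = mul (x' - x) y' + mul x (y' - y).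
  by rewrite sa_mulBl sa_mulBr addrA subrK.
apply: (le_lt_trans (ler_normD _ _)); rewrite !(sa_norm sa).
have y'1 : `|y'| <= `|y| + 1.
  by have := ler_normD (y' - y) y; rewrite subrK; lra.
set dl := e / _ in xx yy *.
have dl0 : 0 < dl by rewrite divr_gt0.
have h1 : `|x' - x| * `|y'| <= dl * (`|y| + 1) by apply: ler_pM => //; exact: ltW.
have h2 : `|x| * `|y' - y| <= `|x| * dl by rewrite ler_wpM2l// ltW.
have : dl * (`|x| + `|y| + 2) = e by rewrite /dl mulfVK// gt_eqF.
lra.
Qed.

Lemma kmeasurable0 : kmeasurable Om (fun=> 0 : Kf).
Proof.
move=> U _; have [U0|U0] := pselect (U 0).
  rewrite (_ : Om `&` _ = Om); first exact: (measurable_open oOm).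
  by apply/seteqP; split => x; [move=> []|split].
rewrite (_ : Om `&` _ = set0); first exact: (@measurable0 _ lebT).
by apply/seteqP; split => x // [].
Qed.

Lemma kmeasurable_sum (I : Type) (s : seq I) (u : I -> V -> Kf) :
  (forall i, kmeasurable Om (u i)) -> kmeasurable Om (fun x => \sum_(i <- s) u i x).
Proof.
move=> mu_; elim: s => [|i s IH].
  rewrite (_ : (fun x => _) = fun=> 0); first exact: kmeasurable0.
  by apply/funext => x; rewrite big_nil.
rewrite (_ : (fun x => _) = fun x => u i x + \sum_(j <- s) u j x).
  exact: kmeasurable_add.
by apply/funext => x; rewrite big_cons.
Qed.

Lemma kmeasurable_comp (f : V -> V) u : vmeasurable Om f -> null_preimages Om f ->
  (forall x, Om x -> Om (f x)) -> kmeasurable Om u -> kmeasurable Om (fun x => u (f x)).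
Proof.
move=> mf nf fOm mu_ U oU.
have := measurable_preimage oOm mf nf (mu_ U oU).
congr (measurable (_ : set lebT)); apply/seteqP; split => x [Ox].
  by move=> [_ Ux]; split.
by move=> Ux; split => //; split => //; exact: fOm.
Qed.

(** Up to a null set, [u x] lies in [U] exactly when, for some [j], the [S m x] are eventually in
    [Uj j]. *)
Lemma kmeasurable_lim (S : nat -> V -> Kf) u : (forall m, kmeasurable Om (S m)) ->
  {ae lebk, forall x : lebT, Om x -> forall e : R, 0 < e ->
     exists n, forall m, (n <= m)%N -> `|u x - S m x| < e} ->
  kmeasurable Om u.
Proof.
move=> mS Su U oU.
set cv := (fun x : lebT => _) in Su.
have nN : lebk.-negligible (~` [set x | cv x]) by exact: Su.
pose r (j : nat) : R := j.+1%:R^-1.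
(* A radius strictly above [r j] makes [Uj j] open and tolerates an error [r j] when passing to the
   limit. *)
pose Uj j : set Kf := [set z | exists2 t : R, r j < t & forall w, `|w - z| < t -> U w].
have oUj j : kopen (Uj j).
  move=> z [t rt tU]; exists ((t - r j) / 2); first by rewrite divr_gt0// subr_gt0.
  move=> w wz; exists (t - (t - r j) / 2); first by lra.
  by move=> y yw; apply: tU; have := ler_distD w y z; lra.
pose A : set lebT := \bigcup_j \bigcup_n \bigcap_(m in [set m | (n <= m)%N])
  (Om `&` S m @^-1` (Uj j)).
have mA : measurable A.
  apply: bigcupT_measurable => j; apply: bigcupT_measurable => n.
  by apply: bigcap_measurable => [|m _]; [exists n => /=|exact: mS].
have mN (B : set lebT) : B `<=` ~` [set x | cv x] -> measurable B.
  move=> BN; apply: leb_null_measurable; apply/negligible_lebP.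
  exact: negligibleS nN.
have -> : Om `&` u @^-1` U = (A `\` ~` [set x | cv x]) `|`
    (Om `&` u @^-1` U `&` ~` [set x | cv x]).
  apply/seteqP; split => x.
    move=> [Ox Ux]; have [cx|cx] := pselect (cv x); last by right.
    left; split; last by move=> /(_ cx).
    have [e e0 eU] := oU _ Ux.
    have j0 : 0 <= 2 / e by rewrite divr_ge0// ltW.
    have := archi_boundP j0; set j := Num.bound _ => ej.
    have rj : r j < e / 2.
      move: ej; rewrite ltr_pdivrMr// => ej.
      rewrite /r ltr_pdivlMr// mulrC ltr_pdivrMr// mulrC (lt_trans ej)//.
      by rewrite ltr_pM2r// ltr_nat.
    have e4 : 0 < e / 4 by rewrite divr_gt0.
    have [n nP] := cx Ox _ e4.
    exists j => //; exists n => // m /= nm; split => //.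
    exists (3 * e / 4); first by lra.
    move=> w wS; apply: eU; have := ler_distD (S m x) w (u x).
    by have := nP m nm; rewrite (distrC (u x)); lra.
  move=> [[[j _ [n _ H]] ncx]|[[Ox Ux] _]]; last by split.
  have cx : cv x by apply: contrapT.
  have [Ox _] := H n (leqnn n); split => //.
  have rj0 : 0 < r j by rewrite invr_gt0.
  have [n' nP] := cx Ox _ rj0.
  have [_ [t rt tU]] := H (maxn n n') (leq_maxl _ _).
  by apply: tU; apply: lt_trans rt; apply: nP; exact: leq_maxr.
apply: (@measurableU _ lebT); last by apply: mN => x [].
by apply: measurableD => //; exact: mN.
Qed.

End kmeasurable_algebra.

(** * Convergence, uniqueness and tail estimates *)

Section elementary_solution.
Context {R : realType} (k N : nat) {Kf : normedZmodType R}.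
Local Notation V := 'rV[R]_k.+1.
Local Notation lebT := (@lebT R k).
Local Notation lebk := (@lebk R k).
Variables (mul : Kf -> Kf -> Kf) (Om : set V).
Variables (f : 'I_N -> V -> V) (g : 'I_N -> V -> Kf) (h0 : V -> Kf).
Variables (K L : nat) (psi : R -> R) (alpha : R).
Hypothesis sa : scalar_algebra mul.
Hypothesis N0 : (0 < N)%N.
Hypothesis K0 : (0 < K)%N.
Hypothesis oOm : open Om.
Hypothesis fOm : forall n x, Om x -> Om (f n x).
Hypothesis hH : hypH Om f g h0 K L.
Hypothesis adm : admissible_psi psi.
Hypothesis h0L : in_Lpsi1 psi Om h0.
Hypothesis alpha0 : 0 <= alpha.
Hypothesis alpha2 : alpha < 2^-1.
Hypothesis gJ : forall n, ae_on Om (fun x =>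
   `|g n x| <= alpha * Num.min (`|Defs.jacobian Om (f n) x| / (K * L)%:R) (N%:R^-1)).

Let mf n : vmeasurable Om (f n). Proof. by case: hH. Qed.
Let nf n : null_preimages Om (f n). Proof. by case: hH => _ [_ [_ [h _]]]. Qed.
Let manyK n : leb_null (many_preimages Om (f n) K).
Proof. by case: hH => _ [_ [_ [_ [h _]]]]. Qed.
Let mg n : kmeasurable Om (g n).
Proof. by case: hH => _ [_ [_ [_ [_ [h _]]]]]. Qed.
Let HL : is_L Om f L. Proof. by case: hH => _ [_ [_ [_ [_ [_ [_ h]]]]]]. Qed.
Let mh0 : kmeasurable Om h0. Proof. by case: h0L => -[]. Qed.

Let qc := quasiconcave_tau_inv adm.
Let lor := lorentz lebk (tau_inv_fin psi).
Let cost := lorentz_cost lebk (tau_inv_fin psi).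
Let F n : lebT -> lebT := extend_id Om (f n).
Let P := opP mul f g.
Let w (u : V -> Kf) : lebT -> \bar R := EFin \o norm_on Om u.

Let w0 u x : (0 <= w u x)%E. Proof. by rewrite lee_fin norm_on_ge0. Qed.
Let mw u : kmeasurable Om u -> measurable_fun setT (w u).
Proof. by move=> mu_; apply/measurable_EFinP; exact: measurable_norm_on. Qed.
Let lorE u : lorentz_norm psi Om u = lor (w u). Proof. exact: lorentz_normE. Qed.
Let lor_ge0 v : (0 <= lor v)%E. Proof. exact: lorentz_ge0. Qed.
Let alpha1 : alpha < 1. Proof. by move: alpha2; lra. Qed.

Lemma kmeasurable_opP u : kmeasurable Om u -> kmeasurable Om (P u).
Proof.
move=> mu_; apply: (kmeasurable_sum sa oOm) => n; apply: (kmeasurable_mul sa) => //.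
by apply: kmeasurable_comp => //; exact: fOm.
Qed.

Lemma kmeasurable_iter i u : kmeasurable Om u -> kmeasurable Om (iter i P u).
Proof. by move=> mu_; elim: i => //= i; exact: kmeasurable_opP. Qed.

Lemma norm_opP_le u :
  {ae lebk, forall x : lebT, (w (P u) x <= transfer F (weight Om g alpha) (w u) x)%E}.
Proof.
have H : {ae lebk, forall x : lebT, forall n, Om x -> weight Om g alpha n x = `|g n x|}.
  by apply: filter_forall => n; exact: (weight_ae alpha0 gJ).
apply: filterS H => x xH.
have b0 n y : 0 <= weight Om g alpha n y by case/andP: (weight_bounds Om g alpha0 n y).
have [Ox|Ox] := pselect (Om x); last first.
  rewrite /w /= norm_on0// /transfer; apply: sume_ge0 => n _.
  by rewrite mule_ge0 ?lee_fin ?norm_on_ge0.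
rewrite /w /= norm_onE// /transfer /=.
rewrite (eq_bigr (fun n => (`|mul (g n x) (u (f n x))|)%:E)).
  by rewrite sumEFin lee_fin; exact: ler_norm_sum.
move=> n _; rewrite (sa_norm sa) -EFinM xH//; congr (_ * _)%:E.
by rewrite /F /extend_id asboolT// norm_onE//; exact: fOm.
Qed.

Lemma cost_opP u c : cost (w u) c -> cost (w (P u)) (alpha%:E * c)%E.
Proof.
move=> uc; apply: lorentz_cost_ae_le (norm_opP_le u) _.
apply: (lorentz_cost_transfer qc) => //.
- by move=> n; exact: measurable_extend_id.
- by move=> n A; exact: negligible_extend_id.
- by move=> n; exact: measurable_weight.
- by move=> n x; exact: weight_bounds.
- by move=> v mv v0; apply: (transfer_L1_le (K := K) (L := L)).
Qed.

Lemma cost_iter i u c : (0 <= c)%E -> cost (w u) c ->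
  cost (w (iter i P u)) ((alpha ^+ i)%:E * c)%E.
Proof.
move=> c0 uc; elim: i => [|i IH]; first by rewrite expr0 mul1e.
by rewrite exprS EFinM -muleA; exact: cost_opP.
Qed.

(** Each [f n] pulls the exceptional null set back to a null set, so [P] acts on classes of
    functions. *)
Lemma ae_opP u v : ae_on Om (fun x => u x = v x) -> ae_on Om (fun x => P u x = P v x).
Proof.
move=> /ae_onP uv; apply/ae_onP.
have H : {ae lebk, forall x : lebT, forall n, Om (F n x) -> u (F n x) = v (F n x)}.
  apply: filter_forall => n; apply: (ae_comp (F := F)) uv => m A.
  exact: negligible_extend_id.
apply: filterS H => x xH Ox; apply: eq_bigr => n _; congr (mul _ _).
by have := xH n; rewrite /F /extend_id asboolT//; apply; exact: fOm.
Qed.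

Lemma opP_add u v x : P (fun y => u y + v y) x = P u x + P v x.
Proof.
by rewrite /P /opP -big_split/=; apply: eq_bigr => n _; rewrite (sa_mulDr sa).
Qed.

Lemma opP_sum (I : Type) (s : seq I) (u : I -> V -> Kf) x :
  P (fun y => \sum_(i <- s) u i y) x = \sum_(i <- s) P (u i) x.
Proof.
elim: s => [|i s IH].
  by rewrite big_nil /P /opP big1// => n _; rewrite big_nil (sa_mul0r sa).
rewrite big_cons -IH -opP_add; congr (P _ x); apply/funext => y.
by rewrite big_cons.
Qed.

Lemma opP_partial_sum m x :
  P (partial_sum mul f g h0 0 m) x + h0 x = partial_sum mul f g h0 0 m.+1 x.
Proof.
rewrite /partial_sum opP_sum !add0n big_nat_recl// addrC; congr (_ + _).
Qed.

Let u i := iter i P h0.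
Let mu_ i : kmeasurable Om (u i). Proof. exact: kmeasurable_iter. Qed.
Let H := fine (lor (w h0)).
Let HE : lor (w h0) = H%:E.
Proof.
rewrite /H fineK// ge0_fin_numE//; case: h0L => _; by rewrite lorE.
Qed.
Let H0 : 0 <= H. Proof. by rewrite -lee_fin -HE. Qed.

Let cost_u i lam : 1 < lam -> cost (w (u i)) (2 * lam * alpha ^+ i * H)%:E.
Proof.
move=> lam1.
have -> : (2 * lam * alpha ^+ i * H)%:E = ((alpha ^+ i)%:E * ((2 * lam)%:E * lor (w h0)))%E.
  by rewrite HE -!EFinM; congr EFin; ring.
apply: cost_iter.
  by rewrite mule_ge0// lee_fin mulr_ge0// ltW// (lt_trans ltr01).
apply: lorentz_cost_layers => //; first exact: mw.
by rewrite -/lor HE ltry.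
Qed.

Let tailw j (x : lebT) : \bar R := (\sum_(j <= i <oo) w (u i) x)%E.

Let mpart (s : seq nat) : measurable_fun setT (fun x => \sum_(i <- s) w (u i) x)%E.
Proof. by apply: emeasurable_sum => i; exact: mw. Qed.

Let lor_part j n lam : 1 < lam ->
  (lor (fun x => \sum_(j <= i < n) w (u i) x) <=
   (2 * lam * (alpha ^+ j / (1 - alpha)) * H)%:E)%E.
Proof.
move=> lam1.
have := lorentz_sum_cost qc (index_iota j n) (measurable_cst (0%E : \bar R))
  (fun=> lexx _) (fun i => mw (mu_ i)) (fun i => w0 (u i)) (fun i => cost_u i lam1).
rewrite (_ : (fun x => _ + _)%E = (fun x => \sum_(j <= i < n) w (u i) x)%E); last first.
  by apply/funext => x; rewrite add0e.
move=> /le_trans; apply.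
rewrite (lorentz0 _ qc) add0e sumEFin lee_fin -mulr_suml ler_wpM2r// -mulr_sumr ler_wpM2l//.
  by rewrite mulr_ge0// ltW// (lt_trans ltr01).
exact: geometric_sum_le.
Qed.

Let mtail j : measurable_fun setT (tailw j).
Proof.
rewrite /tailw (_ : (fun x => _) = fun x => (\sum_(0 <= i <oo) w (u (i + j)) x)%E).
  by apply: ge0_emeasurable_sum => [i x _ _|i _]; [exact: w0|exact: mw].
apply/funext => x; rewrite (nneseries_addn (f := fun i => w (u i) x))// => i; exact: w0.
Qed.

Let lor_tail j lam : 1 < lam ->
  (lor (tailw j) <= (2 * lam * (alpha ^+ j / (1 - alpha)) * H)%:E)%E.
Proof.
move=> lam1.
apply: (lorentz_limit qc (w := fun n x => (\sum_(j <= i < n) w (u i) x)%E)).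
- by move=> n; exact: mpart.
- exact: mtail.
- by move=> x m n mn; apply: lee_sum_nneg_natr => // i _ _; exact: w0.
- by move=> x; apply: is_cvg_nneseries => i _ _; exact: w0.
- by move=> n; exact: lor_part.
Qed.

Definition sums_to j x (l : Kf) : Prop := forall e : R, 0 < e ->
  exists n, forall m, (n <= m)%N -> `|l - partial_sum mul f g h0 j m x| < e.

(** Pointwise sum, with the default 0 where the series diverges; within [Om] this is a null set. *)
Definition tail_sum j (x : V) : Kf := xget 0 [set l | sums_to j x l].

Let tail_fin_ae j : {ae lebk, forall x : lebT, (tailw j x < +oo)%E}.
Proof.
apply: (lorentz_fin_ae qc); first exact: mtail.
have two1 : 1 < 2 :> R by rewrite ltr1n.
by apply: (le_lt_trans (lor_tail j two1)); rewrite ltry.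
Qed.

(** [tailw j] has a finite Lorentz functional, hence is finite almost everywhere; there the series
    converges absolutely. *)
Lemma sums_to_ae j : {ae lebk, forall x : lebT, Om x -> sums_to j x (tail_sum j x)}.
Proof.
have Hj := tail_fin_ae j; apply: filterS Hj => x tx Ox.
apply: (@xgetPex _ 0 [set l | sums_to j x l]).
have [|l lP] := @sa_complete _ _ _ sa (fun i => u (i + j)%N x).
  apply: le_lt_trans tx; rewrite /tailw -(nneseries_addn (f := fun i => w (u i) x)).
    apply: lee_nneseries => [i _ _|i _]; first by rewrite lee_fin.
    by rewrite /w /= norm_onE.
  by move=> i; exact: w0.
exists l => e e0; have [n nP] := lP e e0; exists n => m nm.
rewrite /partial_sum addnC -{1}[j]add0n big_addn addnK; exact: nP.
Qed.

Lemma sums_to_tail j m x l : Om x -> sums_to j x l ->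
  ((`|l - partial_sum mul f g h0 j m x|)%:E <= tailw (j + m) x)%E.
Proof.
move=> Ox jl; apply/lee_addgt0Pr => e e0; have [n nP] := jl e e0.
pose M := maxn n m.
have := nP M (leq_maxl _ _).
have S : partial_sum mul f g h0 j M x - partial_sum mul f g h0 j m x =
    \sum_(j + m <= i < j + M) u i x.
  rewrite /partial_sum (@big_cat_nat _ _ _ (j + m)%N) ?leq_addr ?leq_add2l ?leq_maxr//=.
  by rewrite addrAC subrr add0r.
move=> lM; have h1 : `|l - partial_sum mul f g h0 j m x| <=
    e + \sum_(j + m <= i < j + M) `|u i x|.
  apply: (le_trans (ler_distD (partial_sum mul f g h0 j M x) _ _)).
  rewrite lerD ?(ltW lM)// S; exact: ler_norm_sum.
apply: (@le_trans _ _ (e + \sum_(j + m <= i < j + M) `|u i x|)%:E).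
  by rewrite lee_fin.
rewrite EFinD addeC leeD2r// -sumEFin.
rewrite (eq_bigr (fun i => w (u i) x)); last by move=> i _; rewrite /w /= norm_onE.
by apply: nneseries_lim_ge => i _ _; exact: w0.
Qed.

Lemma kmeasurable_partial_sum j m : kmeasurable Om (partial_sum mul f g h0 j m).
Proof. by apply: (kmeasurable_sum sa oOm) => i; exact: mu_. Qed.

Lemma kmeasurable_tail_sum j : kmeasurable Om (tail_sum j).
Proof.
apply: (kmeasurable_lim (S := partial_sum mul f g h0 j)).
  by move=> m; exact: kmeasurable_partial_sum.
exact: sums_to_ae.
Qed.

(** The ratio 2 in place of one near 1 is wasteful but enough for convergence; [tail_bound] has the
    sharper constant. *)
Lemma lor_tail_sum_sub j m :
  (lorentz_norm psi Om (fun x => (tail_sum j x - partial_sum mul f g h0 j m x)%R)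
   <= (2 * 2 * (alpha ^+ (j + m) / (1 - alpha)) * H)%:E)%E.
Proof.
rewrite lorE.
have two1 : 1 < 2 :> R by rewrite ltr1n.
apply: le_trans (lor_tail (j + m) two1).
apply: (lorentz_ae_le qc).
- apply: mw; apply: (kmeasurable_sub sa); first exact: kmeasurable_tail_sum.
  exact: kmeasurable_partial_sum.
- exact: mtail.
- have Hj := sums_to_ae j; apply: filterS Hj => x xj.
  have [Ox|Ox] := pselect (Om x).
    by rewrite /w /= norm_onE//; apply: sums_to_tail => //; exact: xj.
  by rewrite /w /= norm_on0//; apply: nneseries_ge0 => i _ _; exact: w0.
Qed.

Lemma tail_sum_Lpsi1 j : in_Lpsi1 psi Om (tail_sum j).
Proof.
have fin : (lorentz_norm psi Om (tail_sum j) < +oo)%E.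
  apply: le_lt_trans (ltry (2 * 2 * (alpha ^+ (j + 0) / (1 - alpha)) * H)).
  have := lor_tail_sum_sub j 0; congr (lorentz_norm _ _ _ <= _)%E.
  by apply/funext => x; rewrite /partial_sum addn0 big_geq// subr0.
by split => //; apply: (L1loc_of_lorentz adm) => //; exact: kmeasurable_tail_sum.
Qed.

Lemma tail_sum_converges j : tail_converges psi mul Om f g h0 j (tail_sum j).
Proof.
rewrite /tail_converges.
apply: (squeeze_cvge (f := fun=> 0%E)
  (h := fun m => (2 * 2 * (alpha ^+ (j + m) / (1 - alpha)) * H)%:E)).
- by apply: nearW => m; rewrite lor_tail_sum_sub lorE lor_ge0.
- exact: cvg_cst.
- apply: cvg_EFin; first exact: nearW.
  have -> : (fine \o fun m => (2 * 2 * (alpha ^+ (j + m) / (1 - alpha)) * H)%:E) =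
      (fun m => 2 * 2 * (alpha ^+ j / (1 - alpha)) * H * alpha ^+ m).
    by apply/funext => m /=; rewrite exprD; ring.
  rewrite -[X in _ --> X](mulr0 (2 * 2 * (alpha ^+ j / (1 - alpha)) * H)).
  apply: cvgMr; apply: cvg_expr; by rewrite ger0_norm.
Qed.

(** At almost every [x] the series converges at [x] and at all [f n x]; the identity
    [P S_m + h0 = S_(m+1)] then passes to the limit pointwise. *)
Lemma tail_sum_solves : solves mul Om f g h0 (tail_sum 0).
Proof.
apply/ae_onP.
have s0 := sums_to_ae 0.
have sF : {ae lebk, forall x : lebT, forall n, Om (F n x) ->
    sums_to 0 (F n x) (tail_sum 0 (F n x))}.
  apply: filter_forall => n; apply: (ae_comp (F := F)) s0 => m A.
  exact: negligible_extend_id.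
apply: filterS2 s0 sF => x x0 xF Ox.
have {}x0 := x0 Ox.
apply/eqP; rewrite -subr_eq0 -normr_le0; apply/ler_addgt0Pr => e e0; rewrite add0r.
pose G := \sum_(n < N) `|g n x| + 1.
have G0 : 0 < G by rewrite ltr_wpDl// sumr_ge0.
have e2 : 0 < e / (2 * G) by rewrite divr_gt0// mulr_gt0.
have e1 : 0 < e / 2 by rewrite divr_gt0.
have Hn n : exists m0, forall m, (m0 <= m)%N ->
    `|tail_sum 0 (f n x) - partial_sum mul f g h0 0 m (f n x)| < e / (2 * G).
  have := xF n; rewrite /F /extend_id asboolT// => /(_ (fOm n Ox)) /(_ _ e2).
  by [].
have [M MP] := choice Hn.
have [m1 m1P] := x0 _ e1.
pose m := maxn m1 (\max_n M n).
have p1 : `|tail_sum 0 x - partial_sum mul f g h0 0 m.+1 x| < e / 2.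
  by apply: m1P; rewrite leqW// leq_maxl.
have p2 : `|P (tail_sum 0) x - P (partial_sum mul f g h0 0 m) x| <= e / 2.
  rewrite /P /opP -sumrB; apply: (le_trans (ler_norm_sum _ _ _)).
  apply: (@le_trans _ _ (\sum_(n < N) `|g n x| * (e / (2 * G)))).
    apply: ler_sum => n _; rewrite -(sa_mulBr sa) (sa_norm sa) ler_wpM2l// ltW//.
    apply: MP; apply: leq_trans (leq_maxr _ _); exact: leq_bigmax.
  rewrite -mulr_suml mulrA ler_pdivrMr ?mulr_gt0//.
  have -> : e / 2 * (2 * G) = G * e by field.
  by rewrite ler_wpM2r ?(ltW e0)// /G lerDl.
have -> : tail_sum 0 x - (opP mul f g (tail_sum 0) x + h0 x) =
   (tail_sum 0 x - partial_sum mul f g h0 0 m.+1 x) -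
   (P (tail_sum 0) x - P (partial_sum mul f g h0 0 m) x).
  rewrite -opP_partial_sum !opprD opprK !addrA.
  by rewrite [LHS]addrAC [RHS]addrAC; congr (_ - _); rewrite [RHS]addrAC subrK.
apply: (le_trans (ler_normB _ _)); move: p1 p2; lra.
Qed.

Lemma norm_on_add_le (a b c : V -> Kf) (x : lebT) :
  (Om x -> `|a x| <= `|b x| + `|c x|) -> (w a x <= w b x + w c x)%E.
Proof.
move=> h; rewrite /w /= -EFinD lee_fin.
have [Ox|Ox] := pselect (Om x); first by rewrite !norm_onE//; exact: h.
by rewrite !norm_on0// addr0.
Qed.

Lemma solution_iter v m : solves mul Om f g h0 v ->
  ae_on Om (fun x => v x = iter m P v x + partial_sum mul f g h0 0 m x).
Proof.
move=> sv; elim: m => [|m IH].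
  apply/ae_onP; apply: aeW => x _ /=.
  by rewrite /partial_sum big_geq// addr0.
have IH' := ae_opP IH.
apply/ae_onP; move/ae_onP: sv => sv; move/ae_onP: IH' => IH'.
apply: filterS2 sv IH' => x vx Px Ox; rewrite (vx Ox) -/P (Px Ox) opP_add -addrA.
by rewrite opP_partial_sum.
Qed.

(** By [solution_iter], [v1 - v2 = (v1 - S_m) - P^m v2]. The first term tends to 0 in the Lorentz
    functional, and the cost of the second is [alpha ^ m] times a constant. *)
Lemma solution_unique v1 v2 : in_Lpsi1 psi Om v1 -> in_Lpsi1 psi Om v2 ->
  tail_converges psi mul Om f g h0 0 v1 -> solves mul Om f g h0 v2 ->
  ae_on Om (fun x => v1 x = v2 x).
Proof.
move=> [[mv1 _] _] [[mv2 _] fv2] cv1 sv2.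
pose d x := v1 x - v2 x.
have md : kmeasurable Om d by exact: (kmeasurable_sub sa).
have two1 : 1 < 2 :> R by rewrite ltr1n.
rewrite lorE in fv2.
have f2 : lor (w v2) \is a fin_num by rewrite ge0_fin_numE.
pose c := 2 * 2 * fine (lor (w v2)).
have c0 : 0 <= c by rewrite !mulr_ge0// fine_ge0.
have cE : ((2 * 2)%:E * lor (w v2) = c%:E)%E by rewrite -(fineK f2) -EFinM.
have dm m : (lor (w d) <= lorentz_norm psi Om (fun x => (v1 x - partial_sum mul f g h0 0 m x)%R)
    + (c * alpha ^+ m)%:E)%E.
  pose b x := v1 x - partial_sum mul f g h0 0 m x.
  have mb : kmeasurable Om b.
    by apply: (kmeasurable_sub sa) => //; exact: kmeasurable_partial_sum.
  rewrite lorE -/b.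
  have cm : cost (w (iter m P v2)) (c * alpha ^+ m)%:E.
    rewrite mulrC EFinM -cE; apply: cost_iter; first by rewrite cE lee_fin.
    by apply: lorentz_cost_layers => //; exact: mw.
  have mi := kmeasurable_iter m mv2.
  apply: le_trans (lorentz_add_cost qc (mw mb) (mw mi) (w0 b) (w0 _) cm).
  apply: (lorentz_ae_le qc); first exact: mw.
    by apply: emeasurable_funD; exact: mw.
  have /ae_onP sm := solution_iter m sv2.
  apply: filterS sm => x vx; apply: norm_on_add_le => Ox.
  by rewrite /d (vx Ox) opprD addrA addrAC; exact: ler_normB.
have d0 : lor (w d) = 0%E.
  apply/eqP; rewrite eq_le lor_ge0 andbT.
  have cv : (lorentz_norm psi Om (fun x => (v1 x - partial_sum mul f g h0 0 m x)%R)
      + (c * alpha ^+ m)%:E)%E @[m --> \oo] --> (0 + 0)%E.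
    apply: cvgeD => //.
    apply: cvg_EFin; first exact: nearW.
    rewrite -[X in _ --> X](mulr0 c).
    apply: cvgMr; apply: cvg_expr; by rewrite ger0_norm.
  rewrite -[leRHS](adde0 0%E); apply: (cvge_ge _ cv); exact: nearW.
have /(lorentz_eq0_ae qc (mw md)) H1 := d0.
apply/ae_onP; apply: filterS H1 => x; rewrite /w /= lee_fin => dx Ox.
move: dx; rewrite norm_onE// normr_le0 subr_eq0 => /eqP; exact.
Qed.

(** Partial sums are estimated first; [T - S m] is then added at its own cost, [2 * lam] times a
    quantity tending to 0. The excess of [lam] over 1 is chosen to contribute at most [e / 2]. *)
Lemma tail_bound j T : in_Lpsi1 psi Om T -> tail_converges psi mul Om f g h0 j T ->
  (lorentz_norm psi Om T <=
    ((2 * alpha) ^+ j / (1 - 2 * alpha))%:E * lorentz_norm psi Om h0)%E.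
Proof.
move=> [[mT _] _] cT.
have b0 : 0 < 1 - alpha by rewrite subr_gt0.
have b20 : 0 < 1 - 2 * alpha by move: alpha2; lra.
rewrite !lorE HE -EFinM; apply/lee_addgt0Pr => e e0.
pose S m := partial_sum mul f g h0 j m.
pose Hb := 2 * H / (1 - alpha) + 1.
have Hb0 : 0 < Hb by rewrite ltr_wpDl// divr_ge0 ?mulr_ge0// ltW.
pose dl := e / (2 * Hb).
have dl0 : 0 < dl by rewrite divr_gt0// mulr_gt0.
pose lam := 1 + dl.
have lam1 : 1 < lam by rewrite ltrDl.
have S_le m : (lor (w (S m)) <=
    ((2 * alpha) ^+ j / (1 - 2 * alpha) * H + e / 2)%:E)%E.
  have mS : kmeasurable Om (S m) by exact: kmeasurable_partial_sum.
  have Hdl : 2 * dl / (1 - alpha) * H <= e / 2.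
    have -> : 2 * dl / (1 - alpha) * H = dl * (2 * H / (1 - alpha)) by ring.
    apply: (@le_trans _ _ (dl * Hb)); first by rewrite ler_pM2l// lerDl.
    rewrite /dl le_eqVlt; apply/orP; left; apply/eqP; field.
    by rewrite gt_eqF.
  have wS x : (w (S m) x <= \sum_(j <= i < j + m) w (u i) x)%E.
    rewrite /w /= sumEFin lee_fin /norm_on; case: ifP => _; last by rewrite sumr_ge0.
    exact: ler_norm_sum.
  apply: (le_trans (lorentz_ae_le qc (mw mS) (mpart (index_iota j (j + m))) (aeW _ wS))).
  (* For [j > 0] every term is paid at factor 2, and [2 * alpha ^ j <= (2 * alpha) ^ j] absorbs it.
     For [j = 0] this fails, so [h0] is kept whole at factor 1 and [(1 + alpha) / (1 - alpha) <= 1 /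
     (1 - 2 * alpha)] concludes. *)
  have [j0|j0] := posnP j; last first.
    apply: (le_trans (lor_part j (j + m) lam1)); rewrite lee_fin.
    have aj1 : alpha ^+ j <= 1 by rewrite exprn_ile1// ltW.
    have aj0 : 0 <= alpha ^+ j by rewrite exprn_ge0.
    have -> : 2 * lam * (alpha ^+ j / (1 - alpha)) * H =
      2 * alpha ^+ j / (1 - alpha) * H + alpha ^+ j * (2 * dl / (1 - alpha) * H).
      by rewrite /lam; ring.
    apply: lerD; last first.
      apply: le_trans Hdl; rewrite ler_piMl//.
      by rewrite mulr_ge0// divr_ge0 ?(ltW b0)// mulr_ge0// ltW.
    rewrite ler_wpM2r//; apply: ler_pM.
    + by rewrite mulr_ge0.
    + by rewrite invr_ge0 ltW.
    + rewrite exprMn ler_wpM2r//.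
      by case: (j) j0 => // i _; rewrite exprS ler_peMr// exprn_ege1// ler1n.
    + by rewrite lef_pV2 ?posrE//; move: alpha0; lra.
  case: m {S mS wS} => [|m].
    rewrite j0 addn0 (_ : (fun x => _) = cst 0%E); last first.
      by apply/funext => x; rewrite big_geq.
    rewrite (lorentz0 _ qc) lee_fin addr_ge0 ?(ltW (divr_gt0 e0 _))//.
    by rewrite mulr_ge0// divr_ge0 ?exprn_ge0 ?mulr_ge0 ?(ltW b20).
  rewrite j0 add0n.
  have -> : (fun x => \sum_(0 <= i < m.+1) w (u i) x)%E =
      (fun x => w h0 x + \sum_(1 <= i < m.+1) w (u i) x)%E.
    by apply/funext => x; rewrite big_ltn.
  apply: (le_trans (lorentz_sum_cost qc (index_iota 1 m.+1) (mw mh0) (w0 h0)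
    (fun i => mw (mu_ i)) (fun i => w0 (u i)) (fun i => cost_u i lam1))).
  rewrite -/lor HE sumEFin -EFinD lee_fin -mulr_suml -mulr_sumr.
  have := geometric_sum_le 1 m.+1 alpha0 alpha1; rewrite expr1.
  set sg := \sum_(_ <= _ < _) _ => sgb.
  have H1 : 2 * lam * sg * H <= 2 * lam * (alpha / (1 - alpha)) * H.
    by rewrite ler_wpM2r// ler_wpM2l// mulr_ge0// ltW// (lt_trans ltr01).
  have H2 : 2 * lam * (alpha / (1 - alpha)) * H =
      2 * alpha / (1 - alpha) * H + alpha * (2 * dl / (1 - alpha) * H).
    by rewrite /lam; ring.
  have H3 : alpha * (2 * dl / (1 - alpha) * H) <= e / 2.
    apply: le_trans Hdl; rewrite ler_piMl//; last exact: ltW.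
    by rewrite mulr_ge0// divr_ge0 ?(ltW b0)// mulr_ge0// ltW.
  have H4 : H + 2 * alpha / (1 - alpha) * H <= (2 * alpha) ^+ 0 / (1 - 2 * alpha) * H.
    rewrite -{1}[H]mul1r -mulrDl ler_wpM2r// expr0 mul1r.
    have -> : 1 + 2 * alpha / (1 - alpha) = (1 + alpha) / (1 - alpha).
      by field; rewrite gt_eqF.
    rewrite ler_pdivrMr// mulrC ler_pdivlMr//; move: alpha0; nra.
  lra.
have lam20 : 0 < 2 * lam by rewrite mulr_gt0// (lt_trans ltr01).
(* Multiplied by the cost factor [2 * lam], this is the remaining [e / 2]. *)
have e4 : 0 < e / (4 * lam) by rewrite divr_gt0// mulr_gt0// (lt_trans ltr01).
have [m cm] : exists m, (lor (w (fun x => (T x - S m x)%R)) < (e / (4 * lam))%:E)%E.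
  apply: contrapT => nex; have : ((e / (4 * lam))%:E <= 0)%E.
    apply: (cvge_ge _ cT); apply: nearW => m; rewrite leNgt lorE.
    by apply/negP => mP; apply: nex; exists m.
  by rewrite lee_fin leNgt e4.
pose D x := T x - S m x.
have mD : kmeasurable Om D.
  by apply: (kmeasurable_sub sa) => //; exact: kmeasurable_partial_sum.
have mS : kmeasurable Om (S m) by exact: kmeasurable_partial_sum.
apply: (@le_trans _ _ (lor (w (S m) \+ w D))).
  apply: (lorentz_ae_le qc); first exact: mw.
    by apply: emeasurable_funD; exact: mw.
  apply: aeW => x; apply: norm_on_add_le => Ox.
  by rewrite -{1}(subrK (S m x) (T x)) addrC; exact: ler_normD.
have cD : cost (w D) ((2 * lam)%:E * lor (w D))%E.
  by apply: lorentz_cost_layers => //; [exact: mw|exact: lt_trans cm (ltry _)].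
apply: (le_trans (lorentz_add_cost qc (mw mS) (mw mD) (w0 _) (w0 D) cD)).
apply: (@le_trans _ _ (((2 * alpha) ^+ j / (1 - 2 * alpha) * H + e / 2)%:E + (e / 2)%:E)%E).
  apply: leeD; first exact: S_le.
  have -> : e / 2 = 2 * lam * (e / (4 * lam)).
    by field; rewrite gt_eqF// (lt_trans ltr01).
  by rewrite (EFinM (2 * lam)) lee_wpmul2l ?lee_fin ?(ltW lam20)// (ltW cm).
by rewrite -!EFinD lee_fin -addrA -splitr.
Qed.

End elementary_solution.

Lemma scalar_algebra_claim {R : realType} (Kf : normedZmodType R)
    (mul : Kf -> Kf -> Kf) : scalar_algebra mul -> theorem3p6_claim mul.
Proof.
move=> sa [//|k] N Om f g h0 K L psi alpha _ N0 K0 oOm fOm hH adm h0L a0 a2 gJ.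
pose S := tail_sum mul f g h0.
have SL j : in_Lpsi1 psi Om (S j).
  exact: (tail_sum_Lpsi1 sa N0 K0 oOm fOm hH adm h0L a0 a2 gJ).
have Sc j : tail_converges psi mul Om f g h0 j (S j).
  exact: (tail_sum_converges sa N0 K0 oOm fOm hH adm h0L a0 a2 gJ).
split; [|split].
- exists (S 0%N); split => //.
  exact: (tail_sum_solves sa N0 K0 oOm fOm hH adm h0L a0 a2 gJ).
- exact: (solution_unique sa N0 K0 oOm fOm hH adm h0L a0 a2 gJ).
- move=> j; split; first by exists (S j).
  exact: (tail_bound sa N0 K0 oOm fOm hH adm h0L a0 a2 gJ).
Qed.

(** * The real and the complex scalars *)

Lemma real_series_converges {R : realType} (u : nat -> R) :
  (\sum_(0 <= i <oo) (`|u i|)%:E < +oo)%E ->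
  exists l : R, forall e : R, 0 < e -> exists n, forall m, (n <= m)%N ->
    `|l - \sum_(0 <= i < m) u i| < e.
Proof.
move=> uf; have cu : cvgn (series u).
  apply: normed_cvg; apply: nondecreasing_is_cvgn.
    by apply: nondecreasing_series => i _ _ /=; exact: normr_ge0.
  exists (fine (\sum_(0 <= i <oo) (`|u i|)%:E)%E) => _ [n _ <-].
  have s0 : (0 <= \sum_(0 <= i <oo) (`|u i|)%:E)%E by apply: nneseries_ge0 => i _ _; rewrite lee_fin.
  rewrite -lee_fin fineK ?ge0_fin_numE// /series /= -sumEFin.
  by apply: nneseries_lim_ge => i _ _; rewrite lee_fin.
exists (limn (series u)) => e e0.
have /cvgrPdist_lt/(_ e e0) [n _ nP] := cu.
by exists n => m nm; exact: nP.
Qed.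

Lemma scalar_algebra_real (R : realType) :
  @scalar_algebra R (R : normedZmodType R) (fun x y : R => x * y).
Proof.
split.
- have [d dP] := @separable_rV R 0; exists (fun n => d n 0 0) => x e e0.
  have [n /normv_ltP nP] := dP (\row__ x) e e0; exists n.
  by have := nP e0 0; rewrite !mxE.
- by move=> x y z; rewrite mulrDl.
- by move=> x y z; rewrite mulrDr.
- by move=> x y; rewrite normrM.
- exact: real_series_converges.
Qed.

Lemma Rcomplex_normE (R : realType) (z : Rcomplex R) :
  `|z| = Num.sqrt (complex.Re z ^+ 2 + complex.Im z ^+ 2).
Proof. by case: z. Qed.

Lemma Re_le_norm (R : realType) (z : Rcomplex R) : `|complex.Re z| <= `|z|.
Proof. by rewrite Rcomplex_normE -sqrtr_sqr ler_wsqrtr// lerDl sqr_ge0. Qed.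

Lemma Im_le_norm (R : realType) (z : Rcomplex R) : `|complex.Im z| <= `|z|.
Proof. by rewrite Rcomplex_normE -sqrtr_sqr ler_wsqrtr// lerDr sqr_ge0. Qed.

Lemma Rcomplex_norm_le (R : realType) (z : Rcomplex R) : `|z| <= `|complex.Re z| + `|complex.Im z|.
Proof.
rewrite Rcomplex_normE -[leRHS]ger0_norm ?addr_ge0// -sqrtr_sqr ler_wsqrtr//.
by rewrite sqrrD !real_normK ?num_real// lerD2r lerDl mulrn_wge0// mulr_ge0.
Qed.

(** [Rcomplex] carries the modulus with values in [R]. Density and completeness are those of the
    real and imaginary parts; the dense sequence is read off the rational points of the plane. *)
Lemma scalar_algebra_complex (R : realType) :
  @scalar_algebra R (Rcomplex R : normedZmodType R) (fun x y : Rcomplex R => x * y).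
Proof.
split.
- have [d dP] := @separable_rV R 1.
  exists (fun n => (d n 0 0 +i* d n 0 1)%C : Rcomplex R) => z e e0.
  have e2 : 0 < e / 2 by rewrite divr_gt0.
  have [n /normv_ltP nP] := dP (\row_i if i == 0 then complex.Re z else complex.Im z) _ e2; exists n.
  have := nP e2 0; have := nP e2 1; rewrite !mxE/= => h1 h2.
  apply: (le_lt_trans (Rcomplex_norm_le _)); rewrite !raddfB /=; lra.
- by move=> x y z; rewrite mulrDl.
- by move=> x y z; rewrite mulrDr.
- move=> [a b] [c d]; rewrite !Rcomplex_normE -sqrtrM ?addr_ge0 ?sqr_ge0//=.
  by congr Num.sqrt; ring.
- move=> u uf.
  have [|a aP] := @real_series_converges R (fun i => complex.Re (u i)).
    apply: le_lt_trans uf; apply: lee_nneseries => i _; rewrite lee_fin//.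
    exact: Re_le_norm.
  have [|b bP] := @real_series_converges R (fun i => complex.Im (u i)).
    apply: le_lt_trans uf; apply: lee_nneseries => i _; rewrite lee_fin//.
    exact: Im_le_norm.
  exists (a +i* b)%C => e e0.
  have e2 : 0 < e / 2 by rewrite divr_gt0.
  have [n1 n1P] := aP _ e2; have [n2 n2P] := bP _ e2; exists (maxn n1 n2) => m.
  rewrite geq_max => /andP[/n1P h1 /n2P h2].
  apply: (le_lt_trans (Rcomplex_norm_le _)).
  rewrite !raddfB !raddf_sum /=; rewrite !sumrN; lra.
Qed.

(* Theorem 3.6, for K = R and for K = C (= Rcomplex R). *)
Theorem theorem3p6 (R : realType) :
  @theorem3p6_claim R (R : normedZmodType R) (fun x y : R => x * y) /\
  @theorem3p6_claim R (Rcomplex R : normedZmodType R) (fun x y : Rcomplex R => x * y).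
Proof.
split; apply: scalar_algebra_claim; first exact: scalar_algebra_real.
exact: scalar_algebra_complex.
Qed.
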